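(* Let $q$ be a power of a prime $p$, let $\ell\ge1$ and $k\ge 1$ be integers, and put $c:=k/q$ and $\gamma:=(\ell-1)/\sqrt q$. Let $\delta_0>0$ be a constant (independent of $k$). Suppose that one of the following two conditions holds: Condition A: $$\frac{p-1}{p}\,c\ln\frac1c+(1-c)\ln\frac1{1-c}-\frac{1+c}{p}\ln(1+c)\ \ge\ \gamma\ln(2p)+\delta_0;$$ Condition B: $p\to\infty$, $\gamma\ge \dfrac{c}{p}$, and $$c\ln\frac1c+(1-c)\ln\frac{1}{1-c}\ \ge\ \gamma+\gamma\ln\frac{c+\gamma}{\gamma}+\delta_0 .$$ Then for all sufficiently large $q$, every monic polynomial $f\in\mathbb F_q[x]$ of degree $k+\ell$ is ordinary for the Reed–Solomon code $\mathcal{RS}_{q,k}$. Consequently no monic polynomial of degree $k+\ell$ is a deep-hole of $\mathcal{RS}_{q,k}$.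
   Context: The (standard) Reed–Solomon code $\mathcal{RS}_{q,k}$ consists of the codewords $(g(x):x\in\mathbb F_q)$, where $g$ ranges over the polynomials over $\mathbb F_q$ of degree less than $k$. A polynomial $f$ represents the received word $(f(x):x\in\mathbb F_q)$. $N(f,r)$ denotes the number of codewords of $\mathcal{RS}_{q,k}$ at Hamming distance exactly $q-r$ from the word represented by $f$. A monic $f$ of degree $k+\ell$ is called a deep-hole if $N(f,r)=0$ for all $r\ge k+1$, and ordinary if $N(f,k+\ell)>0$. (The Deep-Hole Conjecture of Cheng and Murray states that there is no deep-hole when $\ell\ge1$.) The statement concerns sequences of parameters $(q,\ell,k)$ with $q\to\infty$, where $\delta_0$ is fixed along the sequence, and where either every member satisfies the inequality in Condition A, or $p\to\infty$ along the sequence and every member satisfies the two inequalities of Condition B; the conclusion is that it holds for all but finitely large values of $q$ along the sequence, i.e. there is $q_0$ such that it holds for every member with $q\ge q_0$. The conditions presuppose $0<c<1$, so that their expressions are defined. *)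

(* Defs.v *)
From mathcomp Require Import all_boot all_order all_algebra.
From mathcomp Require Import qpoly.
From mathcomp Require Import all_classical all_reals all_analysis.

Set Implicit Arguments.
Unset Strict Implicit.
Unset Printing Implicit Defensive.

Import Order.TTheory GRing.Theory Num.Theory.
Local Open Scope ring_scope.

Section ReedSolomon.
Variable F : finFieldType.

Definition word_of (f : {poly F}) : {ffun F -> F} := [ffun x => f.[x]].

Definition hamming (u v : {ffun F -> F}) : nat := #|[pred x | u x != v x]|.

(* {poly_k F} is the finite type of polynomials of size at most k, i.e. of
   degree less than k. *)
Definition reed_solomon (k : nat) : {set {ffun F -> F}} :=
  [set word_of (polyn g) | g : {poly_k F}]%SET.

(* Distance exactly #|F| - r is written as distance + r = #|F|: truncated
   subtraction would give distance 0 when r exceeds #|F|. *)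
Definition count_at (k : nat) (f : {poly F}) (r : nat) : nat :=
  #|[pred w in reed_solomon k | (hamming w (word_of f) + r == #|F|)%N]|.

Definition deep_hole (k : nat) (f : {poly F}) : Prop :=
  forall r : nat, (k.+1 <= r)%N -> count_at k f r = 0%N.

(* (size f).-1 is deg f, i.e. k + l for f of degree k + l. *)
Definition ordinary (k : nat) (f : {poly F}) : Prop :=
  (0 < count_at k f (size f).-1)%N.

End ReedSolomon.

Section Conditions.
Variable R : realType.

Definition rate (q k : nat) : R := k%:R / q%:R.

Definition gam (q l : nat) : R := (l%:R - 1) / Num.sqrt q%:R.

Definition condA (delta0 : R) (p q l k : nat) : Prop :=
  let c := rate q k in
  let g := gam q l in
  g * ln (2 * p%:R) + delta0 <=
    (p%:R - 1) / p%:R * c * ln (1 / c) + (1 - c) * ln (1 / (1 - c))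
      - (1 + c) / p%:R * ln (1 + c).

(* The two inequalities only; that p tends to infinity is a property of the
   whole sequence of parameters. *)
Definition condB (delta0 : R) (p q l k : nat) : Prop :=
  let c := rate q k in
  let g := gam q l in
  c / p%:R <= g /\
  g + g * ln ((c + g) / g) + delta0 <=
    c * ln (1 / c) + (1 - c) * ln (1 / (1 - c)).

End Conditions.

(* Main.v *)
(* Let m = k + l.  A monic f of degree m is ordinary as soon as some product P of
   m distinct factors X - b has the same l coefficients below the leading one:
   then f - P has degree < k, and its word agrees with that of f exactly at the
   roots of P.  Reversing polynomials, such a P is a set of m elements b of F_q
   with product of the 1 - b x in a prescribed class of the group G of principal
   units modulo x^(l+1), which has q^l elements.

   By orthogonality of the characters of G, the number of these sets is
   C(q, m) / q^l, up to the largest e_m(chi(1 - b x) : b) with chi nontrivial.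
   As G is a p-group, chi^j is nontrivial for p not dividing j; the power sums of
   the numbers chi(1 - b x) are then at most (l - 1) sqrt q by the Weil bound, and
   the trivial bound q is used when p divides j.  By Newton's identities
   e_m(chi) is dominated by the coefficient of T^m in
   (1 - T)^(-(l - 1) sqrt q) (1 - T^p)^(-q / p), hence by
   r^(-m) (1 - r)^(-(l - 1) sqrt q) (1 - r^p)^(-q / p) for every 0 < r < 1.
   With r^p = c / (1 + c) under Condition A and r = c / (c + gamma) under
   Condition B, this is exponentially smaller than C(q, k), whereas all other
   factors are exp(O(sqrt q log q)).

   The Weil bound is proved by Stepanov's method in Bombieri's form.  The Lang
   torsor Z^(q) = (1 - a x) Z of G is a tower of Artin-Schreier extensions of
   K[a], totally ramified at infinity, on which pole orders are explicit.  The
   points over F_(q^n) where the Frobenius acts as g in G are those over the a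
   with norm g of 1 - a x, so that each g is the norm for q^(n - l) +
   O(q^(n / 2)) elements a of F_(q^n).  Thus the power sums of the inverse roots
   of the L-function of chi, a polynomial of degree at most l - 1, are
   O(q^(n / 2)), which forces each of these roots to be at most sqrt q. *)

Require Import Defs.
From HB Require Import structures.
From mathcomp Require Import all_boot all_order all_algebra all_fingroup.
From mathcomp Require Import all_solvable all_field all_character.
From mathcomp Require Import qpoly zify ring.
From mathcomp Require boolp.

Set Implicit Arguments.
Unset Strict Implicit.
Unset Printing Implicit Defensive.

Import GRing.Theory.
Local Open Scope ring_scope.

(** * Pole orders and Stepanov's method *)

Section PoleOrder.
Variables (K : fieldType) (A : comNzRingType) (io : {rmorphism K -> A}).

(* [sz x] is one more than the pole order of [x] at the unique place at
   infinity, with [sz 0 = 0], in analogy with [size] for polynomials. *)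
Record pole_order (sz : A -> nat) : Prop := PoleOrder {
  sz_eq0 : forall x, (sz x == 0%N) = (x == 0);
  szD : forall x y, (sz (x + y)%R <= maxn (sz x) (sz y))%N;
  szM : forall x y, x != 0 -> y != 0 -> sz (x * y) = (sz x + sz y).-1;
  szC : forall c, c != 0 -> sz (io c) = 1%N;
  sz_lead : forall x y, sz x = sz y -> x != 0 ->
    exists c, (sz (x - io c * y)%R < sz x)%N
}.

Variable sz : A -> nat.
Hypothesis szP : pole_order sz.

Lemma sz0 : sz 0 = 0%N.
Proof. by apply/eqP; rewrite (sz_eq0 szP). Qed.

Lemma sz_gt0 x : (0 < sz x)%N = (x != 0).
Proof. by rewrite lt0n (sz_eq0 szP). Qed.

Lemma sz1 : sz 1 = 1%N.
Proof. by have := szC szP (oner_neq0 K); rewrite rmorph1. Qed.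

Lemma sz_mulf_neq0 (x y : A) : x != 0 -> y != 0 -> x * y != 0.
Proof.
move=> x0 y0; rewrite -sz_gt0 (szM szP) //.
by move: x0 y0; rewrite -!sz_gt0; lia.
Qed.

Lemma sz_expf_neq0 (x : A) n : x != 0 -> x ^+ n != 0.
Proof.
by move=> x0; elim: n => [|n IH]; rewrite ?expr0 ?oner_neq0 // exprS sz_mulf_neq0.
Qed.

Lemma szX x n : x != 0 -> sz (x ^+ n) = (n * (sz x).-1).+1.
Proof.
move=> x0; elim: n => [|n IH]; first by rewrite expr0 sz1.
rewrite exprS (szM szP) ?sz_expf_neq0 // IH.
by move: x0; rewrite -sz_gt0; lia.
Qed.

Lemma szM_le x y : (sz (x * y)%R <= (sz x + sz y).-1)%N.
Proof.
case: (eqVneq x 0) => [->|x0]; first by rewrite mul0r sz0.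
case: (eqVneq y 0) => [->|y0]; first by rewrite mulr0 sz0.
by rewrite (szM szP).
Qed.

Lemma szZ c x : c != 0 -> sz (io c * x) = sz x.
Proof.
move=> c0; case: (eqVneq x 0) => [->|x0]; first by rewrite mulr0 sz0.
by rewrite (szM szP) ?(szC szP) // -sz_gt0 (szC szP).
Qed.

Lemma szZ_le c x : (sz (io c * x)%R <= sz x)%N.
Proof.
by case: (eqVneq c 0) => [->|c0]; rewrite ?rmorph0 ?mul0r ?sz0 // szZ.
Qed.

Lemma szN x : sz (- x) = sz x.
Proof.
have : (- 1 : K) != 0 by rewrite oppr_eq0 oner_neq0.
by move=> /(szZ x); rewrite rmorphN rmorph1 mulN1r.
Qed.

Lemma sz_sum_lt (I : Type) (r : seq I) (P : pred I) (F : I -> A) n :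
  (0 < n)%N -> (forall i, P i -> (sz (F i) < n)%N) ->
  (sz (\sum_(i <- r | P i) F i)%R < n)%N.
Proof.
move=> n0 H; elim/big_rec: _ => [|i x Pi Hx]; first by rewrite sz0.
by apply: leq_ltn_trans (szD szP _ _) _; rewrite gtn_max H.
Qed.

Lemma sz_sum_le (I : Type) (r : seq I) (P : pred I) (F : I -> A) n :
  (forall i, P i -> (sz (F i) <= n)%N) ->
  (sz (\sum_(i <- r | P i) F i)%R <= n)%N.
Proof. by move=> H; rewrite -ltnS; apply: sz_sum_lt. Qed.

Lemma sz_prod_le (I : Type) (r : seq I) (P : pred I) (F G : I -> A) :
  (forall i, P i -> G i != 0) ->
  (forall i, P i -> (sz (F i) <= sz (G i))%N) ->
  (sz (\prod_(i <- r | P i) F i)%R <= sz (\prod_(i <- r | P i) G i)%R)%N /\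
  \prod_(i <- r | P i) G i != 0.
Proof.
move=> G0 H; pose Q x y := (sz x <= sz y)%N /\ y != 0.
suff: Q (\prod_(i <- r | P i) F i) (\prod_(i <- r | P i) G i) by [].
elim/big_rec2: _ => [|i x y Pi [le_xy y0]]; first by split; rewrite ?oner_neq0.
split; last by apply: sz_mulf_neq0; rewrite ?G0.
rewrite (szM szP (G0 _ Pi) y0); apply: leq_trans (szM_le _ _) _.
by have := H _ Pi; lia.
Qed.

Lemma sz_exp_le x y n : (sz x <= sz y)%N -> (sz (x ^+ n) <= sz (y ^+ n))%N.
Proof.
move=> le_xy; case: (eqVneq y 0) => [y0|y0].
  suff -> : x = 0 by rewrite y0.
  by apply/eqP; rewrite -(sz_eq0 szP) -leqn0 -sz0 -y0.
case: n => [|n]; first by rewrite !expr0.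
case: (eqVneq x 0) => [->|x0]; first by rewrite expr0n sz0.
by rewrite !szX // ltnS leq_mul2l -!subn1 leq_sub2r.
Qed.

Lemma szDl x y : (sz y < sz x)%N -> sz (x + y) = sz x.
Proof.
move=> lt_yx; apply/eqP; rewrite eqn_leq.
have -> : (sz (x + y)%R <= sz x)%N.
  by apply: leq_trans (szD szP _ _) _; rewrite geq_max leqnn ltnW.
rewrite leqNgt; apply/negP => lt_s.
have : (sz ((x + y) - y)%R < sz x)%N.
  by apply: leq_ltn_trans (szD szP _ _) _; rewrite szN gtn_max lt_s.
by rewrite addrK ltnn.
Qed.

(** Nonzero terms of distinct pole orders cannot cancel, so the dominant one gives the order of the
    sum. Vanishing terms are allowed to repeat. *)
Lemma sz_sum_distinct (I : finType) (F : I -> A) :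
  (forall i j, F i != 0 -> sz (F i) = sz (F j) -> i = j) ->
  (forall i, sz (F i) <= sz (\sum_i F i)%R)%N.
Proof.
move=> inj i1.
case: (arg_maxnP (P := predT) (fun i => sz (F i)) (erefl : predT i1)) => i _ /(_ _ isT) maxi.
apply: leq_trans (maxi i1) _.
case: (eqVneq (F i) 0) => [->|Fi0]; first by rewrite sz0.
rewrite (bigD1 i) //= szDl // sz_sum_lt ?sz_gt0 // => j ji.
rewrite ltn_neqAle (maxi j : _ <= _)%N andbT; apply: contra ji => /eqP e.
by apply/eqP/esym/inj; rewrite ?e.
Qed.

(** Gaussian elimination on pole orders: an element with [sz] equal to [D.+1] is a pivot that lowers
    the others, so the functions with [sz] at most [D] span dimension at most [D]. *)
Lemma sz_lin_dep D m (x : 'I_m -> A) :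
  (D < m)%N -> (forall i, sz (x i) <= D)%N ->
  exists2 y : 'I_m -> K, (exists i, y i != 0) & \sum_i io (y i) * x i = 0.
Proof.
elim: D m x => [|D IH] m x ltDm le_x.
  exists (fun=> 1); first by exists (Ordinal ltDm); rewrite oner_neq0.
  rewrite big1 // => i _; have /eqP -> : x i == 0; last by rewrite mulr0.
  by rewrite -(sz_eq0 szP) -leqn0.
case: (pickP (fun j => sz (x j) == D.+1)) => [j /eqP xj|lex]; last first.
  apply: IH => [|i]; first exact: ltnW.
  by move: (le_x i) (lex i); rewrite leq_eqVlt => /orP[->|].
case: m => [|m] in x ltDm le_x j xj *; first by case: j {xj}.
have c_ex i : exists c, (sz (x (lift j i) - io c * x j)%R <= D)%N.
  case: (eqVneq (sz (x (lift j i))) D.+1) => [e|ne].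
    have [|c] := sz_lead szP (etrans e (esym xj)); first by rewrite -sz_gt0 e.
    by rewrite e; exists c.
  exists 0; rewrite rmorph0 mul0r subr0 -ltnS ltn_neqAle ne /=.
  by apply: le_x.
have [c cP] := fin_all_exists c_ex.
have [y' [i0 yi0] Sy'] := IH m _ ltDm cP.
exists (fun i => if unlift j i is Some i' then y' i' else - \sum_i c i * y' i).
  by exists (lift j i0); rewrite liftK.
rewrite (bigD1_ord j) //= unlift_none -[RHS]Sy'.
rewrite rmorphN rmorph_sum mulNr mulr_suml -sumrN -big_split /=.
by apply: eq_bigr => i _; rewrite liftK rmorphM; ring.
Qed.

Lemma sz_lin_dep_fin D (J : finType) (x : J -> A) :
  (D < #|J|)%N -> (forall i, sz (x i) <= D)%N ->
  exists2 y : J -> K, (exists i, y i != 0) & \sum_i io (y i) * x i = 0.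
Proof.
move=> ltD le_x.
have [y [i yi] Sy] := sz_lin_dep (x := x \o enum_val) ltD (fun i => le_x _).
exists (y \o enum_rank); first by exists (enum_val i); rewrite /= enum_valK.
rewrite (reindex (@enum_val J predT)) /=; last exact/onW_bij/enum_val_bij.
by rewrite -[RHS]Sy; apply: eq_bigr => k _; rewrite enum_valK.
Qed.

End PoleOrder.

(** * Counting zeros and points by Stepanov's method *)

Section Stepanov.
Variables (K : fieldType) (A : comNzRingType) (io : {rmorphism K -> A}).
Variables (sz : A -> nat) (C : nat) (e : nat -> A).
Hypothesis szP : pole_order io sz.
Hypothesis sz_e : forall n, sz (e n) = (n + C).+1.

Let e_neq0 n : e n != 0.
Proof. by rewrite -(sz_gt0 szP) sz_e. Qed.

Variables (I : finType) (phi : I -> {rmorphism A -> K}).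
Hypothesis phi_io : forall i c, phi i (io c) = c.
Hypothesis phi_sep : forall i j, i != j -> exists x, phi i x != phi j x.

Lemma lagrange_points :
  exists eps : I -> A, forall i j, phi i (eps j) = (i == j)%:R.
Proof.
have d_ex ij : exists x, ij.1 != ij.2 -> phi ij.1 x = 0 /\ phi ij.2 x = 1.
  case: (eqVneq ij.1 ij.2) => [_|ne]; first by exists 0.
  have [x nx] := phi_sep ne.
  exists (io (phi ij.2 x - phi ij.1 x)^-1 * (x - io (phi ij.1 x))) => _.
  rewrite !rmorphM !rmorphB /= !phi_io subrr mulr0; split=> //.
  by rewrite mulVf // subr_eq0 eq_sym.
have [d dP] := fin_all_exists d_ex.
exists (fun j => \prod_(i | i != j) d (i, j)) => i j; rewrite rmorph_prod.
case: (eqVneq i j) => [<-|ne].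
  by rewrite big1 // => k ki; have [_] := dP (k, i) ki.
by rewrite (bigD1 i) //=; have [-> _] := dP (i, j) ne; rewrite mul0r.
Qed.

(** A dimension count. With too many points, the multiples [h * e t] and the interpolating functions
    [eps i] would satisfy a linear relation. Evaluation at the points kills the coefficients of the
    [eps i], and the distinct orders of the [h * e t] kill the others. *)
Lemma card_zeros h : h != 0 -> (forall i, phi i h = 0) ->
  (#|I|.+1 <= sz h + C)%N.
Proof.
move=> h0 phih; have [eps epsP] := lagrange_points.
(* [T] is taken past the orders of the [eps i], so that they fit in the space bounding the
   [h * e t]. *)
pose E := (\max_i sz (eps i))%N.
rewrite leqNgt; apply/negP => ltI; pose T := E.+1.
pose x (t : 'I_T + I) := match t with inl t => h * e t | inr i => eps i end.
have [||y [t yt]] := @sz_lin_dep_fin _ _ _ _ szP (sz h + T + C).-1 _ x.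
- by rewrite card_sum card_ord; move: ltI; rewrite -addnS; lia.
- case=> [t|i] /=; last first.
    have : (sz (eps i) <= E)%N by rewrite (leq_bigmax i).
    by rewrite /T; lia.
  rewrite (szM szP) ?e_neq0 // sz_e.
  by have := ltn_ord t; lia.
rewrite big_sumType /= => S0.
have y_inr i : y (inr i) = 0.
  have := congr1 (phi i) S0; rewrite rmorphD !rmorph_sum /= rmorph0.
  rewrite big1 ?add0r => [|k _]; last by rewrite !rmorphM /= phih mul0r mulr0.
  rewrite (bigD1 i) //= rmorphM /= phi_io epsP eqxx mulr1 big1 ?addr0 // => j ji.
  by rewrite rmorphM /= phi_io epsP eq_sym (negPf ji) mulr0.
case: t yt => [t|i]; last by rewrite y_inr eqxx.
move=> yt; move: S0; rewrite [X in _ + X]big1 ?addr0 => [S0|i _]; last first.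
  by rewrite y_inr rmorph0 mul0r.
have nz k : y (inl k) != 0 -> sz (io (y (inl k)) * (h * e k)) = (sz h + k + C)%N.
  move=> yk; rewrite (szZ szP) // (szM szP) // ?sz_e //; lia.
have inj (i j : 'I_T) : io (y (inl i)) * (h * e i) != 0 ->
    sz (io (y (inl i)) * (h * e i)) = sz (io (y (inl j)) * (h * e j)) -> i = j.
  move=> Fi.
  have yi : y (inl i) != 0 by apply: contraNneq Fi => ->; rewrite rmorph0 mul0r.
  case: (eqVneq (y (inl j)) 0) => [->|yj].
    rewrite nz // rmorph0 mul0r (sz0 szP).
    by move: h0; rewrite -(sz_gt0 szP); lia.
  by rewrite !nz // => /eqP; rewrite !eqn_add2r eqn_add2l => /eqP/val_inj.
have := sz_sum_distinct szP inj t; rewrite S0 (sz0 szP) nz //.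
by move: h0; rewrite -(sz_gt0 szP); lia.
Qed.

Variables (M : nat) (e' : nat -> A).
Hypothesis frobD : forall x y : K, (x + y) ^+ M = x ^+ M + y ^+ M.
Hypothesis frob_root : forall y : K, exists x, x ^+ M = y.
Hypothesis sz_e' : forall n, (sz (e' n) <= (n + C).+1)%N.
Hypothesis phi_e' : forall i n, phi i (e n) ^+ (M * M) = phi i (e' n).

(* Stepanov's method in Bombieri's form: the auxiliary function is a nonzero
   [h = \sum x_(t, i) e_t e_i ^ M] whose [M]-th power agrees, at the points where
   the [M ^ 2]-Frobenius is [e |-> e'], with [\sum x_(t, i) ^ M e_t ^ M e'_i];
   the latter lives in a space of dimension smaller than the number of the
   unknown coefficients. *)
Lemma card_points : (3 * C + 3 < M)%N ->
  (#|I| <= M * M + (2 * C + 3) * M + 2 * C)%N.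
Proof.
(* With this [W] the number [M * W] of unknowns exceeds the dimension bound [D] by
   [M - 2 * C - 2]. *)
move=> ltM; pose W := (M + C + 2)%N.
pose x (t : 'I_M * 'I_W) := e t.1 ^+ M * e' t.2.
pose D := (M * (M + C) + W + C)%N.
have M0 : (0 < M)%N by lia.
have [||y [t0 yt0] Sy] := @sz_lin_dep_fin _ _ _ _ szP D _ x.
- rewrite card_prod !card_ord /D /W; nia.
- case=> t i; rewrite /x /=; apply: leq_trans (szM_le szP _ _) _.
  rewrite (szX szP) ?e_neq0 // sz_e.
  have := sz_e' i; have := ltn_ord t; have := ltn_ord i; rewrite /D /=.
  by move: (sz (e' i)) => s iW tM sC; nia.
have frob_sum (J : finType) (F : J -> K) :
    (\sum_j F j) ^+ M = \sum_j F j ^+ M.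
  by apply: (big_morph _ frobD); rewrite expr0n eqn0Ngt M0.
have [r rP] := fin_all_exists (fun t => frob_root (y t)).
pose F (t : 'I_M * 'I_W) := io (r t) * (e t.1 * e t.2 ^+ M).
have em0 (t : 'I_M * 'I_W) : e t.1 * e t.2 ^+ M != 0.
  by rewrite (sz_mulf_neq0 szP) ?(sz_expf_neq0 szP).
have szem (t : 'I_M * 'I_W) :
    sz (e t.1 * e t.2 ^+ M) = (t.1 + C + M * (t.2 + C)).+1.
  rewrite (szM szP) ?(sz_expf_neq0 szP) // (szX szP) // !sz_e /=; lia.
have szF (t : 'I_M * 'I_W) :
    r t != 0 -> sz (F t) = (t.1 + C + M * (t.2 + C)).+1.
  by move=> rt; rewrite (szZ szP).
have r_neq0 t : F t != 0 -> r t != 0.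
  by apply: contraNneq; rewrite /F => ->; rewrite rmorph0 mul0r.
have rt0 : r t0 != 0.
  by move: yt0; rewrite -rP; apply: contraNneq => ->; rewrite expr0n eqn0Ngt M0.
have h0 : \sum_t F t != 0.
  rewrite -(sz_gt0 szP).
  apply: leq_trans (sz_sum_distinct szP _ t0); first by rewrite szF.
  move=> [a b] [c d] /r_neq0 nab; rewrite (szF _ nab).
  case: (eqVneq (r (c, d)) 0) => [z|ncd].
    by rewrite /F z rmorph0 mul0r (sz0 szP).
  (* As [t.1 < M], the order determines [t.1] and [t.2] by division by [M]. *)
  rewrite (szF _ ncd) /= => /eqP; rewrite eqSS => /eqP eq_abcd.
  have eq_ac : a = c :> nat.
    have : (a + M * b = c + M * d)%N by nia.
    move=> /(congr1 (modn^~ M)); rewrite ![(M * _)%N]mulnC ![(_ + _ * M)%N]addnC !modnMDl.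
    by rewrite !modn_small.
  have eq_bd : b = d :> nat.
    have : (M * b = M * d)%N by nia.
    by move/eqP; rewrite eqn_pmul2l // => /eqP.
  by congr (_, _); apply: val_inj.
have phih i : phi i (\sum_t F t) = 0.
  suff /eqP : phi i (\sum_t F t) ^+ M = 0 by rewrite expf_eq0 M0 => /eqP.
  rewrite rmorph_sum frob_sum -[RHS](rmorph0 (phi i)) -Sy rmorph_sum.
  apply: eq_bigr => t _.
  by rewrite /F /x !rmorphM /= !rmorphXn /= !phi_io !exprMn rP -exprM phi_e'.
have szh : (sz (\sum_t F t)%R <= (M + C + M * (W + C)))%N.
  apply: (sz_sum_le szP) => t _.
  apply: leq_trans (szZ_le szP _ _) _; rewrite szem.
  have le_t2 : (M * (t.2 + C) <= M * (W + C))%N by rewrite leq_mul2l leq_add2r ltnW ?orbT.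
  by rewrite -addSn leq_add // -addSn leq_add2r.
have := leq_trans (card_zeros h0 phih) (leq_add szh (leqnn C)).
by rewrite /W; nia.
Qed.

End Stepanov.

(** * The Lang torsor as an Artin-Schreier tower *)

Section ArtinSchreierStep.
Import Pdiv.CommonRing Pdiv.RingMonic.
Variables (K : fieldType) (A : comNzRingType) (io : {rmorphism K -> A}).
Variables (sz : A -> nat) (q d : nat) (c : A).
Hypothesis szP : pole_order io sz.
Hypothesis q_gt1 : (1 < q)%N.
Hypothesis sz_c : sz c = d.+1.
Hypothesis coprime_dq : coprime d q.

Definition as_poly : {poly A} := 'X^q - 'X - c%:P.
Notation h := as_poly.

Let size_low : (size (- 'X - c%:P : {poly A})%R < q.+1)%N.
Proof.
by rewrite -opprD size_polyN size_XaddC.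
Qed.

Lemma size_as_poly : size h = q.+1.
Proof. by rewrite /h -addrA size_polyDl size_polyXn. Qed.

Lemma as_poly_monic : h \is monic.
Proof.
by rewrite monicE /h -addrA lead_coefDl ?size_polyXn // lead_coefXn.
Qed.

Lemma mk_monic_as : mk_monic h = h.
Proof. by rewrite /mk_monic size_as_poly as_poly_monic ltnS (ltnW q_gt1). Qed.

(* The pole order (plus one) of [a y ^ i], where [y] is a root of [h]: pole orders
   of [A] get multiplied by the ramification index [q], and [y] has pole order [d].
   As [d] is prime to [q], the terms with [i < q] never cancel. *)
Definition tw (a : A) i := if a == 0 then 0%N else (q * (sz a).-1 + d * i).+1.

Lemma tw0 i : tw 0 i = 0%N. Proof. by rewrite /tw eqxx. Qed.

Lemma twN a i : tw (- a) i = tw a i.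
Proof. by rewrite /tw oppr_eq0 (szN szP). Qed.

Lemma tw_le a b i : (sz a <= sz b)%N -> (tw a i <= tw b i)%N.
Proof.
move=> le_ab; rewrite /tw; case: eqVneq => // a0.
case: eqVneq => [b0|b0]; first by move: a0; rewrite -(sz_gt0 szP); move: le_ab; rewrite b0 (sz0 szP); lia.
by rewrite ltnS leq_add2r leq_mul2l -!subn1 leq_sub2r ?orbT.
Qed.

Lemma twD a b i : (tw (a + b)%R i <= maxn (tw a i) (tw b i))%N.
Proof.
have := szD szP a b; rewrite leq_max => /orP[] /tw_le H.
  by apply: leq_trans (H i) _; rewrite leq_maxl.
by apply: leq_trans (H i) _; rewrite leq_maxr.
Qed.

Lemma twM a b i j : a != 0 -> b != 0 ->
  tw (a * b) (i + j) = (tw a i + tw b j).-1.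
Proof.
move=> a0 b0; rewrite /tw (negPf a0) (negPf b0) (negPf (sz_mulf_neq0 szP a0 b0)).
rewrite (szM szP) //; move: a0 b0; rewrite -!(sz_gt0 szP).
by case: (sz a) (sz b) => [|m] [|n] //= _ _; rewrite addnS /=; lia.
Qed.

Lemma twM_le a b i j : (tw (a * b)%R (i + j) <= (tw a i + tw b j).-1)%N.
Proof.
case: (eqVneq a 0) => [->|a0]; first by rewrite mul0r tw0.
case: (eqVneq b 0) => [->|b0]; first by rewrite mulr0 tw0.
by rewrite twM.
Qed.

(** Modulo [q] the order is [d * i] with [d] invertible, so it recovers the exponent, and then the
    order of the coefficient. *)
Lemma tw_inj a b i j : a != 0 -> (i < q)%N -> (j < q)%N ->
  tw a i = tw b j -> i = j /\ sz a = sz b.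
Proof.
move=> a0 ltiq ltjq; rewrite {1}/tw (negPf a0) /tw; case: eqVneq => // b0 [e].
have eqm : (i == j %[mod q])%N.
  have : (d * i == d * j %[mod q])%N.
    by apply/eqP; move/(congr1 (modn^~ q)): e; rewrite ![(q * _)%N]mulnC !modnMDl.
  wlog le_ji : i j {a a0 b b0 e} ltiq ltjq / (j <= i)%N => [H|].
    case: (leqP j i) => [/H|/ltnW/H]; first exact.
    by rewrite eq_sym => H' /H' => /(_ ltjq ltiq); rewrite eq_sym.
  rewrite eqn_mod_dvd ?leq_mul2l ?le_ji ?orbT // -mulnBr Gauss_dvdr 1?coprime_sym //.
  by rewrite eqn_mod_dvd.
move: eqm; rewrite !modn_small // => /eqP ij; split=> //.
move: e; rewrite ij => /eqP; rewrite eqn_add2r eqn_pmul2l ?(ltnW q_gt1) //.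
by move: a0 b0; rewrite -!(sz_gt0 szP); lia.
Qed.

(** On reduced representatives this is the pole order; it is defined on all polynomials so as to be
    followed through reduction modulo [h]. *)
Definition wt (P : {poly A}) := (\max_(i < size P) tw P`_i i)%N.

Lemma tw_wt (P : {poly A}) i : (tw P`_i i <= wt P)%N.
Proof.
case: (ltnP i (size P)) => [lti|gei]; last by rewrite nth_default // tw0.
exact: (leq_bigmax (Ordinal lti)).
Qed.

Lemma wt_leP (P : {poly A}) n : (forall i, (tw P`_i i <= n)%N) -> (wt P <= n)%N.
Proof. by move=> H; apply/bigmax_leqP => i _. Qed.

Lemma wtD P Q : (wt (P + Q)%R <= maxn (wt P) (wt Q))%N.
Proof.
apply: wt_leP => i; rewrite coefD; apply: leq_trans (twD _ _ _) _.
by rewrite geq_max !leq_max !tw_wt orbT.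
Qed.

Lemma wtN P : wt (- P) = wt P.
Proof. by rewrite /wt size_polyN; apply: eq_bigr => i _; rewrite coefN twN. Qed.

Lemma wt_eq0 P : (wt P == 0%N) = (P == 0).
Proof.
apply/eqP/eqP => [P0|->]; last first.
  by apply/eqP; rewrite -leqn0; apply: wt_leP => i; rewrite coef0 tw0.
apply/polyP => i; rewrite coef0; have := tw_wt P i.
by rewrite P0 leqn0 /tw; case: (P`_i =P 0).
Qed.

Lemma wt0 : wt 0 = 0%N. Proof. by apply/eqP; rewrite wt_eq0. Qed.

Lemma wt_monom a i : wt (a%:P * 'X^i) = tw a i.
Proof.
apply/eqP; rewrite eqn_leq; apply/andP; split.
  apply: wt_leP => j; rewrite coefCM coefXn.
  by case: eqVneq => [->|_]; rewrite ?mulr1 // mulr0 tw0.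
by have := tw_wt (a%:P * 'X^i) i; rewrite coefCM coefXn eqxx mulr1.
Qed.

Lemma wtM_le P Q : (wt (P * Q)%R <= (wt P + wt Q).-1)%N.
Proof.
apply: wt_leP => i; rewrite coefM.
elim/big_rec: _ => [|j x _ IH]; first by rewrite tw0.
apply: leq_trans (twD _ _ _) _; rewrite geq_max IH andbT.
have le_ji : (j <= i)%N by rewrite -ltnS.
rewrite -[X in tw _ X](subnKC le_ji); apply: leq_trans (twM_le _ _ _ _) _.
by rewrite -!subn1 leq_sub2r // leq_add ?tw_wt.
Qed.

Lemma wt_h : (wt h <= (q * d).+1)%N.
Proof.
have tw1 i : tw 1 i = (d * i).+1 by rewrite /tw oner_eq0 (sz1 szP) muln0.
have wtX n : wt 'X^n = (d * n).+1 by rewrite -tw1 -wt_monom polyC1 mul1r.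
have wtc : wt c%:P = (q * d).+1.
  rewrite -[c%:P]mulr1 -(expr0 'X) wt_monom /tw -(sz_eq0 szP) sz_c /=.
  by rewrite muln0 addn0.
rewrite /h; apply: leq_trans (wtD _ _) _; rewrite geq_max wtN wtc leqnn andbT.
apply: leq_trans (wtD _ _) _; rewrite geq_max wtN -['X]expr1 !wtX.
by rewrite mulnC leqnn ltnS mulnC leq_mul2r (ltnW q_gt1) orbT.
Qed.

(** A division step subtracts a multiple of [h] that cancels the top monomial, and [h] weighs no
    more than [X ^ q], so no step raises the weight. *)
Lemma wt_mod P : (wt (rmodp P h) <= wt P)%N.
Proof.
move: {2}(size P) (leqnn (size P)) => n; elim: n P => [|n IH] P.
  by rewrite leqn0 size_poly_eq0 => /eqP->; rewrite rmod0p.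
rewrite leq_eqVlt => /orP[/eqP szP_n|]; last exact: IH.
case: (ltnP (size P) (size h)) => [ltP|]; first by rewrite rmodp_small.
rewrite szP_n size_as_poly ltnS => le_qn.
pose T := (P`_n)%:P * 'X^(n - q) * h.
have size_PT : (size (P - T)%R <= n)%N.
  apply/leq_sizeP => j le_nj; rewrite coefB /T -mulrA ['X^_ * h]mulrC coefCM coefMXn.
  have -> : (j < n - q)%N = false by move: le_nj; clear; lia.
  rewrite /=.
  case: (ltngtP n j) le_nj => // [lt_nj|<-] _.
    rewrite [P`_j]nth_default ?szP_n // [h`__]nth_default ?mulr0 ?subr0 //.
    by rewrite size_as_poly; move: lt_nj le_qn; clear; lia.
  rewrite subKn // (_ : h`_q = 1) ?mulr1 ?subrr //.
  by have := as_poly_monic; rewrite monicE lead_coefE size_as_poly => /eqP.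
have wtT : (wt T <= wt P)%N.
  apply: leq_trans (wtM_le _ _) _; rewrite wt_monom.
  apply: leq_trans (tw_wt P n); have := wt_h; rewrite /tw.
  have Pn0 : P`_n != 0.
    have := lead_coef_eq0 P; rewrite lead_coefE szP_n /= => ->.
    by rewrite -size_poly_gt0 szP_n.
  rewrite (negPf Pn0) => wth.
  have -> : (d * n = d * (n - q) + q * d)%N.
    by rewrite [(q * d)%N]mulnC -mulnDr subnK.
  by move: (d * (n - q))%N (q * (sz P`_n).-1)%N (q * d)%N (wt h) wth; clear; lia.
rewrite -[P in rmodp P](subrK T) rmodpD ?as_poly_monic // /T rmodp_mull ?as_poly_monic //.
rewrite addr0 -/T; apply: leq_trans (IH _ size_PT) _.
by apply: leq_trans (wtD _ _) _; rewrite wtN geq_max leqnn.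
Qed.

(** By [tw_inj] the monomials of a reduced polynomial have distinct weights, so a single one carries
    the maximum. *)
Lemma lead_term (P : {poly A}) : P != 0 -> (size P <= q)%N ->
  exists i, [/\ P`_i != 0, (i < q)%N, tw P`_i i = wt P &
    (wt (P - (P`_i)%:P * 'X^i)%R < wt P)%N].
Proof.
move=> P0 szPq.
have [|i wtE] := eq_bigmax (fun i : 'I_(size P) => tw P`_i i).
  by rewrite card_ord size_poly_gt0.
have ltiq : (i < q)%N by apply: leq_trans (ltn_ord i) szPq.
have Pi0 : P`_i != 0.
  by apply: contraNneq P0 => e; rewrite -wt_eq0 /wt wtE e tw0.
exists i; split=> //; set Q := P - _; have Qj j : Q`_j = if j == i :> nat then 0 else P`_j.
  rewrite coefB coefCM coefXn; case: eqVneq => [->|_]; first by rewrite mulr1 subrr.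
  by rewrite mulr0 subr0.
case: (eqVneq Q 0) => [->|Q0]; first by rewrite wt0 lt0n wt_eq0.
have le_wt : (wt Q <= wt P)%N.
  by apply: wt_leP => j; rewrite Qj; case: eqP => _; rewrite ?tw0 ?tw_wt.
rewrite ltn_neqAle le_wt andbT; apply/eqP => eqw.
have [|j wtQ] := eq_bigmax (fun j : 'I_(size Q) => tw Q`_j j).
  by rewrite card_ord size_poly_gt0.
move: eqw; rewrite /wt wtE wtQ Qj; case: eqVneq => [_|ne].
  by rewrite tw0 /tw (negPf Pi0).
have ltjq : (j < q)%N.
  rewrite ltnNge; apply/negP => leqj; move: wtQ; rewrite Qj (negPf ne).
  rewrite nth_default ?(leq_trans szPq) // tw0 => /eqP.
  by rewrite -/(wt Q) wt_eq0 (negPf Q0).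
by move/esym/(tw_inj Pi0 ltiq ltjq) => [/esym/eqP]; rewrite (negPf ne).
Qed.

Notation A' := {poly %/ h}.
Definition as_sz (x : A') := wt x.

Lemma size_as_elt (x : A') : (size x <= q)%N.
Proof.
rewrite -ltnS; apply: leq_trans (size_mk_monic x) _.
by rewrite mk_monic_as size_as_poly.
Qed.

Lemma val_asM (x y : A') : x * y = rmodp ((x : {poly A}) * y) h :> {poly A}.
Proof. by rewrite poly_of_qpolyM; congr (rmodp _ _); exact: mk_monic_as. Qed.

Lemma val_as_exp (x : A') n : x ^+ n = rmodp ((x : {poly A}) ^+ n) h :> {poly A}.
Proof. by rewrite poly_of_qpolyX; congr (rmodp _ _); exact: mk_monic_as. Qed.

(** When [i + j] reaches [q], reduction replaces [X ^ q] with [X + c]; the constant [c] weighs as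
    much as [X ^ q], so the full order survives. *)
Lemma wt_mod_monomM a b i j : a != 0 -> b != 0 -> (i < q)%N -> (j < q)%N ->
  wt (rmodp ((a%:P * 'X^i) * (b%:P * 'X^j)) h) = (tw a i + tw b j).-1.
Proof.
move=> a0 b0 ltiq ltjq; apply/eqP; rewrite eqn_leq; apply/andP; split.
  apply: leq_trans (wt_mod _) _; apply: leq_trans (wtM_le _ _) _.
  by rewrite !wt_monom.
have -> : a%:P * 'X^i * (b%:P * 'X^j) = (a * b)%:P * 'X^(i + j).
  by rewrite polyCM exprD; ring.
rewrite -twM //; case: (ltnP (i + j) q) => [lt_ij|le_q].
  rewrite rmodp_small ?wt_monom // size_as_poly ltnS mul_polyC.
  by apply: leq_trans (size_scale_leq _ _) _; rewrite size_polyXn.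
pose m := (i + j - q)%N.
have -> : (a * b)%:P * 'X^(i + j) =
    (a * b)%:P * 'X^m * h + ((a * b)%:P * 'X^(m.+1) + (a * b * c)%:P * 'X^m).
  have -> : 'X^(i + j) = 'X^m * 'X^q :> {poly A} by rewrite -exprD subnK.
  rewrite exprS !polyCM /h; ring.
rewrite rmodp_addl_mul_small ?as_poly_monic //; last first.
  rewrite size_as_poly ltnS; apply: leq_trans (size_polyD _ _) _.
  have lt_mq : (m.+1 < q)%N by rewrite /m; move: ltiq ltjq le_q; clear; lia.
  rewrite geq_max !mul_polyC !(leq_trans (size_scale_leq _ _)) // size_polyXn //.
  exact: ltnW.
apply: leq_trans (tw_wt _ m); rewrite coefD !coefCM !coefXn eqxx ltn_eqF //.
rewrite mulr0 add0r mulr1 -[X in tw _ X](subnK le_q) -/m /tw.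
have c0 : c != 0 by rewrite -(sz_gt0 szP) sz_c.
have ab0 := sz_mulf_neq0 szP a0 b0; have abc0 := sz_mulf_neq0 szP ab0 c0.
rewrite (negPf ab0) (negPf abc0) (szM szP ab0 c0) sz_c !addnS /=.
move: ab0; rewrite -(sz_gt0 szP); case: (sz (a * b)) => // n _.
by rewrite addSn /= !mulnDr [(d * q)%N]mulnC; lia.
Qed.

Lemma wtDl P Q : (wt Q < wt P)%N -> wt (P + Q) = wt P.
Proof.
move=> lt_QP; apply/eqP; rewrite eqn_leq.
have -> : (wt (P + Q)%R <= wt P)%N.
  by apply: leq_trans (wtD _ _) _; rewrite geq_max leqnn ltnW.
rewrite leqNgt; apply/negP => lt_s.
have : (wt ((P + Q) - Q)%R < wt P)%N.
  by apply: leq_ltn_trans (wtD _ _) _; rewrite wtN gtn_max lt_s.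
by rewrite addrK ltnn.
Qed.

Lemma as_szM (x y : A') : x != 0 -> y != 0 ->
  wt (x * y : A') = (wt x + wt y).-1.
Proof.
move=> x0 y0; rewrite val_asM.
have [i [xi ltiq wtx ltx]] := lead_term (x0 : (x : {poly A}) != 0) (size_as_elt x).
have [j [yj ltjq wty lty]] := lead_term (y0 : (y : {poly A}) != 0) (size_as_elt y).
move: (polyn x) (polyn y) xi yj wtx wty ltx lty => P Q xi yj wtx wty.
set r := P - _; set s := Q - _ => ltx lty.
pose L := (P`_i)%:P * 'X^i * s + r * Q.
have -> : P * Q = (P`_i)%:P * 'X^i * ((Q`_j)%:P * 'X^j) + L.
  by rewrite /L /s /r; ring.
have wtL : (wt L < (wt P + wt Q).-1)%N.
  apply: leq_ltn_trans (wtD _ _) _; rewrite gtn_max; apply/andP; split.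
    apply: leq_ltn_trans (wtM_le _ _) _; rewrite wt_monom wtx.
    by move: ltx lty; clear; lia.
  apply: leq_ltn_trans (wtM_le _ _) _.
  by move: ltx lty; clear; lia.
have wtM := wt_mod_monomM xi yj ltiq ltjq; rewrite wtx wty in wtM.
rewrite rmodpD ?as_poly_monic // wtDl wtM //.
exact: leq_ltn_trans (wt_mod _) wtL.
Qed.

Lemma tw_lt a b i : b != 0 -> (sz a < sz b)%N -> (tw a i < tw b i)%N.
Proof.
move=> b0 lt_ab; rewrite /tw (negPf b0); case: eqVneq => // a0.
rewrite ltnS ltn_add2r ltn_mul2l (ltnW q_gt1).
by move: a0 lt_ab; rewrite -(sz_gt0 szP); lia.
Qed.

Definition as_io : {rmorphism K -> A'} := qpolyC h \o io.

Lemma val_as_ioM k (x : A') : as_io k * x = (io k)%:P * (x : {poly A}) :> {poly A}.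
Proof.
rewrite val_asM rmodp_small // size_as_poly ltnS mul_polyC.
exact: leq_trans (size_scale_leq _ _) (size_as_elt x).
Qed.

Lemma wtC k : wt (io k)%:P = (k != 0).
Proof.
rewrite -[_%:P]mulr1 -(expr0 'X) wt_monom /tw -(sz_eq0 szP) muln0 addn0.
case: (eqVneq k 0) => [->|k0]; first by rewrite rmorph0 (sz0 szP).
by rewrite (szC szP) // muln0.
Qed.

Lemma as_sz_pole_order : pole_order as_io as_sz.
Proof.
split.
- by move=> x; rewrite /as_sz wt_eq0.
- by move=> x y; apply: wtD.
- exact: as_szM.
- by move=> k k0; rewrite /as_sz wtC k0.
move=> x y eq_xy x0; rewrite /as_sz in eq_xy *.
have y0 : y != 0.
  have : (y : {poly A}) != 0 by rewrite -wt_eq0 -eq_xy wt_eq0.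
  by [].
have [i [xi ltiq wtx ltx]] := lead_term (x0 : (x : {poly A}) != 0) (size_as_elt x).
have [j [yj ltjq wty lty]] := lead_term (y0 : (y : {poly A}) != 0) (size_as_elt y).
have [|ij sz_xy] := tw_inj (b := (y : {poly A})`_j) xi ltiq ltjq.
  by rewrite wtx wty.
have [k ltk] := sz_lead szP sz_xy xi; exists k.
rewrite [X in (X < _)%N](_ : _ = wt ((x : {poly A}) - (io k)%:P * y)); last first.
  by rewrite -val_as_ioM.
move: (polyn x) (polyn y) xi yj wtx wty ltx lty ltk eq_xy {sz_xy} => P Q xi yj wtx wty ltx lty ltk eq_xy.
have -> : P - (io k)%:P * Q = ((P`_i - io k * Q`_j)%:P * 'X^i) +
    ((P - (P`_i)%:P * 'X^i) - (io k)%:P * (Q - (Q`_j)%:P * 'X^j)).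
  by rewrite -ij polyCB polyCM; ring.
apply: leq_ltn_trans (wtD _ _) _; rewrite wt_monom gtn_max -[X in (_ < X)%N]wtx tw_lt //=.
apply: leq_ltn_trans (wtD _ _) _; rewrite gtn_max ltx wtN /=.
apply: leq_ltn_trans (wtM_le _ _) _; rewrite wtC eq_xy.
by apply: leq_ltn_trans lty; case: (k != 0); rewrite ?add1n ?add0n ?leq_pred.
Qed.

Lemma val_asX : qpolyX h = 'X :> {poly A}.
Proof. by rewrite qpolyXE ?as_poly_monic // size_as_poly ltnS. Qed.

Lemma as_sz_monom a i : (i < q)%N -> a != 0 ->
  as_sz (qpolyC h a * qpolyX h ^+ i) = (q * (sz a).-1 + d * i).+1.
Proof.
move=> ltiq a0; rewrite /as_sz val_asM val_as_exp val_asX.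
rewrite (@rmodp_small _ 'X^i) ?size_polyXn ?size_as_poly // rmodp_small.
  by rewrite wt_monom /tw (negPf a0).
rewrite size_as_poly ltnS mul_polyC.
by apply: leq_trans (size_scale_leq _ _) _; rewrite size_polyXn.
Qed.

Lemma as_szC a : a != 0 -> as_sz (qpolyC h a) = (q * (sz a).-1).+1.
Proof. by move=> a0; rewrite -[qpolyC h a]mulr1 -(expr0 (qpolyX h)) as_sz_monom ?muln0 ?addn0 ?(ltnW q_gt1). Qed.

(** Evaluation at a root of the specialised Artin-Schreier equation kills [h], hence passes to the
    quotient: points of the base lift to the cover. *)
Lemma as_hom (phi : {rmorphism A -> K}) eta : eta ^+ q - eta = phi c ->
  exists psi : {rmorphism A' -> K},
    (forall a, psi (qpolyC h a) = phi a) /\ psi (qpolyX h) = eta.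
Proof.
move=> eta_eq; pose f (x : A') := (map_poly phi x).[eta].
have fB : zmod_morphism f.
  by move=> x y; rewrite /f rmorphB hornerD hornerN.
have hh : (map_poly phi h).[eta] = 0.
  by rewrite /h !rmorphB /= map_polyXn map_polyX map_polyC /= !hornerE eta_eq subrr.
have fM : monoid_morphism f.
  split; first by rewrite /f rmorph1 hornerC.
  move=> x y; rewrite /f val_asM -hornerM -rmorphM.
  rewrite [in RHS](rdivp_eq as_poly_monic (_ * _)) rmorphD rmorphM hornerD hornerM hh.
  by rewrite mulr0 add0r.
pose psi : {rmorphism A' -> K} := HB.pack f
  (GRing.isZmodMorphism.Build A' K f fB) (GRing.isMonoidMorphism.Build A' K f fM).
exists psi; split=> [a|]; rewrite /= /f; first by rewrite map_polyC hornerC.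
by rewrite val_asX map_polyX hornerX.
Qed.

End ArtinSchreierStep.

Definition geom (q j : nat) : nat := \sum_(i < j) q ^ i.

Lemma geomS q j : geom q j.+1 = (geom q j + q ^ j)%N.
Proof. by rewrite /geom big_ord_recr. Qed.

Lemma geomSl q j : geom q j.+1 = (q * geom q j).+1.
Proof.
rewrite /geom big_ord_recl expn0 big_distrr /= add1n.
by congr _.+1; apply: eq_bigr => i _; rewrite expnS.
Qed.

(** By Bezout, [i] is the residue of [n / d] modulo [q]. The middle inequality keeps [v] large along
    with [n], as the induction on the tower requires. *)
Lemma coprime_representation d q n : (1 < q)%N -> coprime d q ->
  (d * q <= n)%N -> exists i v, [/\ (i < q)%N, (n <= q * v + d * q)%N & n = (q * v + d * i)%N].
Proof.
move=> q1 cdq le_n; case: (posnP d) => [d0|d_gt0].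
  by move: cdq q1; rewrite d0 /coprime gcd0n => /eqP->.
have /(coprimeP q d_gt0)[[u v] /= uv] := cdq.
have du : (d * (u * n) = n + (v * n) * q)%N.
  have : (u * d = 1 + v * q)%N by lia.
  by move/(congr1 (muln n)); lia.
pose i := ((u * n) %% q)%N.
have lt_iq : (i < q)%N by rewrite ltn_pmod // ltnW.
have le_di : (d * i <= n)%N by apply: leq_trans le_n; rewrite leq_mul2l ltnW ?orbT.
have : (d * i == n %[mod q])%N by rewrite modnMmr du addnC modnMDl.
rewrite eq_sym eqn_mod_dvd // => /dvdnP[w nw].
exists i, w; split=> //; last by rewrite mulnC -nw subnK.
have : (d * i <= d * q)%N by rewrite leq_mul2l ltnW ?orbT.
by rewrite [(q * w)%N]mulnC -nw; lia.
Qed.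

(* The Lang torsor [Z^(q) = (1 - a x) Z] of the group of principal units
   modulo [x ^ l.+1], with [Z = 1 + z_1 x + ... + z_l x ^ l]: a tower of
   Artin-Schreier extensions of [K[a]] that is totally ramified at infinity. *)
Lemma lang_tower (K : fieldType) (q : nat) (q_gt1 : (1 < q)%N) (l : nat) :
  exists (A : comNzRingType) (io : {rmorphism K -> A}) (sz : A -> nat)
    (a : A) (z : nat -> A) (C : nat),
  [/\ pole_order io sz, z 0%N = 1, sz a = (q ^ l).+1 &
  [/\ forall j, (j <= l)%N -> sz (z j) = (q ^ (l - j) * geom q j).+1,
      forall n, (C <= n)%N -> exists (e0 : nat) (e : nat -> nat),
        sz (a ^+ e0 * \prod_(j < l) z j.+1 ^+ e j) = n.+1 &
      forall (alpha : K) (zeta : nat -> K), zeta 0%N = 1 ->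
        (forall j, (j < l)%N -> zeta j.+1 ^+ q - zeta j.+1 = - (alpha * zeta j)) ->
        exists phi : {rmorphism A -> K},
          [/\ forall c, phi (io c) = c, phi a = alpha &
              forall j, (j <= l)%N -> phi (z j) = zeta j]]].
Proof.
elim: l => [|l [A [io [sz [a [z [C [szP z0 sz_a [sz_z szC hom]]]]]]]]].
  exists {poly K}, (@polyC K), (fun p : {poly K} => size p), 'X, (fun=> 1), 0%N.
  split=> //; first split.
  - by move=> x; rewrite size_poly_eq0.
  - by move=> x y; apply: size_polyD.
  - by move=> x y x0 y0; rewrite size_mul.
  - by move=> c c0; rewrite size_polyC c0.
  - move=> x y eq_xy x0; have y0 : y != 0 by rewrite -size_poly_gt0 -eq_xy size_poly_gt0.
    exists (lead_coef x / lead_coef y).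
    have := x0; rewrite -size_poly_gt0; case E : (size x) => [|n] // _.
    rewrite ltnS; apply/leq_sizeP => j; rewrite leq_eqVlt coefB coefCM => /orP[/eqP<-|ltnj].
      rewrite !lead_coefE -eq_xy E /= divfK ?subrr //.
      by move: y0; rewrite -lead_coef_eq0 lead_coefE -eq_xy E.
    by rewrite !nth_default ?mulr0 ?subr0 // -?eq_xy E.
  - by rewrite size_polyX.
  split.
  - by move=> j; rewrite leqn0 => /eqP->; rewrite size_poly1 /geom big_ord0 muln0.
  - by move=> n _; exists n, (fun=> 0%N); rewrite big_ord0 mulr1 size_polyXn.
  move=> alpha zeta zeta0 _.
  exists (horner_eval alpha : {rmorphism {poly K} -> K}); split=> [c||j].
  - by rewrite /= /horner_eval hornerC.
  - by rewrite /= /horner_eval hornerX.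
  by rewrite leqn0 => /eqP->; rewrite rmorph1 zeta0.
have a0 : a != 0 by rewrite -(sz_gt0 szP) sz_a.
have zl0 : z l != 0 by rewrite -(sz_gt0 szP) sz_z.
(* The coefficient of [x ^ l.+1] in the torsor equation is [z_(l+1)^q - z_(l+1) = - a z_l]. The
   right side has pole order [geom q l.+1], which is 1 modulo [q], whence total ramification. *)
pose c := - (a * z l); pose d := geom q l.+1.
have sz_c : sz c = d.+1.
  rewrite (szN szP) (szM szP) // sz_a sz_z // subnn mul1n /d geomS.
  by rewrite addnS /= addSn addnC.
have cdq : coprime d q by rewrite /d geomSl -addn1 mulnC coprime_sym /coprime gcdnMDl gcdn1.
pose h := as_poly q c.
pose z' j := if (j <= l)%N then qpolyC h (z j) else qpolyX h.
have z'l : z' l.+1 = qpolyX h by rewrite /z' ltnn.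
have z'E j : (j <= l)%N -> z' j = qpolyC h (z j) by rewrite /z' => ->.
have szC' x : x != 0 -> as_sz sz d (qpolyC h x : {poly %/ h}) = (q * (sz x).-1).+1.
  exact: as_szC.
exists {poly %/ h}, (as_io io q c), (as_sz sz d (c := c) (q := q)), (qpolyC h a), z', (q * C + d * q)%N.
split.
- exact: as_sz_pole_order.
- by rewrite z'E // z0 rmorph1.
- by rewrite szC' // sz_a expnS.
split.
- move=> j; rewrite leq_eqVlt => /orP[/eqP->|]; last rewrite ltnS => lejl.
    rewrite z'l subnn mul1n -/d -[qpolyX h]mul1r -(rmorph1 (qpolyC h)) -[qpolyX h]expr1.
    by rewrite as_sz_monom ?oner_neq0 // (sz1 szP) muln0 muln1.
  rewrite z'E // szC'; last by rewrite -(sz_gt0 szP) sz_z.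
  by rewrite sz_z //= subSn // expnS mulnA.
- move=> n le_n.
  (* The exponent [i] of the new coordinate fixes the order modulo [q]; the rest of the order is
     realised one level below. *)
  have [|i [v [lt_iq le_v n_eq]]] := coprime_representation (n := n) q_gt1 cdq.
    by apply: leq_trans le_n; rewrite leq_addl.
  have leCv : (C <= v)%N.
    have : (q * C <= q * v)%N by move: le_n le_v; lia.
    by rewrite leq_pmul2l // ltnW.
  have [e0 [e sz_e]] := szC v leCv.
  exists e0, (fun j => if (j < l)%N then e j else i).
  rewrite big_ord_recr /= ltnn z'l mulrA.
  rewrite [_ * \prod_(_ < _) _](_ : _ = qpolyC h (a ^+ e0 * \prod_(j < l) z j.+1 ^+ e j)).
    rewrite as_sz_monom //; last by rewrite -(sz_gt0 szP) sz_e.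
    by rewrite sz_e n_eq.
  rewrite rmorphM rmorphXn rmorph_prod; congr (_ * _); apply: eq_bigr => j _.
  by rewrite z'E //= ltn_ord rmorphXn.
move=> alpha zeta zeta0 zetaP.
have [|phi [phi_io phi_a phi_z]] := hom alpha zeta zeta0.
  by move=> j ltjl; apply: zetaP; apply: leqW.
have [|psi [psiC psiX]] := as_hom (q_gt1) (phi := phi) (c := c) (eta := zeta l.+1).
  by rewrite zetaP // rmorphN rmorphM /= phi_a phi_z.
exists psi; split=> [k||j]; first by rewrite /= psiC.
  by rewrite psiC.
rewrite leq_eqVlt => /orP[/eqP->|]; first by rewrite z'l.
by rewrite ltnS => lejl; rewrite z'E // psiC phi_z.
Qed.

(** * Points of the torsor with a prescribed Frobenius action *)

Section ConjugatesCount.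
Variables (F : finFieldType) (p e : nat) (K : closedFieldType).
Variable emb : {rmorphism F -> K}.
Hypothesis p_prime : prime p.
Hypothesis cardF : #|F| = (p ^ e)%N.
Notation q := #|F|.

Lemma q_gt1 : (1 < q)%N.
Proof. exact: finNzRing_gt1. Qed.

Lemma expq_gt0 n : (0 < q ^ n)%N.
Proof. by rewrite expn_gt0 (ltnW q_gt1). Qed.

Lemma pchar_closed : p \in [pchar K].
Proof.
have : p \in [pchar F] by apply: (card_finPcharP cardF).
exact: rmorph_pchar.
Qed.

Lemma frobD n (x y : K) : (x + y) ^+ (q ^ n) = x ^+ (q ^ n) + y ^+ (q ^ n).
Proof.
apply: exprDn_pchar; rewrite cardF -expnM.
rewrite (eq_pnat _ (pcharf_eq pchar_closed)) pnatX pnat_id //.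
Qed.

Lemma frob_root n (y : K) : exists x, x ^+ (q ^ n) = y.
Proof.
have /closed_rootP[x] : size ('X^(q ^ n) - y%:P) != 1%N.
  by rewrite size_XnsubC ?expq_gt0 // eqSS -lt0n expq_gt0.
by rewrite /root !hornerE subr_eq0 => /eqP; exists x.
Qed.

Lemma frob_emb n (c : F) : emb c ^+ (q ^ n) = emb c.
Proof.
rewrite -rmorphXn; congr (emb _); elim: n => [|n IH]; first by rewrite expr1.
by rewrite expnS exprM expf_card.
Qed.

Lemma as_root_ex (c : K) : exists x, x ^+ q - x == c.
Proof.
have /closed_rootP[x] : size ('X^q - 'X - c%:P) != 1%N.
  by rewrite -/(as_poly q c) size_as_poly ?q_gt1 // eqSS -lt0n (ltnW q_gt1).
by rewrite /root !hornerE subr_eq0 => e0; exists x.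
Qed.

(* The points of the Lang torsor over [a], parametrised by [w]. *)
Fixpoint lang_point (a : K) (w : seq F) (j : nat) : K :=
  if j is j'.+1 then xchoose (as_root_ex (- (a * lang_point a w j'))) + emb w`_j'
  else 1.

Lemma lang_pointP a w j :
  lang_point a w j.+1 ^+ q - lang_point a w j.+1 = - (a * lang_point a w j).
Proof.
rewrite /=; case: (xchooseP (as_root_ex (- (a * lang_point a w j)))) => /eqP.
set x := xchoose _ => <-; have := frobD 1 x (emb w`_j).
by rewrite (frob_emb 1) expn1 => ->; ring.
Qed.

Lemma lang_point_inj a (l : nat) (w w' : l.-tuple F) :
  (forall j, (j <= l)%N -> lang_point a w j = lang_point a w' j) -> w = w'.
Proof.
move=> eq_ww'; apply/val_inj/(@eq_from_nth _ 0); rewrite ?size_tuple // => j ltj.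
have := eq_ww' j.+1 ltj; rewrite /= eq_ww' ?(ltnW ltj) // => /addrI.
exact: fmorph_inj.
Qed.

(* The [n]-th power of Frobenius acts on the fibre of the torsor over [a] as
   multiplication by the power series with coefficients [g]. *)
Definition frob_class (l n : nat) (g : nat -> F) (a : K) : Prop :=
  forall zeta : nat -> K, zeta 0%N = 1 ->
    (forall j, zeta j.+1 ^+ q - zeta j.+1 = - (a * zeta j)) ->
    forall j, (j <= l)%N ->
      zeta j ^+ (q ^ n) = \sum_(i < j.+1) emb (g i) * zeta (j - i)%N.

(** The pole orders of the [z_i] do not decrease, so a combination of [z_0, ..., z_j] has at most
    the order of [z_j]. *)
Lemma geom_mono l j i : (i <= j <= l)%N ->
  (q ^ (l - i) * geom q i <= q ^ (l - j) * geom q j)%N.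
Proof.
case/andP; elim: j => [|j IH]; first by rewrite leqn0 => /eqP->.
rewrite leq_eqVlt => /orP[/eqP->//|]; rewrite ltnS => le_ij lt_jl.
apply: leq_trans (IH le_ij (ltnW lt_jl)) _; rewrite geomSl.
rewrite -(subnSK lt_jl) expnS; move: (q ^ _)%N (geom q j) => u v.
by rewrite -[X in (X * v)%N]mulnC -mulnA leq_mul2l leqnSn orbT.
Qed.

(** Stepanov's bound with [M = q ^ s], for the [q ^ l] points of the torsor over each [a] in [r].
    The functions are monomials in [a] and the [z_j]; at these points Frobenius replaces [z_j] with
    the combination [gz j] given by [g], whose pole order is no larger. *)
Lemma card_frob_class (l : nat) : exists C, forall s, (C < q ^ s)%N ->
  forall (g : nat -> F) (r : seq K), uniq r ->
    (forall a, a \in r -> a ^+ (q ^ (s + s)) = a) ->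
    (forall a, a \in r -> frob_class l (s + s) g a) ->
    (size r * q ^ l <= q ^ (s + s) + C * q ^ s)%N.
Proof.
have [A [io [sz [a [z [C [szP z0 sz_a [sz_z szC hom]]]]]]]] := lang_tower K q_gt1 l.
(* This constant absorbs [(2 * C + 3) * M + 2 * C] into a multiple of [M], and makes [M] exceed
   [3 * C + 3]. *)
exists (4 * C + 3)%N => s ltCs g r uniq_r r_fix r_class.
have e_ex n : exists ee : nat * (nat -> nat),
    sz (a ^+ ee.1 * \prod_(j < l) z j.+1 ^+ ee.2 j) = (n + C).+1.
  by have [e0 [e' sz_e]] := szC (n + C)%N (leq_addl _ _); exists (e0, e').
have [ee sz_ee] := boolp.choice e_ex.
pose en n := a ^+ (ee n).1 * \prod_(j < l) z j.+1 ^+ (ee n).2 j.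
have a0 : a != 0 by rewrite -(sz_gt0 szP) sz_a.
have z_neq0 j : (j <= l)%N -> z j != 0 by move=> lejl; rewrite -(sz_gt0 szP) sz_z.
pose gz j := \sum_(i < j.+1) io (emb (g i)) * z (j - i)%N.
pose en' n := a ^+ (ee n).1 * \prod_(j < l) gz j.+1 ^+ (ee n).2 j.
have sz_gz j : (j <= l)%N -> (sz (gz j) <= sz (z j))%N.
  move=> lejl; apply: (sz_sum_le szP) => i _.
  apply: leq_trans (szZ_le szP _ _) _.
  by rewrite !sz_z ?(leq_trans (leq_subr _ _)) // ltnS geom_mono // leq_subr.
have sz_en' n : (sz (en' n) <= (n + C).+1)%N.
  rewrite -sz_ee; apply: leq_trans (szM_le szP _ _) _.
  have [le_prod prod0] := sz_prod_le szP (index_enum 'I_l) (P := predT)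
    (F := fun j => gz j.+1 ^+ (ee n).2 j) (G := fun j => z j.+1 ^+ (ee n).2 j)
    (fun j _ => sz_expf_neq0 szP _ (z_neq0 _ (ltn_ord j)))
    (fun j _ => sz_exp_le szP _ (sz_gz _ (ltn_ord j))).
  rewrite [X in (_ <= X)%N](szM szP) ?(sz_expf_neq0 szP) //.
  by rewrite -!subn1 leq_sub2r // leq_add2l.
pose I := ('I_(size r) * l.-tuple F)%type.
pose pt (i : I) := lang_point (r`_i.1) i.2.
have phi_ex (i : I) : exists phi : {rmorphism A -> K},
    [/\ forall c, phi (io c) = c, phi a = r`_i.1 &
        forall j, (j <= l)%N -> phi (z j) = pt i j].
  by apply: hom => // j _; apply: lang_pointP.
have [phi phiP] := fin_all_exists phi_ex.
have r_i (i : I) : r`_i.1 \in r by rewrite mem_nth.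
have phi_io i c : phi i (io c) = c by have [-> _ _] := phiP i.
have phi_sep i i' : i != i' -> exists x, phi i x != phi i' x.
  move=> ne.
  case: (eqVneq (phi i a) (phi i' a)) => [eq_a|]; last by exists a.
  case: (pickP (fun j : 'I_l.+1 => phi i (z j) != phi i' (z j))) => [j|eq_z].
    by exists (z j).
  have [_ ia iz] := phiP i; have [_ i'a i'z] := phiP i'.
  move: eq_a; rewrite ia i'a => /eqP; rewrite nth_uniq // => /eqP/val_inj eq_ii'.
  case/eqP: ne; case: i i' eq_ii' iz i'z eq_z {ia i'a} => [i w] [i' w'] /= <- iz i'z eq_z.
  congr (_, _); apply: (@lang_point_inj (r`_i)) => j lejl.
  have := eq_z (Ordinal (lejl : (j < l.+1)%N)) => /negbFE/eqP.
  by rewrite /= iz // i'z.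
have phi_en i n : phi i (en n) ^+ (q ^ s * q ^ s) = phi i (en' n).
  have [_ phi_a phi_z] := phiP i.
  rewrite -expnD /en /en' !rmorphM !rmorphXn !rmorph_prod exprMn -exprM mulnC exprM.
  rewrite phi_a (r_fix _ (r_i i)); congr (_ * _).
  rewrite -prodrXl; apply: eq_bigr => j _; rewrite !rmorphXn exprAC.
  congr (_ ^+ _); rewrite phi_z // (r_class _ (r_i i)) //; last exact: lang_pointP.
  rewrite rmorph_sum; apply: eq_bigr => k _.
  by rewrite rmorphM phi_io phi_z // (leq_trans (leq_subr _ _)).
have := card_points szP sz_ee phi_io phi_sep (frobD s) (frob_root s) sz_en' phi_en.
rewrite card_prod card_ord card_tuple -expnD => H.
apply: leq_trans (H _) _; move: ltCs; move: (q ^ s)%N (q ^ _)%N => u v; clear; nia.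
Qed.

End ConjugatesCount.

(** * Reciprocal polynomials *)

Section Reversal.
Variable R : comNzRingType.

(** This is [X^n P(1 / X)], relative to a prescribed [n] rather than to the degree of [P];
    coefficients beyond [n] are dropped. *)
Definition rev_poly (n : nat) (P : {poly R}) : {poly R} :=
  \sum_(i < n.+1) P`_i *: 'X^(n - i).

Lemma coef_rev_poly n P i : (rev_poly n P)`_i = if (i <= n)%N then P`_(n - i) else 0.
Proof.
rewrite /rev_poly coef_sum; case: leqP => [le_in|lt_ni].
  have lt_i : (n - i < n.+1)%N by rewrite ltnS leq_subr.
  rewrite (bigD1 (Ordinal lt_i)) //= coefZ coefXn subKn // eqxx mulr1.
  rewrite big1 ?addr0 // => j ne; rewrite coefZ coefXn.
  case: eqP => [e|]; last by rewrite mulr0.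
  by case/eqP: ne; apply: val_inj; rewrite /= e subKn // -ltnS.
rewrite big1 // => j _; rewrite coefZ coefXn.
by case: eqP => [e|]; rewrite ?mulr0 //; move: lt_ni; rewrite e ltnNge leq_subr.
Qed.

Lemma rev_polyD n P Q : rev_poly n (P + Q) = rev_poly n P + rev_poly n Q.
Proof. by rewrite -big_split; apply: eq_bigr => i _; rewrite coefD scalerDl. Qed.

Lemma rev_poly_sum n (I : finType) (P : I -> {poly R}) :
  rev_poly n (\sum_i P i) = \sum_i rev_poly n (P i).
Proof.
apply: (big_morph _ (rev_polyD n)).
by rewrite /rev_poly big1 // => i _; rewrite coef0 scale0r.
Qed.

Lemma rev_polyZXn n c i : (i <= n)%N -> rev_poly n (c *: 'X^i) = c *: 'X^(n - i).
Proof.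
move=> le_in; apply/polyP => j; rewrite coef_rev_poly !coefZ !coefXn.
case: leqP => [le_jn|lt_nj]; last first.
  by rewrite gtn_eqF ?mulr0 // (leq_ltn_trans (leq_subr _ _)).
by congr (c * _%:R); congr nat_of_bool; apply/eqP/eqP; lia.
Qed.

Lemma size_le_sum n (P : {poly R}) : (size P <= n)%N -> P = \sum_(i < n) P`_i *: 'X^i.
Proof.
move=> le_n; rewrite -poly_def; apply/polyP => i; rewrite coef_poly.
by case: ltnP => // le_ni; rewrite nth_default // (leq_trans le_n).
Qed.

Lemma rev_polyM m n (P Q : {poly R}) : (size P <= m.+1)%N -> (size Q <= n.+1)%N ->
  rev_poly (m + n) (P * Q) = rev_poly m P * rev_poly n Q.
Proof.
move=> leP leQ; rewrite {1}(size_le_sum leP) {1}(size_le_sum leQ).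
rewrite mulr_suml rev_poly_sum mulr_suml; apply: eq_bigr => i _.
rewrite !mulr_sumr rev_poly_sum; apply: eq_bigr => j _.
have [lei lej] : (i <= m /\ j <= n)%N by split; rewrite -ltnS ltn_ord.
rewrite -!scalerAl -!scalerAr !scalerA -!exprD rev_polyZXn ?leq_add //.
by congr (_ *: 'X^_); lia.
Qed.

End Reversal.

(** * Points of the torsor and the von Mangoldt weight *)

Section Conjugates.
Variables (F : finFieldType) (p e : nat) (K : closedFieldType).
Variable emb : {rmorphism F -> K}.
Hypothesis p_prime : prime p.
Hypothesis cardF : #|F| = (p ^ e)%N.
Notation q := #|F|.
Let frobD := frobD emb p_prime cardF.

Lemma frobN t (x : K) : (- x) ^+ (q ^ t) = - x ^+ (q ^ t).
Proof.
by apply/eqP; rewrite -addr_eq0 -frobD addNr expr0n eqn0Ngt expq_gt0.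
Qed.

Definition conj_poly (n : nat) (a : K) : {poly K} :=
  \prod_(i < n) ('X - (a ^+ (q ^ i))%:P).

Lemma conj_poly_monic n a : conj_poly n a \is monic.
Proof. exact: monic_prod_XsubC. Qed.

Lemma size_conj_poly n a : size (conj_poly n a) = n.+1.
Proof. by rewrite /conj_poly size_prod_XsubC /index_enum -enumT size_enum_ord. Qed.

Lemma conj_polyD m n a : conj_poly (m + n) a = conj_poly m a * conj_poly n (a ^+ (q ^ m)).
Proof.
rewrite /conj_poly big_split_ord /=; congr (_ * _); apply: eq_bigr => i _.
by rewrite -exprM -expnD.
Qed.

(** Iterating [Z^(q) = (1 - a x) Z] multiplies [Z] by the product of the [1 - a^(q^i) x] for
    [i < n], which is the reversal of [conj_poly n a]. *)
Lemma frob_class_conj l n a (g : nat -> F) :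
  (forall i, emb (g i) = (rev_poly n (conj_poly n a))`_i) -> frob_class emb l n g a.
Proof.
move=> gP zeta zeta0 zetaP j _.
have zetaS t i : zeta i.+1 ^+ (q ^ t.+1) =
    zeta i.+1 ^+ (q ^ t) - a ^+ (q ^ t) * zeta i ^+ (q ^ t).
  have := zetaP i => /eqP; rewrite subr_eq => /eqP zi.
  by rewrite expnS exprM zi frobD addrC frobN exprMn.
under eq_bigr do rewrite gP.
elim: n j {gP} => [|n IH] j.
  rewrite expr1 /conj_poly big_ord0 big_ord_recl big1 => [|i _].
    by rewrite coef_rev_poly coef1 mul1r addr0 subn0.
  by rewrite coef_rev_poly mul0r.
have rev_conj : rev_poly n.+1 (conj_poly n.+1 a) =
    rev_poly n (conj_poly n a) * (1 - a ^+ (q ^ n) *: 'X).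
  rewrite -addn1 conj_polyD rev_polyM ?size_conj_poly //; congr (_ * _).
  rewrite /conj_poly big_ord1 expr1; apply/polyP => i.
  rewrite coef_rev_poly !coefB coefZ !coefX coefC coef1.
  by case: i => [|[|i]] //=; rewrite ?mulr0 ?mulr1 ?subr0 // sub0r.
case: j => [|j].
  rewrite zeta0 expr1n big_ord1 coef_rev_poly /= subn0 ?zeta0 mulr1.
  have := conj_poly_monic n.+1 a.
  by rewrite monicE lead_coefE size_conj_poly => /eqP.
rewrite zetaS !IH rev_conj mulrBr mulr1 -scalerAr.
rewrite [in RHS](eq_bigr (fun i : 'I_j.+2 =>
    (rev_poly n (conj_poly n a))`_i * zeta (j.+1 - i)%N
    - a ^+ (q ^ n) * ((rev_poly n (conj_poly n a) * 'X)`_i * zeta (j.+1 - i)%N))); last first.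
  by move=> i _; rewrite coefB coefZ mulrBl mulrA.
rewrite sumrB -mulr_sumr; congr (_ - _ * _).
rewrite [RHS]big_ord_recl coefMX mul0r add0r; apply: eq_bigr => i _.
by rewrite coefMX /= subSS.
Qed.

End Conjugates.

(** * Frobenius orbits and multiplicities of roots *)

Section ConjugateMultiplicity.
Variables (F : finFieldType) (p e : nat) (K : closedFieldType).
Variable emb : {rmorphism F -> K}.
Hypothesis p_prime : prime p.
Hypothesis cardF : #|F| = (p ^ e)%N.
Notation q := #|F|.
Notation conj_poly := (conj_poly F).
Let frobD := frobD emb p_prime cardF.
Let frobN := frobN emb p_prime cardF.

Lemma frob_inj t (x y : K) : x ^+ (q ^ t) = y ^+ (q ^ t) -> x = y.
Proof.
move/eqP; rewrite -subr_eq0 -frobN -frobD expf_eq0 expq_gt0 /= subr_eq0.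
by move/eqP.
Qed.

Lemma frob_sum t (I : Type) (r : seq I) (f : I -> K) :
  (\sum_(i <- r) f i) ^+ (q ^ t) = \sum_(i <- r) f i ^+ (q ^ t).
Proof. by apply: (big_morph _ (frobD t)); rewrite expr0n eqn0Ngt expq_gt0. Qed.

Lemma horner_frob (f : {poly F}) (x : K) t :
  (map_poly emb f).[x ^+ (q ^ t)] = (map_poly emb f).[x] ^+ (q ^ t).
Proof.
rewrite !horner_coef frob_sum; apply: eq_bigr => i _.
by rewrite exprMn coef_map /= frob_emb exprAC.
Qed.

Lemma fixed_emb (x : K) : x ^+ q = x -> exists c, emb c = x.
Proof.
move=> xq; have /(congr1 (fun P => (map_poly emb P).[x])) := finField_genPoly F.
rewrite rmorphB /= map_polyXn map_polyX !hornerE xq subrr rmorph_prod horner_prod.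
move/esym/eqP; rewrite prodf_seq_eq0 => /hasP[c _ /=].
by rewrite rmorphB /= map_polyX map_polyC !hornerE subr_eq0 => /eqP->; exists c.
Qed.

Lemma fixed_poly_descent (P : {poly K}) :
  (forall i, P`_i ^+ q = P`_i) -> exists h, map_poly emb h = P.
Proof.
move=> Pq; pose inv (x : K) := odflt 0 [pick c | emb c == x].
have invK x : x ^+ q = x -> emb (inv x) = x.
  move=> /fixed_emb[c cx]; rewrite /inv; case: pickP => [d /eqP //|/(_ c)].
  by rewrite cx eqxx.
exists (\poly_(i < size P) inv P`_i); apply/polyP => i.
rewrite coef_map coef_poly /=; case: ltnP => [_|le_i]; first exact: invK.
by rewrite rmorph0 nth_default.
Qed.

(** Frobenius permutes the conjugates cyclically: split [conj_poly n.+1 a] at either end and cancel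
    ['X - a]. *)
Lemma conj_poly_frob n (a : K) : a ^+ (q ^ n) = a -> conj_poly n (a ^+ q) = conj_poly n a.
Proof.
move=> an; have c1 : conj_poly 1 a != 0 by rewrite monic_neq0 ?conj_poly_monic.
apply: (mulfI c1); have := conj_polyD F 1 n a; rewrite expn1 => <-.
by rewrite addnC conj_polyD an mulrC.
Qed.

Lemma conj_poly_descent n (a : K) :
  a ^+ (q ^ n) = a -> exists h, map_poly emb h = conj_poly n a.
Proof.
move=> an; apply: fixed_poly_descent => i.
pose f (x : K) := x ^+ q.
have fD x y : f (x + y) = f x + f y by have := frobD 1 x y; rewrite expn1.
have fB : zmod_morphism f.
  by move=> x y; rewrite fD; have := frobN 1 y; rewrite expn1 => <-.
have fM : monoid_morphism f by split=> [|x y]; rewrite /f ?expr1n ?exprMn.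
pose fr : {rmorphism K -> K} := HB.pack f
  (GRing.isZmodMorphism.Build K K f fB) (GRing.isMonoidMorphism.Build K K f fM).
have frP : map_poly fr (conj_poly n a) = conj_poly n a.
  rewrite -[RHS](conj_poly_frob an) rmorph_prod; apply: eq_bigr => j _.
  by rewrite rmorphB exprAC; congr (_ - _); [exact: map_polyX | exact: map_polyC].
by rewrite -[in RHS]frP coef_map.
Qed.

Lemma conj_poly_root n (a : K) i : (i < n)%N -> root (conj_poly n a) (a ^+ (q ^ i)).
Proof.
move=> lt_in; rewrite /conj_poly (bigD1 (Ordinal lt_in)) //= rootM.
by rewrite root_XsubC eqxx.
Qed.

Lemma orbit_period (f : {poly F}) n (a : K) : f != 0 -> size f = n.+1 ->
  root (map_poly emb f) a -> exists d, [&& (0 < d)%N, (d <= n)%N & a ^+ (q ^ d) == a].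
Proof.
move=> f0 sz_f ra; pose s := [seq a ^+ (q ^ i) | i <- iota 0 n.+1].
have rs : all (root (map_poly emb f)) s.
  apply/allP => _ /mapP[i _ ->]; rewrite /root horner_frob (eqP ra).
  by rewrite expr0n eqn0Ngt expq_gt0.
have : ~~ uniq s.
  apply/negP => us; have := max_poly_roots _ rs us.
  by rewrite map_poly_eq0 size_map_poly sz_f size_map size_iota ltnn => /(_ f0).
case/(uniqPn 0) => i [j [lt_ij lt_j]]; rewrite size_map size_iota in lt_j.
rewrite !(nth_map 0) ?size_iota ?(ltn_trans lt_ij) // !nth_iota ?(ltn_trans lt_ij) // !add0n.
rewrite -{1}(subnK (ltnW lt_ij)) expnD exprM => /esym/frob_inj eq_a.
exists (j - i)%N; rewrite eq_a eqxx subn_gt0 lt_ij /= andbT.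
by rewrite -ltnS (leq_ltn_trans (leq_subr _ _)).
Qed.

Lemma uniq_orbit d (a : K) : (0 < d)%N ->
  (forall j, (0 < j < d)%N -> a ^+ (q ^ j) != a) ->
  uniq [seq a ^+ (q ^ j) | j <- iota 0 d].
Proof.
move=> d0 min_d; apply/(uniqPn 0) => -[i [j [lt_ij lt_j]]]; rewrite size_map size_iota in lt_j.
rewrite !(nth_map 0) ?size_iota ?(ltn_trans lt_ij) // !nth_iota ?(ltn_trans lt_ij) // !add0n.
rewrite -{1}(subnK (ltnW lt_ij)) expnD exprM => /esym/frob_inj eq_a.
have := min_d (j - i)%N; rewrite eq_a eqxx subn_gt0 lt_ij /=.
by rewrite (leq_ltn_trans (leq_subr _ _)) // => /(_ isT).
Qed.

Lemma conj_polyE n (a : K) :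
  conj_poly n a = \prod_(x <- [seq a ^+ (q ^ j) | j <- iota 0 n]) ('X - x%:P).
Proof.
rewrite big_map /conj_poly.
by rewrite -(big_mkord xpredT (fun i => 'X - (a ^+ (q ^ i))%:P)) /index_iota subn0.
Qed.

(** For a root [a] of period [d], the indices with [a ^+ (q ^ i) = a] are the multiples of [d],
    where [conj_poly i a] is the power [i / d] of the minimal polynomial; it divides [f] exactly
    when [i / d] is at most the multiplicity. The induction removes one minimal polynomial at a
    time. *)
Lemma sum_conj_dvd n (f : {poly F}) (a : K) : f \is monic -> size f = n.+1 ->
  (\sum_(1 <= i < n.+1) ((a ^+ (q ^ i) == a) && dvdp (conj_poly i a) (map_poly emb f))
   = mup a (map_poly emb f))%N.
Proof.
elim/ltn_ind: n f => n IH f monf sz_f.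
case ra : (root (map_poly emb f) a); last first.
  rewrite mupNroot ?ra // big_nat big1 // => i /andP[i1 _].
  apply/eqP; rewrite eqb0; apply/negP => /andP[_ dv].
  have /= := conj_poly_root a i1; rewrite expr1 -dvdp_XsubCl.
  by move=> /dvdp_trans/(_ dv); rewrite dvdp_XsubCl ra.
have f0 : f != 0 by rewrite monic_neq0.
have [d /and3P[d_gt0 le_dn /eqP ad] d_min] := ex_minnP
  (orbit_period f0 sz_f ra).
have d_min' j : (0 < j < d)%N -> a ^+ (q ^ j) != a.
  case/andP=> j0 ltjd; apply/negP => /eqP aj; have := d_min j.
  by rewrite j0 aj eqxx (leq_trans (ltnW ltjd)) // => /(_ isT); rewrite leqNgt ltjd.
have [m0 m0P] := conj_poly_descent ad.
have dv_m : conj_poly d a %| map_poly emb f.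
  rewrite conj_polyE uniq_roots_dvdp ?uniq_rootsE ?uniq_orbit //.
  by apply/allP => _ /mapP[i _ ->]; rewrite /root horner_frob (eqP ra) expr0n eqn0Ngt expq_gt0.
have /dvdpP[f' def_f] : m0 %| f by rewrite -(dvdp_map emb) m0P.
have m0_monic : m0 \is monic by rewrite -(map_monic emb) m0P conj_poly_monic.
have f'_monic : f' \is monic by rewrite -(monicMr _ m0_monic) -def_f.
have sz_m0 : size m0 = d.+1 by rewrite -(size_map_poly emb) m0P size_conj_poly.
have sz_f' : size f' = (n - d).+1.
  have := sz_f; rewrite def_f size_proper_mul ?(monicP m0_monic) ?(monicP f'_monic) ?mul1r ?oner_neq0 //.
  by rewrite sz_m0 addnS /= => /(canRL (addnK _)) ->; rewrite subSn.
(* Indices below [d] contribute nothing by minimality, [d] contributes one, and the others reproduce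
   the sum for [f']. *)
rewrite (big_cat_nat _ (n := d)) //=; last by apply: leqW.
rewrite big_nat big1 ?add0n => [|i /d_min'/negPf-> //].
rewrite big_ltn ?ltnS // ad eqxx dv_m /=.
have -> : mup a (map_poly emb f) = (1 + mup a (map_poly emb f'))%N.
  rewrite def_f rmorphM /= m0P mulrC mupM ?monic_neq0 ?conj_poly_monic ?map_monic //.
  rewrite conj_polyE mu_prod_XsubC count_uniq_mem ?uniq_orbit //.
  suff -> : a \in [seq a ^+ (q ^ j) | j <- iota 0 d] by [].
  by apply/mapP; exists 0%N; rewrite ?expr1 // mem_iota.
congr (_ + _)%N; rewrite -(IH (n - d)%N) //; last by rewrite -subn_gt0 subKn.
rewrite -[d.+1]add1n big_addn subSn //; apply: eq_bigr => i _.
rewrite addnC expnD exprM ad conj_polyD ad def_f rmorphM /= m0P mulrC.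
by rewrite dvdp_mul2r ?monic_neq0 ?conj_poly_monic.
Qed.

End ConjugateMultiplicity.

(** * Monic polynomials of fixed degree, indexed by their tails *)

Section MonicOf.
Variable F : finFieldType.

Definition monic_of n (h : {poly_n F}) : {poly F} := 'X^n + h.

Lemma size_monic_of n (h : {poly_n F}) : size (monic_of h) = n.+1.
Proof. by rewrite /monic_of size_polyDl size_polyXn // ltnS size_npoly. Qed.

Lemma monic_of_monic n (h : {poly_n F}) : monic_of h \is monic.
Proof.
by rewrite monicE /monic_of lead_coefDl ?lead_coefXn // size_polyXn ltnS size_npoly.
Qed.

Definition monic_tail n (f : {poly F}) : {poly_n F} := npolyp n (f - 'X^n).

Lemma monic_tailK n f : f \is monic -> size f = n.+1 -> monic_of (monic_tail n f) = f.
Proof.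
move=> monf sz_f; rewrite /monic_of /monic_tail npolypK ?subrKC //.
apply/leq_sizeP => j; rewrite leq_eqVlt coefB coefXn => /orP[/eqP<-|ltnj].
  by have := monf; rewrite monicE lead_coefE sz_f eqxx => /eqP->; rewrite subrr.
by rewrite gtn_eqF // nth_default ?subr0 // sz_f.
Qed.

Lemma monic_ofK n : cancel (@monic_of n) (@monic_tail n).
Proof.
move=> h; apply: val_inj; rewrite /monic_tail /monic_of addrC addKr /=.
by rewrite npolypK ?size_npoly.
Qed.

Lemma card_monic n : #|{poly_n F}| = (#|F| ^ n)%N.
Proof. exact: card_npoly. Qed.

Lemma sum_monic_dvd (C : nmodType) (n i : nat) (d : {poly_i F}) (chi : {poly F} -> C) :
  (i <= n)%N ->
  \sum_(f : {poly_n F} | dvdp (monic_of d) (monic_of f)) chi (monic_of f) =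
  \sum_(g : {poly_(n - i) F}) chi (monic_of d * monic_of g).
Proof.
move=> le_in; have md := monic_of_monic d.
have prodK g : monic_of (monic_tail n (monic_of d * monic_of g)) =
    monic_of d * monic_of (g : {poly_(n - i) F}).
  apply: monic_tailK; first by rewrite monicMl ?monic_of_monic.
  rewrite size_monicM ?monic_of_monic // ?monic_neq0 ?monic_of_monic //.
  by rewrite !size_monic_of addnS /= addSn subnKC.
rewrite (reindex_onto (fun g => monic_tail n (monic_of d * monic_of g))
   (fun f => monic_tail (n - i) (monic_of f %/ monic_of d))) /=.
  apply: eq_big => [g|g _]; last by rewrite prodK.
  rewrite prodK dvdp_mulr //= mulrC mulpK ?monic_neq0 //.
  by rewrite monic_ofK eqxx.
move=> f /divpK dvf.
have mdf : monic_of f %/ monic_of d \is monic.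
  by rewrite -(monicMr _ md) dvf monic_of_monic.
have : size (monic_of f %/ monic_of d * monic_of d) = n.+1 by rewrite dvf size_monic_of.
rewrite size_monicM ?monic_neq0 // size_monic_of addnS /=.
move=> /(canRL (addnK _)) szq; rewrite monic_tailK //; last by rewrite szq subSn.
by rewrite mulrC dvf monic_ofK.
Qed.

End MonicOf.

(** * The von Mangoldt function and the L-function recursion *)

Section VonMangoldt.
Variables (F : finFieldType) (p e : nat) (K : closedFieldType).
Variable emb : {rmorphism F -> K}.
Hypothesis p_prime : prime p.
Hypothesis cardF : #|F| = (p ^ e)%N.
Notation q := #|F|.
Notation conj_poly := (conj_poly F).

Definition fixed_pts (n : nat) : seq K :=
  undup (sval (closed_field_poly_normal ('X^(q ^ n) - 'X : {poly K}))).

Lemma mem_fixed_pts n a : (0 < n)%N -> (a \in fixed_pts n) = (a ^+ (q ^ n) == a).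
Proof.
move=> n0; rewrite mem_undup; case: closed_field_poly_normal => s /= def_s.
have q1 : (1 < q ^ n)%N by rewrite -(exp1n n) ltn_exp2r // q_gt1.
have lc : lead_coef ('X^(q ^ n) - 'X : {poly K}) = 1.
  by rewrite lead_coefDl ?lead_coefXn // size_polyN size_polyX size_polyXn ltnS.
move: def_s; rewrite lc scale1r => def_s; rewrite -root_prod_XsubC -def_s.
by rewrite /root !hornerE subr_eq0.
Qed.

(* The number of [a] in the field with [q ^ n] elements with characteristic
   polynomial [h], i.e. the von Mangoldt weight of [h] when [deg h = n]. *)
Definition mangoldt (n : nat) (h : {poly F}) : nat :=
  count (fun a => conj_poly n a == map_poly emb h) (fixed_pts n).

Lemma sum_monic_conj n (a : K) (P : {poly F} -> bool) : a ^+ (q ^ n) = a ->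
  exists2 h : {poly F}, map_poly emb h = conj_poly n a &
    (\sum_(f : {poly_n F}) (P (monic_of f) && (conj_poly n a == map_poly emb (monic_of f)))
     = P h)%N.
Proof.
move=> an; have [h hP] := conj_poly_descent emb p_prime cardF an; exists h => //.
have mh : h \is monic by rewrite -(map_monic emb) hP conj_poly_monic.
have sz_h : size h = n.+1 by rewrite -(size_map_poly emb) hP size_conj_poly.
rewrite (bigD1 (monic_tail n h)) //= monic_tailK // hP eqxx andbT.
rewrite big1 ?addn0 // => f; apply: contraNeq; rewrite eqb0 negbK => /andP[_ /eqP].
by rewrite -hP => /map_poly_inj->; rewrite monic_ofK.
Qed.

(** The analogue of [\sum_(d | n) Lambda(d) = log n]: the roots of [f] with multiplicity are counted
    through [sum_conj_dvd], then grouped by characteristic polynomial. *)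
Lemma mangoldt_sum n (f : {poly F}) : f \is monic -> size f = n.+1 ->
  (\sum_(1 <= i < n.+1) \sum_(h : {poly_i F})
     dvdp (monic_of h) f * mangoldt i (monic_of h) = n)%N.
Proof.
move=> monf sz_f; have f0 : map_poly emb f != 0 by rewrite map_poly_eq0 monic_neq0.
have [s] := closed_field_poly_normal (map_poly emb f).
have lc : lead_coef (map_poly emb f) = 1 by apply/eqP; rewrite -monicE map_monic.
rewrite lc scale1r => def_s.
have size_s : size s = n.
  by have := congr1 (fun P : {poly K} => size P) def_s; rewrite size_prod_XsubC size_map_poly sz_f => -[].
rewrite -[RHS]size_s -(perm_size (perm_count_undup s)) size_flatten sumnE /shape -map_comp big_map.
rewrite (eq_bigr (fun a => \sum_(1 <= i < n.+1)
   ((a ^+ (q ^ i) == a) && dvdp (conj_poly i a) (map_poly emb f)))%N); last first.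
  by move=> a _; rewrite /= size_nseq (sum_conj_dvd emb p_prime cardF) // def_s mu_prod_XsubC.
rewrite exchange_big /=; apply: eq_big_nat => i /andP[i0 _].
rewrite (eq_bigr (fun h : {poly_i F} => \sum_(a <- fixed_pts i)
  (dvdp (monic_of h) f && (conj_poly i a == map_poly emb (monic_of h))))%N); last first.
  move=> h _; rewrite /mangoldt -sum1_count big_distrr big_mkcond /=.
  by apply: eq_bigr => a _; case: eqP; case: dvdp.
rewrite exchange_big /=.
rewrite (eq_big_seq (fun a => dvdp (conj_poly i a) (map_poly emb f) : nat)); last first.
  move=> a; rewrite mem_fixed_pts // => /eqP ai.
  have [h <- ->] := sum_monic_conj (fun g => dvdp g f) ai.
  by rewrite dvdp_map.
have sum_count (r : seq K) (b : pred K) : (\sum_(a <- r) b a = count b r)%N.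
  by rewrite -sumn_count sumnE big_map.
rewrite !sum_count -!size_filter; apply/perm_size/uniq_perm.
- by rewrite filter_uniq // undup_uniq.
- by rewrite filter_uniq // undup_uniq.
move=> a; rewrite !mem_filter mem_undup mem_fixed_pts //.
case: eqP => [ai|]; rewrite ?andbF //= andbT.
case dv: dvdp => //=.
have := conj_poly_root F a i0; rewrite expr1 -dvdp_XsubCl => /dvdp_trans/(_ dv).
by rewrite dvdp_XsubCl def_s root_prod_XsubC.
Qed.

Variable C : comNzRingType.
Variable chi : {poly F} -> C.
Hypothesis chiM : forall f g, f \is monic -> g \is monic -> chi (f * g) = chi f * chi g.

Definition monic_sum (n : nat) : C := \sum_(f : {poly_n F}) chi (monic_of f).

Definition mangoldt_chi (n : nat) : C :=
  \sum_(f : {poly_n F}) chi (monic_of f) *+ mangoldt n (monic_of f).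

(* The logarithmic derivative of the L-function of [chi]. *)
Lemma L_recursion n : monic_sum n *+ n =
  \sum_(1 <= i < n.+1) mangoldt_chi i * monic_sum (n - i).
Proof.
rewrite /monic_sum -sumrMnl.
rewrite (eq_bigr (fun f : {poly_n F} => \sum_(1 <= i < n.+1) \sum_(h : {poly_i F})
   chi (monic_of f) *+ (dvdp (monic_of h) (monic_of f) * mangoldt i (monic_of h)))); last first.
  move=> f _; rewrite -[X in chi _ *+ X = _](mangoldt_sum (monic_of_monic f) (size_monic_of f)).
  by rewrite -sumrMnr; apply: eq_bigr => i _; rewrite sumrMnr.
rewrite exchange_big /=; apply: eq_big_nat => i /andP[i0 le_in].
rewrite exchange_big /= /mangoldt_chi mulr_suml; apply: eq_bigr => h _.
rewrite (eq_bigr (fun f : {poly_n F} => (if dvdp (monic_of h) (monic_of f) then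
  chi (monic_of f) else 0) *+ mangoldt i (monic_of h))); last first.
  by move=> f _; case: dvdp; rewrite ?mul1n // mul0n mulr0n mul0rn.
rewrite sumrMnl -big_mkcond sum_monic_dvd // mulrnAl; congr (_ *+ _).
by rewrite mulr_sumr; apply: eq_bigr => g _; rewrite chiM ?monic_of_monic.
Qed.

End VonMangoldt.

(** * Distribution of the von Mangoldt weight among classes *)

Section MangoldtCounts.
Variables (F : finFieldType) (p e : nat) (K : closedFieldType).
Variable emb : {rmorphism F -> K}.
Hypothesis p_prime : prime p.
Hypothesis cardF : #|F| = (p ^ e)%N.
Notation q := #|F|.

(** For the trivial character the recursion is [n q^n = \sum_(1 <= i <= n) S_i q^(n - i)], where the
    terms with [i < n] equal [q^n] by induction. *)
Lemma mangoldt_total n : (0 < n)%N ->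
  (\sum_(f : {poly_n F}) mangoldt emb n (monic_of f) = q ^ n)%N.
Proof.
elim/ltn_ind: n => n IH n0; set S := fun m => (\sum_(f : {poly_m F}) mangoldt emb m (monic_of f))%N.
have Sint m : mangoldt_chi emb (fun=> 1 : int) m = (S m)%:R.
  by rewrite /mangoldt_chi /S natr_sum; apply: eq_bigr.
have cint m : monic_sum (fun _ : {poly F} => 1 : int) m = (q ^ m)%:R.
  by rewrite /monic_sum sumr_const card_monic.
have := L_recursion emb p_prime cardF (chi := fun=> 1 : int) (fun _ _ _ _ => esym (mulr1 1)) n.
case: n => // n in IH n0 *; rewrite big_nat_recr //= subnn Sint !cint expn0 mulr1.
rewrite (eq_big_nat _ _ (F2 := fun=> (q ^ n.+1)%:R)); last first.
  move=> i /andP[i0 lt_i]; rewrite Sint cint /S IH // -natrM -expnD subnKC //.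
  exact: ltnW.
rewrite sumr_const_nat subn1 /= mulrSr => /addrI.
by rewrite !natz => -[/esym].
Qed.

Lemma frob_class_ext l n (g g' : nat -> F) (a : K) :
  (forall i, (i <= l)%N -> g i = g' i) -> frob_class emb l n g a -> frob_class emb l n g' a.
Proof.
move=> eq_g H zeta z0 zP j le_jl; rewrite (H zeta z0 zP j le_jl).
by apply: eq_bigr => i _; rewrite eq_g // (leq_trans _ le_jl) // -ltnS.
Qed.

(** For monic [f] of degree [n], this says that the reversals of [f] and of [monic_of v] are the
    same principal unit modulo [x ^ l.+1]. *)
Definition same_top l n (f : {poly F}) (v : {poly_l F}) :=
  [forall i : 'I_l.+1, (rev_poly n f)`_i == (rev_poly l (monic_of v))`_i].

(** The weight of a class counts elements of the field with [q ^ (s + s)] elements, to which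
    [card_frob_class] applies. The even exponent provides the square [M ^ 2] of Stepanov's
    method. *)
Lemma mangoldt_class l : exists C, forall s, (0 < s)%N -> (C < q ^ s)%N ->
  forall v : {poly_l F},
  (\sum_(f : {poly_(s + s) F} | same_top (s + s) (monic_of f) v)
      mangoldt emb (s + s) (monic_of f) * q ^ l <= q ^ (s + s) + C * q ^ s)%N.
Proof.
have [C CP] := card_frob_class emb p_prime cardF l.
exists C => s s0 ltC v; rewrite -big_distrl /=.
pose n := (s + s)%N; have n0 : (0 < n)%N by rewrite addn_gt0 s0.
pose r := [seq a <- fixed_pts F K n | [exists f : {poly_n F},
   same_top n (monic_of f) v && (conj_poly F n a == map_poly emb (monic_of f))]].
have r_mem a : a \in r -> a ^+ (q ^ n) = a.
  by rewrite mem_filter mem_fixed_pts // => /andP[_ /eqP].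
have uniq_r : uniq r by rewrite filter_uniq // undup_uniq.
apply: leq_trans (CP s ltC (fun i => (rev_poly l (monic_of v))`_i) r uniq_r r_mem _).
  rewrite leq_mul2r; apply/orP; right.
  rewrite (eq_bigr (fun f : {poly_n F} => \sum_(a <- fixed_pts F K n)
    (conj_poly F n a == map_poly emb (monic_of f) : nat))%N); last first.
    by move=> f _; rewrite /mangoldt -sumn_count sumnE big_map.
  rewrite exchange_big /= /r size_filter -sumn_count sumnE big_map.
  rewrite big_seq [X in (_ <= X)%N]big_seq; apply: leq_sum => a.
  rewrite mem_fixed_pts // => /eqP an.
  have [h hP] := sum_monic_conj emb p_prime cardF (fun f => same_top n f v) an.
  rewrite [X in (X <= _)%N]big_mkcond (eq_bigr (fun f : {poly_n F} => (same_top n (monic_of f) v &&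
    (conj_poly F n a == map_poly emb (monic_of f)) : nat))%N) => [sumE|f _]; last first.
    by case: same_top.
  case: existsP => [_|nex]; first by rewrite sumE; case: same_top.
  rewrite big1 // => f _; apply/eqP; rewrite eqb0; apply/negP => H.
  by apply: nex; exists f.
move=> a; rewrite mem_filter => /andP[/existsP[f /andP[topf /eqP conjf]] _].
apply: (@frob_class_ext _ _ (fun i => (rev_poly n (monic_of f))`_i)) => [i le_il|].
  by have /forallP/(_ (Ordinal (le_il : (i < l.+1)%N)))/eqP := topf.
apply: (frob_class_conj p_prime cardF) => i.
by rewrite conjf !coef_rev_poly coef_map; case: leqP; rewrite ?rmorph0.
Qed.

End MangoldtCounts.

Import Order.TTheory Num.Theory.

(** * The Weil bound *)

Section LogRecursion.
Variable C : comNzRingType.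

(* [E] is the coefficient sequence of [exp (\sum_(i >= 1) b_i T^i / i)]. *)
Definition log_rec (b E : nat -> C) : Prop :=
  forall n, E n *+ n = \sum_(1 <= i < n.+1) b i * E (n - i)%N.

Definition mul_linear (a : C) (E : nat -> C) (n : nat) : C :=
  if n is n'.+1 then E n'.+1 - a * E n' else E 0%N.

(** Multiplying a series by [1 - a T] subtracts [\sum a^i T^i / i] from its logarithm; on
    coefficients this needs no division. *)
Lemma log_rec_linear (a : C) b E :
  log_rec b E -> log_rec (fun i => b i - a ^+ i) (mul_linear a E).
Proof.
move=> bE [|n]; first by rewrite mulr0n big_geq.
have geo m : \sum_(1 <= i < m.+2) a ^+ i * mul_linear a E (m.+1 - i) = a * E m.
  elim: m => [|m IH]; first by rewrite big_nat1.
  rewrite big_ltn // subSS subn0 expr1 /= big_add1 /=.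
  rewrite (eq_bigr (fun i => a * (a ^+ i * mul_linear a E (m.+1 - i)))); last first.
    by move=> i _; rewrite subSS exprS mulrA.
  by rewrite -mulr_sumr IH; ring.
rewrite (eq_bigr (fun i => b i * mul_linear a E (n.+1 - i)
    - a ^+ i * mul_linear a E (n.+1 - i))); last by move=> i _; rewrite mulrBl.
have splitE : \sum_(1 <= i < n.+2) b i * mul_linear a E (n.+1 - i) =
    \sum_(1 <= i < n.+2) b i * E (n.+1 - i)%N - a * \sum_(1 <= i < n.+1) b i * E (n - i)%N.
  rewrite !(big_nat_recr n.+1) //= subnn mulr_sumr addrAC -sumrB; congr (_ + _).
  by apply: eq_big_nat => i /andP[_ le_in]; rewrite subSn //=; ring.
rewrite sumrB geo splitE -!bE /= mulrnBl !mulrS; ring.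
Qed.

Lemma log_rec_prod (r : seq C) : exists2 E : nat -> C,
  (forall n, E n = (\prod_(x <- r) (1 - x *: 'X))`_n) &
  log_rec (fun i => - \sum_(x <- r) x ^+ i) E.
Proof.
elim: r => [|a r [E defE recE]].
  exists (fun n => (n == 0%N)%:R) => [n|n]; first by rewrite big_nil coef1.
  rewrite big1 => [|i _]; first by case: n => [|n] /=; rewrite ?mulr0n ?mul0rn.
  by rewrite big_nil oppr0 mul0r.
exists (mul_linear a E) => [n|n].
  rewrite big_cons mulrBl mul1r coefB -scalerAl coefZ coefXM.
  by case: n => [|n] /=; rewrite !defE ?mulr0 ?subr0.
rewrite (log_rec_linear a recE); apply: eq_bigr => i _.
by rewrite big_cons opprD addrC.
Qed.

Lemma log_rec_inj b b' E : E 0%N = 1 -> log_rec b E -> log_rec b' E ->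
  forall n, (0 < n)%N -> b n = b' n.
Proof.
move=> E0 recb recb'; elim/ltn_ind => n IH n0.
have := recb n; rewrite recb'; case: n n0 IH => // n _ IH.
rewrite !(big_nat_recr n.+1) //= subnn E0 !mulr1.
rewrite (eq_big_nat _ _ (F2 := fun i => b i * E (n.+1 - i)%N)) => [/addrI //|i /andP[i0 lt_i]].
by rewrite IH.
Qed.

End LogRecursion.

Section PowerSums.

Lemma bernoulli_ge (y : algC) n : 0 <= y -> 1 + y *+ n <= (1 + y) ^+ n.
Proof.
move=> y0; elim: n => [|n IH]; first by rewrite mulr0n addr0 expr0.
rewrite exprS; apply: le_trans (_ : (1 + y) * (1 + y *+ n) <= _); last first.
  by rewrite ler_wpM2l // addr_ge0.
have -> : (1 + y) * (1 + y *+ n) = 1 + y *+ n.+1 + y * (y *+ n).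
  by rewrite mulrS; ring.
by rewrite lerDl mulr_ge0 // mulrn_wge0.
Qed.

(* The linear functional sending [x ^ s] to [P(x) x ^ s], with [P] vanishing at
   the other points, isolates each term. *)
Lemma bounded_power_sums (r : seq algC) (D : algC) (s0 : nat) :
  (forall s, (s0 <= s)%N -> `|\sum_(x <- r) x ^+ s| <= D) ->
  forall x, x \in r -> `|x| <= 1.
Proof.
move=> bnd x xr; pose P := \prod_(y <- undup r | y != x) ('X - y%:P).
have Px : P.[x] != 0.
  rewrite /P horner_prod prodf_seq_neq0; apply/allP => y _; apply/implyP => ne.
  by rewrite hornerXsubC subr_eq0 eq_sym.
have Py y : y \in r -> y != x -> P.[y] = 0.
  move=> yr ne; apply/eqP; rewrite /P horner_prod prodf_seq_eq0; apply/hasP.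
  by exists y; rewrite ?mem_undup // ne hornerXsubC subrr eqxx.
pose D' := \sum_(t < size P) `|P`_t| * D.
have bndx s : (s0 <= s)%N -> `|P.[x]| * `|x| ^+ s <= D'.
  move=> les; have : `|\sum_(y <- r) P.[y] * y ^+ s| <= D'.
    rewrite (eq_bigr (fun y => \sum_(t < size P) P`_t * y ^+ (t + s))); last first.
      by move=> y _; rewrite horner_coef mulr_suml; apply: eq_bigr => t _; rewrite exprD mulrA.
    rewrite exchange_big /=; apply: le_trans (ler_norm_sum _ _ _) _.
    apply: ler_sum => t _; rewrite -mulr_sumr normrM ler_wpM2l // bnd //.
    by rewrite (leq_trans les) // leq_addl.
  rewrite (eq_big_seq (fun y => if y == x then P.[x] * x ^+ s else 0)); last first.
    by move=> y yr; case: eqVneq => [->//|ne]; rewrite Py ?mul0r.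
  rewrite -big_mkcond big_const_seq iter_addr_0 normrMn normrM normrX.
  apply: le_trans; rewrite -[X in X <= _]mulr1n ler_wpMn2l ?mulr_ge0 ?exprn_ge0 //.
  by rewrite -has_count; apply/hasP; exists x => /=.
rewrite real_leNgt ?normr_real ?rpred1 //; apply/negP => x1.
pose y := `|x| - 1; have y0 : 0 < y by rewrite subr_gt0.
have Px0 : 0 < `|P.[x]| by rewrite normr_gt0.
have D'0 : 0 <= D'.
  by apply: le_trans (bndx s0 (leqnn _)); rewrite mulr_ge0 ?exprn_ge0.
have Pxy0 : 0 < `|P.[x]| * y by rewrite mulr_gt0.
(* If [|x| = 1 + y] with [y > 0], Bernoulli's inequality makes [|x| ^ (s0 + n)] exceed
   [D' / |P(x)|]. *)
pose n := Num.bound (D' / (`|P.[x]| * y)).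
have ltn : D' / (`|P.[x]| * y) < n%:R.
  by apply: archi_boundP; rewrite divr_ge0 // ltW.
have := bndx (s0 + n)%N (leq_addr _ _); apply/negP.
rewrite -real_ltNge ?ger0_real ?mulr_ge0 ?exprn_ge0 //.
move: ltn; rewrite ltr_pdivrMr // => /lt_le_trans; apply.
rewrite mulrCA ler_pM2l //; apply: le_trans (_ : (1 + y) ^+ (s0 + n) <= _); last first.
  by rewrite addrC subrK.
apply: le_trans (bernoulli_ge _ (ltW y0)).
rewrite mulr_natl; apply: ler_wpDl => //.
by apply: ler_wpMn2l; rewrite ?ltW // leq_addl.
Qed.

End PowerSums.

(** * The inverse roots of the L-function *)

Section WeilBound.
Variables (F : finFieldType) (p e l : nat).
Hypothesis p_prime : prime p.
Hypothesis cardF : #|F| = (p ^ e)%N.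
Hypothesis l_gt0 : (0 < l)%N.
Notation q := #|F|.

Definition top_coefs n (f : {poly F}) : {poly_l F} :=
  npolyp l (\poly_(j < l) (rev_poly n f)`_(l - j)).

Lemma same_topE n f v : f \is monic -> size f = n.+1 ->
  same_top n f v = (v == top_coefs n f).
Proof.
move=> monf sz_f.
have coef_v (u : {poly_l F}) i : (0 < i)%N -> (i <= l)%N ->
    (rev_poly l (monic_of u))`_i = u`_(l - i).
  move=> i0 le_il; rewrite coef_rev_poly le_il /monic_of coefD coefXn.
  by rewrite ltn_eqF ?add0r // ltn_subrL i0.
have coef_top i : (i < l)%N -> (top_coefs n f)`_i = (rev_poly n f)`_(l - i).
  by move=> lt_il; rewrite coef_npolyp lt_il coef_poly lt_il.
apply/forallP/eqP => [H|-> i].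
  apply/npolyP => i; case: (ltnP i l) => [lt_il|le_li]; last first.
    by rewrite !big_coef_npoly.
  have lt_l : (l - i < l.+1)%N by rewrite ltnS leq_subr.
  have /eqP := H (Ordinal lt_l); rewrite coef_top //= => ->.
  by rewrite coef_v ?subn_gt0 ?leq_subr // subKn // ltnW.
case: (posnP i) => [i0|i0].
  rewrite i0 !coef_rev_poly /= !subn0 /monic_of coefD coefXn eqxx.
  rewrite big_coef_npoly // addr0.
  by have := monf; rewrite monicE lead_coefE sz_f.
have le_il : (i <= l)%N by rewrite -ltnS.
by rewrite coef_v // coef_top ?subKn // ltn_subrL i0.
Qed.

Variable chi : {poly F} -> algC.
Hypothesis chiM : forall f g, f \is monic -> g \is monic -> chi (f * g) = chi f * chi g.
Hypothesis chi1 : chi 1 = 1.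
Hypothesis chi_norm : forall f, f \is monic -> `|chi f| <= 1.
Hypothesis chi_top : forall n f v, f \is monic -> size f = n.+1 ->
  same_top n f v -> chi f = chi (monic_of (v : {poly_l F})).
Hypothesis chi_sum : \sum_(v : {poly_l F}) chi (monic_of v) = 0.

Lemma monic_sum0 : monic_sum chi 0 = 1.
Proof.
rewrite /monic_sum (eq_bigr (fun=> 1)); first by rewrite sumr_const card_monic expn0.
move=> f _; rewrite -chi1; congr chi; rewrite /monic_of.
by apply/polyP => i; rewrite coefD big_coef_npoly // addr0 expr0.
Qed.

(** The value of [chi] depends only on the [l] coefficients below the leading one, over which its
    sum vanishes; the other [d - l] are free. Hence the L-function is a polynomial of degree below
    [l]. *)
Lemma monic_sum_eq0 d : (l <= d)%N -> monic_sum chi d = 0.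
Proof.
move=> le_ld; pose m := (d - l)%N.
have sz_vr (vr : {poly_l F} * {poly_m F}) :
    (size (polyn vr.2 + polyn vr.1 * 'X^m)%R <= d)%N.
  apply: leq_trans (size_polyD _ _) _; rewrite geq_max.
  rewrite (leq_trans (size_npoly _)) ?leq_subr //=.
  apply: leq_trans (size_polyMleq _ _) _; rewrite size_polyXn addnS /=.
  by rewrite -[X in (_ <= X)%N](subnKC le_ld) leq_add2r size_npoly.
pose fwd (vr : {poly_l F} * {poly_m F}) : {poly_d F} :=
  npolyp d (polyn vr.2 + polyn vr.1 * 'X^m).
pose bwd (f : {poly_d F}) : {poly_l F} * {poly_m F} :=
  (npolyp l (drop_poly m f), npolyp m (take_poly m f)).
have fwdK : cancel fwd bwd.
  case=> v r; rewrite /bwd /fwd npolypK ?sz_vr //=; congr (_, _); apply: val_inj => /=.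
    by rewrite drop_polyDMXn ?size_npoly // npolypK ?size_npoly.
  by rewrite take_polyDMXn ?size_npoly // npolypK ?size_npoly.
have bij_fwd : bijective fwd.
  apply: inj_card_bij; first exact: can_inj fwdK.
  by rewrite card_prod !card_npoly -expnD subnKC.
rewrite /monic_sum (reindex fwd) /=; last exact: onW_bij.
rewrite -(pair_bigA _ (fun v r => chi (monic_of (fwd (v, r))))) /=.
rewrite (eq_bigr (fun v => chi (monic_of v) *+ #|{poly_m F}|)) => [|v _].
  by rewrite sumrMnl chi_sum mul0rn.
rewrite -sumr_const; apply: eq_bigr => r _.
apply: (chi_top (n := d)); rewrite ?monic_of_monic ?size_monic_of //.
apply/forallP => i; rewrite !coef_rev_poly /monic_of !coefD.
have le_il : (i <= l)%N by rewrite -ltnS.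
rewrite (leq_trans le_il) // le_il /fwd npolypK ?sz_vr //= !coefXn coefD coefMXn.
have -> : (d - i < m)%N = false by rewrite /m; lia.
have -> : (d - i - m = l - i)%N by rewrite /m; lia.
have -> : (d - i == d)%N = (l - i == l)%N by lia.
by rewrite [r`__]big_coef_npoly ?add0r // /m; lia.
Qed.

Variables (K : closedFieldType) (emb : {rmorphism F -> K}).

(** Stepanov's method bounds each class from above only, but the total weight is exactly [q ^ n], so
    the deficits [x v] have a small sum. As [chi] sums to zero over the classes, the counts,
    multiplied by [q ^ l], may be replaced with minus the deficits. *)
Lemma mangoldt_chi_bound : exists C s0, forall s, (s0 <= s)%N ->
  `|mangoldt_chi emb chi (s + s)| <= C%:R * q%:R ^+ s.
Proof.
have [C CP] := mangoldt_class emb p_prime cardF l.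
exists C, C.+1 => s le_s; have s0 : (0 < s)%N by apply: leq_trans le_s.
have ltC : (C < q ^ s)%N.
  by apply: leq_trans le_s _; apply: ltnW; apply: ltn_expl; apply: q_gt1.
pose n := (s + s)%N.
pose cnt (v : {poly_l F}) := (\sum_(f : {poly_n F} | same_top n (monic_of f) v) mangoldt emb n (monic_of f))%N.
have cnt_le v : (cnt v * q ^ l <= q ^ n + C * q ^ s)%N.
  by rewrite /cnt big_distrl /=; apply: CP.
have cnt_total : (\sum_v cnt v = q ^ n)%N.
  rewrite -(mangoldt_total emb p_prime cardF (n := n)) ?addn_gt0 ?s0 //.
  rewrite (exchange_big_dep predT) //=; apply: eq_bigr => f _.
  rewrite (eq_bigl (pred1 (top_coefs n (monic_of f)))) ?big_pred1_eq // => v.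
  by rewrite same_topE ?monic_of_monic ?size_monic_of.
have chiE : mangoldt_chi emb chi n = \sum_v chi (monic_of v) *+ cnt v.
  rewrite /mangoldt_chi (eq_bigr (fun f : {poly_n F} => \sum_(v : {poly_l F} | same_top n (monic_of f) v)
     chi (monic_of v) *+ mangoldt emb n (monic_of f))); last first.
    move=> f _; rewrite (eq_bigl (pred1 (top_coefs n (monic_of f)))).
      rewrite big_pred1_eq; congr (_ *+ _).
      apply: (chi_top (n := n)); rewrite ?monic_of_monic ?size_monic_of //.
      by rewrite same_topE ?monic_of_monic ?size_monic_of.
    by move=> v; rewrite same_topE ?monic_of_monic ?size_monic_of.
  rewrite (exchange_big_dep predT) //=; apply: eq_bigr => v _.
  by rewrite sumrMnr.
pose x (v : {poly_l F}) := (q ^ n + C * q ^ s - cnt v * q ^ l)%N.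
have x_total : (\sum_v x v = q ^ l * (C * q ^ s))%N.
  apply/eqP; rewrite -(eqn_add2r (\sum_v cnt v * q ^ l)) -big_split /=.
  rewrite (eq_bigr (fun=> q ^ n + C * q ^ s)%N) => [|v _]; last by rewrite subnK.
  rewrite sum_nat_const card_npoly -big_distrl /= cnt_total mulnDr addnC [(q ^ n * _)%N]mulnC.
  exact: eqxx.
have ql0 : 0 < (q ^ l)%:R :> algC by rewrite ltr0n expq_gt0.
rewrite -(ler_pM2l ql0) -[X in X * `|_|]gtr0_norm // -normrM.
have -> : (q ^ l)%:R * mangoldt_chi emb chi n = - \sum_v chi (monic_of v) *+ x v.
  apply/eqP; rewrite -addr_eq0 chiE mulr_sumr -big_split /=.
  rewrite (eq_bigr (fun v => chi (monic_of v) *+ (q ^ n + C * q ^ s))) => [|v _].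
    by rewrite sumrMnl chi_sum mul0rn.
  by rewrite mulr_natl -mulrnA -mulrnDr subnKC.
rewrite normrN; apply: le_trans (ler_norm_sum _ _ _) _.
apply: le_trans (_ : \sum_v (x v)%:R <= _); last first.
  by rewrite -natr_sum x_total -natrX -!natrM lexx.
apply: ler_sum => v _; rewrite normrMn; apply: ler_wMn2r.
by apply: chi_norm; apply: monic_of_monic.
Qed.

Lemma rev_prod_XsubC (R : comNzRingType) (r : seq R) :
  rev_poly (size r) (\prod_(x <- r) ('X - x%:P)) = \prod_(x <- r) (1 - x *: 'X).
Proof.
elim: r => [|x r IH].
  by rewrite !big_nil /rev_poly big_ord1 coef1 scale1r expr0.
rewrite !big_cons -[size _]/(1 + size r)%N rev_polyM ?IH ?size_XsubC ?size_prod_XsubC //.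
congr (_ * _); apply/polyP => -[|[|i]]; rewrite coef_rev_poly !coefB coefZ !coefX coefC coef1 /=.
- by rewrite mulr0.
- by rewrite sub0r mulr1 sub0r.
by rewrite mulr0 subrr.
Qed.

(** [P] is the reversed L-function, so its roots [r] are the [l.-1] inverse roots. The sums
    [mangoldt_chi] are minus their power sums, and [monic_sum chi 1] is minus their sum. *)
Lemma monic_sum1_bound : `|monic_sum chi 1| <= sqrtC q%:R *+ l.-1.
Proof.
pose P : {poly algC} := \poly_(j < l) monic_sum chi (l.-1 - j).
have P_lead : P`_l.-1 = 1 by rewrite coef_poly ltn_predL l_gt0 subnn monic_sum0.
have sz_P : size P = l.
  apply/eqP; rewrite eqn_leq size_poly /= -[X in (X <= _)%N](ltn_predK l_gt0).
  rewrite ltnNge; apply/negP => /(nth_default 0); rewrite P_lead => /eqP.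
  by rewrite oner_eq0.
have [r] := closed_field_poly_normal P.
rewrite lead_coefE sz_P P_lead scale1r => def_P.
have size_r : size r = l.-1.
  by have := sz_P; rewrite def_P size_prod_XsubC => <-.
have [E defE recE] := log_rec_prod r.
have E_c n : E n = monic_sum chi n.
  rewrite defE -rev_prod_XsubC -def_P size_r coef_rev_poly.
  case: leqP => [le_n|lt_n]; last by rewrite monic_sum_eq0 // -(ltn_predK l_gt0).
  rewrite coef_poly subKn // (leq_ltn_trans (leq_subr _ _)) //.
  by rewrite ltn_predL.
have recS : log_rec (mangoldt_chi emb chi) E.
  move=> n; rewrite E_c (L_recursion emb p_prime cardF) //.
  by apply: eq_bigr => i _; rewrite E_c.
have E0 : E 0%N = 1 by rewrite E_c monic_sum0.
have S_p := log_rec_inj E0 recS recE.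
have q0 : 0 < q%:R :> algC by rewrite ltr0n (ltnW (q_gt1 F)).
have [C [s0 CP]] := mangoldt_chi_bound.
(* Only even exponents are controlled, so the power sums considered are those of the numbers
   [x ^ 2 / q]. *)
have bnd : forall s, (maxn s0 1 <= s)%N ->
    `|\sum_(x <- [seq x ^+ 2 / q%:R | x <- r]) x ^+ s| <= C%:R.
  move=> s; rewrite geq_max => /andP[le_s s_gt0]; rewrite big_map.
  rewrite (eq_bigr (fun x => x ^+ (s + s) / q%:R ^+ s)) => [|x _]; last first.
    by rewrite exprMn exprVn -exprM mul2n addnn.
  rewrite -mulr_suml normrM normfV normrX [`|q%:R|]gtr0_norm // ler_pdivrMr ?exprn_gt0 //.
  by rewrite -normrN -S_p ?addn_gt0 ?s_gt0 // CP.
have r_le x : x \in r -> `|x| <= sqrtC q%:R.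
  move=> xr; have := bounded_power_sums bnd (map_f (fun x => x ^+ 2 / q%:R) xr).
  rewrite normrM normfV [`|q%:R|]gtr0_norm // ler_pdivrMr // mul1r normrX => le_x.
  rewrite -(ler_pXn2r (n := 2)) ?nnegrE ?sqrtC_ge0 ?(ltW q0) //.
  by rewrite sqrtCK.
rewrite -E_c; have := recE 1%N; rewrite mulr1n big_nat1 subnn E0 mulr1 => ->.
rewrite normrN; apply: le_trans (ler_norm_sum _ _ _) _.
rewrite big_seq; apply: le_trans (_ : \sum_(x <- r | x \in r) sqrtC q%:R <= _).
  by apply: ler_sum => x /r_le; rewrite expr1.
by rewrite -big_seq big_const_seq count_predT iter_addr_0 size_r.
Qed.

End WeilBound.

(* The Weil bound for the nontrivial characters of the group of principal units modulo
   [x ^ l.+1], written as functions of monic polynomials. *)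
Theorem weil_bound (F : finFieldType) (p e l : nat) (chi : {poly F} -> algC) :
  prime p -> #|F| = (p ^ e)%N -> (0 < l)%N ->
  (forall f g, f \is monic -> g \is monic -> chi (f * g) = chi f * chi g) ->
  chi 1 = 1 -> (forall f, f \is monic -> `|chi f| <= 1) ->
  (forall n f v, f \is monic -> size f = n.+1 ->
    same_top n f v -> chi f = chi (monic_of (v : {poly_l F}))) ->
  \sum_(v : {poly_l F}) chi (monic_of v) = 0 ->
  `|\sum_(b : F) chi ('X - b%:P)| <= sqrtC #|F|%:R *+ l.-1.
Proof.
move=> p_prime cardF l_gt0 chiM chi1 chi_norm chi_top chi_sum.
have [K [emb _]] := countable_algebraic_closure F.
have := monic_sum1_bound p_prime cardF l_gt0 chiM chi1 chi_norm chi_top chi_sum emb.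
congr (`|_| <= _); rewrite /monic_sum.
pose fwd (b : F) : {poly_1 F} := npolyp 1 (- b%:P).
have fwdE b : fwd b = - b%:P :> {poly F}.
  by rewrite npolypK // size_polyN size_polyC leq_b1.
have bij_fwd : bijective fwd.
  apply: inj_card_bij; last by rewrite card_npoly expn1.
  by move=> b b' /(congr1 val); rewrite /= !fwdE => /oppr_inj/polyC_inj.
rewrite (reindex fwd) /=; last exact: onW_bij.
by apply: eq_bigr => b _; rewrite /monic_of fwdE expr1.
Qed.

(** * Counting split polynomials with prescribed top coefficients *)

Section PrincipalUnits.
Variables (F : finFieldType) (l : nat).
Hypothesis l_gt0 : (0 < l)%N.
Notation q := #|F|.
Notation h := ('X^(l.+1) : {poly F}).
Notation U := {unit {poly %/ h}}.

Lemma val_in_qpoly (P : {poly F}) : in_qpoly h P = take_poly l.+1 P :> {poly F}.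
Proof. by rewrite Pdiv.RingMonic.take_poly_rmodp /in_qpoly /= mk_monic_Xn. Qed.

Lemma in_qpoly_unit (P : {poly F}) : P`_0 != 0 -> in_qpoly h P \is a GRing.unit.
Proof.
move=> P0; have : coprimep P h.
  rewrite coprimep_expr // coprimep_sym; apply/coprimepP.
  have := coprimep_XsubC P 0; rewrite subr0 /root horner_coef0 P0 coprimep_sym.
  by move/coprimepP.
case/Bezout_eq1_coprimepP => -[u v] /= /(congr1 (in_qpoly h)).
rewrite rmorphD !rmorphM rmorph1 /=.
have -> : in_qpoly h h = 0.
  apply: val_inj; rewrite /= mk_monic_Xn.
  exact: Pdiv.RingMonic.rmodpp (monicXn _ _).
rewrite mulr0 addr0 => uP; apply/unitrPr; exists (in_qpoly h u).
by rewrite mulrC.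
Qed.

(** The default [1%g] makes the map total; for monic [f] the reversal has constant term 1, hence is
    a unit. *)
Definition punit (f : {poly F}) : U :=
  insubd (1%g : U) (in_qpoly h (rev_poly (size f).-1 f)).

Lemma rev_poly_monic0 n (f : {poly F}) : f \is monic -> size f = n.+1 -> (rev_poly n f)`_0 = 1.
Proof.
by move=> monf sz_f; rewrite coef_rev_poly /= subn0; have := monf; rewrite monicE lead_coefE sz_f => /eqP.
Qed.

Lemma val_punit n (f : {poly F}) : f \is monic -> size f = n.+1 ->
  val (punit f) = in_qpoly h (rev_poly n f).
Proof.
move=> monf sz_f; rewrite /punit sz_f /= insubdK //.
by apply: in_qpoly_unit; rewrite rev_poly_monic0 // oner_neq0.
Qed.

Lemma punitM f g : f \is monic -> g \is monic -> punit (f * g) = (punit f * punit g)%g.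
Proof.
move=> monf mong.
have szE (P : {poly F}) : P \is monic -> size P = (size P).-1.+1.
  by move=> /monic_neq0; rewrite -size_poly_gt0; case: (size P).
have sz_fg : size (f * g) = ((size f).-1 + (size g).-1).+1.
  by rewrite size_monicM ?monic_neq0 // (szE f) // (szE g) // addSn addnS.
apply: val_inj; rewrite FinRing.val_unitM (val_punit _ sz_fg) ?monicMl //.
rewrite (val_punit monf (szE _ monf)) (val_punit mong (szE _ mong)) -rmorphM.
by rewrite rev_polyM -?szE.
Qed.

Lemma punit1 : punit 1 = 1%g.
Proof.
apply: val_inj; rewrite (val_punit (n := 0)) ?monic1 ?size_poly1 //.
by rewrite /rev_poly big_ord1 coef1 scale1r expr0 rmorph1.
Qed.

Lemma punit_eqP n m f g : f \is monic -> size f = n.+1 -> g \is monic -> size g = m.+1 ->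
  (forall i, (i <= l)%N -> (rev_poly n f)`_i = (rev_poly m g)`_i) <-> punit f = punit g.
Proof.
move=> monf sz_f mong sz_g; split=> [H|/(congr1 val)].
  apply: val_inj; rewrite (val_punit monf sz_f) (val_punit mong sz_g); apply: val_inj.
  rewrite -[LHS]/(in_qpoly h _ : {poly F}) -[RHS]/(in_qpoly h _ : {poly F}) !val_in_qpoly.
  by apply/polyP => i; rewrite !coef_take_poly; case: ltnP => // lti; rewrite H.
rewrite (val_punit monf sz_f) (val_punit mong sz_g) => /(congr1 val).
rewrite -[LHS]/(in_qpoly h _ : {poly F}) -[RHS]/(in_qpoly h _ : {poly F}) !val_in_qpoly.
move=> /polyP H i le_il; have := H i; rewrite !coef_take_poly.
by rewrite ltnS le_il.
Qed.

Lemma same_top_punit n f (v : {poly_l F}) : f \is monic -> size f = n.+1 ->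
  same_top n f v <-> punit f = punit (monic_of v).
Proof.
move=> monf sz_f; rewrite -(punit_eqP monf sz_f (monic_of_monic v) (size_monic_of v)).
split=> [/forallP H i le_il|H]; first by have /eqP := H (Ordinal (le_il : (i < l.+1)%N)).
by apply/forallP => i; rewrite H // -ltnS.
Qed.

Lemma punit_top n f : f \is monic -> size f = n.+1 ->
  punit f = punit (monic_of (top_coefs l n f)).
Proof.
by move=> monf sz_f; apply/(same_top_punit _ monf sz_f); rewrite same_topE ?eqxx.
Qed.

Lemma punit_monic_inj : injective (fun v : {poly_l F} => punit (monic_of v)).
Proof.
move=> v w /esym/(same_top_punit v (monic_of_monic w) (size_monic_of w)) vw.
have /(same_top_punit w (monic_of_monic w) (size_monic_of w)) ww :
  punit (monic_of w) = punit (monic_of w) by [].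
move: vw ww; rewrite !same_topE ?monic_of_monic ?size_monic_of //.
by move=> /eqP -> /eqP <-.
Qed.

(** Degree [l] suffices: the class of any monic polynomial is determined by its [l] coefficients
    below the leading one. *)
Definition punits : {set U} := [set punit (monic_of v) | v : {poly_l F}].

Lemma mem_punits f : f \is monic -> punit f \in punits.
Proof.
move=> monf; have [n sz_f] : exists n, size f = n.+1.
  by exists (size f).-1; have := monic_neq0 monf; rewrite -size_poly_gt0; case: (size f).
by rewrite (punit_top monf sz_f); apply/imsetP; exists (top_coefs l n f).
Qed.

Lemma punits_group_set : group_set punits.
Proof.
apply/group_setP; split; first by rewrite -punit1 mem_punits ?monic1.
move=> _ _ /imsetP[v _ ->] /imsetP[w _ ->].
by rewrite -punitM ?monic_of_monic // mem_punits // monicMl ?monic_of_monic.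
Qed.

Canonical punits_group := Group punits_group_set.

Lemma card_punits : #|punits| = (q ^ l)%N.
Proof. by rewrite card_imset ?card_npoly //; apply: punit_monic_inj. Qed.

Lemma punits_abelian : abelian punits.
Proof.
apply/centsP => x _ y _; apply: val_inj.
by rewrite !FinRing.val_unitM mulrC.
Qed.

End PrincipalUnits.

(** A majorant series argument: the recursion of [E] is dominated term by term by that of [W]. *)
Lemma log_rec_norm_le (b E : nat -> algC) (w W : nat -> nat) :
  E 0%N = 1 -> log_rec b E -> (forall i, (0 < i)%N -> `|b i| <= (w i)%:R) ->
  W 0%N = 1%N -> (forall n, (n * W n = \sum_(1 <= i < n.+1) w i * W (n - i))%N) ->
  forall n, `|E n| <= (W n)%:R.
Proof.
move=> E0 recE le_b W0 recW; elim/ltn_ind => -[_|n IH]; first by rewrite E0 W0 normr1.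
rewrite -(ler_pMn2r (ltn0Sn n)) -normrMn recE -mulrnA mulnC recW natr_sum.
apply: le_trans (ler_norm_sum _ _ _) _; rewrite !big_nat; apply: ler_sum => i /andP[i0 lt_i].
rewrite normrM natrM ler_pM ?normr_ge0 ?le_b // IH //.
by rewrite ltn_subrL i0.
Qed.

Lemma coef_prod_linear (R : comNzRingType) (I : finType) (c : I -> R) (m : nat) :
  (\prod_i (1 + c i *: 'X))`_m = \sum_(A : {set I} | #|A| == m) \prod_(i in A) c i.
Proof.
under eq_bigr do rewrite addrC.
rewrite bigA_distr coef_sum [RHS]big_mkcond /=; apply: eq_bigr => A _.
rewrite -big_mkcond /=.
rewrite (eq_bigr (fun i => (c i)%:P * 'X)) => [|i _]; last by rewrite mul_polyC.
rewrite big_split /= prodr_const -rmorph_prod /= coefCM coefXn eq_sym.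
by case: eqP; rewrite ?mulr1 ?mulr0.
Qed.

(** * Character sums over split polynomials *)

Section CharacterSums.
Variables (F : finFieldType) (p e l : nat).
Hypothesis p_prime : prime p.
Hypothesis cardF : #|F| = (p ^ e)%N.
Hypothesis l_gt0 : (0 < l)%N.
Notation q := #|F|.
Let G := punits_group F l_gt0.
Let punit (f : {poly F}) := punit l f.

Let G_abelian : abelian G. Proof. exact: punits_abelian. Qed.
Let lin_irr (i : Iirr G) : 'chi_i \is a linear_char.
Proof. exact: (char_abelianP _ G_abelian). Qed.
Let G_punit (f : {poly F}) : f \is monic -> punit f \in G.
Proof. exact: (mem_punits l_gt0). Qed.

(** The order of [G] is a power of [p], so the power map of exponent [j] permutes [G]; if [chi ^ j]
    were trivial, so would be [chi]. *)
Lemma irr_pow_neq1 (i : Iirr G) j : i != 0 -> coprime p j ->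
  exists2 x, x \in G & 'chi_i x ^+ j != 1.
Proof.
move=> i0 co_pj; have coGj : coprime #|G| j.
  by rewrite card_punits // cardF -expnM coprimeXl.
case: (boolP [exists x in G, 'chi_i x ^+ j != 1]) => [/exists_inP[x Gx]|]; first by exists x.
rewrite negb_exists_in => /forall_inP chi1.
case/eqP: i0; apply: irr_inj; rewrite irr0; apply/cfun_inP => x Gx.
rewrite cfun1E Gx -{1}(expgK coGj Gx) expgAC lin_charX ?groupX //.
by apply/eqP; rewrite -[_ == _]negbK chi1 // groupX.
Qed.

Lemma irr_sum_bound (i : Iirr G) j : i != 0 -> coprime p j ->
  `|\sum_(b : F) 'chi_i (punit ('X - b%:P)) ^+ j| <= sqrtC q%:R *+ l.-1.
Proof.
move=> i0 co_pj; pose chi f := 'chi_i (punit f) ^+ j.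
apply: (weil_bound (chi := chi) p_prime cardF l_gt0).
- move=> f g mf mg; rewrite /chi /punit punitM //.
  by rewrite lin_charM ?exprMn // G_punit.
- by rewrite /chi /punit punit1 lin_char1 // expr1n.
- by move=> f mf; rewrite /chi normrX normC_lin_char ?expr1n ?G_punit.
- move=> n f v mf sz_f /(same_top_punit v mf sz_f) eq_fv.
  by rewrite /chi /punit eq_fv.
have [y Gy chi_y] := irr_pow_neq1 i0 co_pj.
have -> : \sum_(v : {poly_l F}) chi (monic_of v) = \sum_(x in G) 'chi_i x ^+ j.
  rewrite -[RHS]/(\sum_(x in punits F l) _) [RHS]big_imset //=.
  by move=> v w _ _; apply: punit_monic_inj.
suff : (1 - 'chi_i y ^+ j) * \sum_(x in G) 'chi_i x ^+ j = 0.
  by move/eqP; rewrite mulf_eq0 subr_eq0 eq_sym (negPf chi_y) => /eqP.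
rewrite mulrBl mul1r {1}(reindex_inj (mulgI y)) /= mulr_sumr.
apply/eqP; rewrite subr_eq0; apply/eqP/eq_big => x; first by rewrite groupMl.
by rewrite groupMl // => Gx; rewrite lin_charM // exprMn.
Qed.

Lemma punit_prod (A : {set F}) :
  punit (\prod_(b in A) ('X - b%:P)) = (\prod_(b in A) punit ('X - b%:P))%g.
Proof.
suff [] : \prod_(b in A) ('X - b%:P) \is monic /\
  punit (\prod_(b in A) ('X - b%:P)) = (\prod_(b in A) punit ('X - b%:P))%g by [].
elim/big_rec2: _ => [|b P x _ [mP <-]]; first by rewrite monic1 /punit punit1.
by rewrite monicMl ?monicXsubC // /punit punitM ?monicXsubC.
Qed.

(** The sum is the elementary symmetric function of degree [m] of the values [c b]. Their power sums
    of exponent [j] are at most [B] by the Weil bound if [p] does not divide [j], and at most [q]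
    trivially otherwise. *)
Lemma irr_subset_sum (B m : nat) (W : nat -> nat) (i : Iirr G) : i != 0 ->
  (l.-1 ^ 2 * q <= B ^ 2)%N -> W 0%N = 1%N ->
  (forall n, (n * W n = \sum_(1 <= j < n.+1) (B + q * (p %| j)) * W (n - j))%N) ->
  `|\sum_(A : {set F} | #|A| == m) 'chi_i (punit (\prod_(b in A) ('X - b%:P)))| <= (W m)%:R.
Proof.
move=> i0 leB W0 recW; pose c b := 'chi_i (punit ('X - b%:P)).
rewrite (eq_bigr (fun A : {set F} => \prod_(b in A) c b)) => [|A _]; last first.
  rewrite punit_prod; suff [] : (\prod_(b in A) punit ('X - b%:P))%g \in G /\
    'chi_i (\prod_(b in A) punit ('X - b%:P))%g = \prod_(b in A) c b by [].
  elim/big_rec2: _ => [|b x y _ [Gx <-]]; first by rewrite group1 lin_char1.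
  by rewrite groupM ?G_punit ?monicXsubC // lin_charM ?G_punit ?monicXsubC.
have [E defE recE] := log_rec_prod [seq - c b | b <- index_enum F].
have {}defE n : E n = \sum_(A : {set F} | #|A| == n) \prod_(b in A) c b.
  rewrite defE -coef_prod_linear big_map.
  by rewrite (eq_bigr (fun b => 1 + c b *: 'X)) // => b _; rewrite scaleNr opprK.
rewrite -defE; apply: (log_rec_norm_le _ recE _ W0 recW) => [|j j0].
  rewrite defE (big_pred1 set0) => [|A]; first by rewrite big_set0.
  by rewrite cards_eq0.
rewrite normrN big_map (eq_bigr (fun b => (-1) ^+ j * c b ^+ j)); last first.
  by move=> b _; rewrite [LHS]exprNn.
rewrite -mulr_sumr normrM normrX normrN1 expr1n mul1r.
case: (boolP (p %| j)%N) => [dv|ndv]; last first.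
  rewrite muln0 addn0; apply: le_trans (irr_sum_bound i0 _) _; first by rewrite prime_coprime.
  rewrite -[sqrtC _ *+ _]mulr_natr -(ler_pXn2r (n := 2)) ?nnegrE ?mulr_ge0 ?sqrtC_ge0 ?ler0n //.
  by rewrite exprMn sqrtCK -!natrX -natrM ler_nat mulnC.
apply: le_trans (ler_norm_sum _ _ _) _.
rewrite (eq_bigr (fun=> 1)) => [|b _]; last first.
  by rewrite normrX normC_lin_char ?expr1n ?G_punit ?monicXsubC.
by rewrite sumr_const ler_nat muln1 leq_addl.
Qed.

(** Were the class of [f] missed, second orthogonality summed over all sets would give zero. The
    trivial character contributes ['C(q, m)], and the others, at most [q ^ l] in number, at most
    [W m] each. *)
Lemma exists_split_class (B m : nat) (W : nat -> nat) (f : {poly F}) :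
  f \is monic -> (l.-1 ^ 2 * q <= B ^ 2)%N -> W 0%N = 1%N ->
  (forall n, (n * W n = \sum_(1 <= j < n.+1) (B + q * (p %| j)) * W (n - j))%N) ->
  (q ^ l * W m < 'C(q, m))%N ->
  exists2 A : {set F}, #|A| = m & punit (\prod_(b in A) ('X - b%:P)) = punit f.
Proof.
move=> mf leB W0 recW ltC.
pose pA (A : {set F}) := punit (\prod_(b in A) ('X - b%:P)).
case: (pickP (fun A : {set F} => (#|A| == m) && (pA A == punit f))) => [A /andP[/eqP ? /eqP ?]|none].
  by exists A.
have GpA A : pA A \in G by apply/G_punit/monic_prod_XsubC.
have : \sum_(A : {set F} | #|A| == m) \sum_i 'chi[G]_i (pA A) * ('chi_i (punit f))^* = 0.
  rewrite big1 // => A cA; rewrite second_orthogonality_relation ?G_punit //.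
  have -> : (pA A \in (punit f ^: G)%g) = (pA A == punit f).
    by rewrite (abelian_classP _ G_abelian _ (G_punit mf)) inE.
  by have := none A; rewrite cA /= => ->.
rewrite exchange_big /= (bigD1 0) //= irr0.
rewrite (eq_bigr (fun=> 1)) => [|A _]; last first.
  by rewrite !cfun1E GpA G_punit // conjC1 mulr1.
have -> : \sum_(A : {set F} | #|A| == m) 1 = 'C(q, m)%:R :> algC.
  rewrite sumr_const; congr (_%:R); rewrite -card_draws.
  by apply: eq_card => A; rewrite !inE.
move/eqP; rewrite addr_eq0 => /eqP/(congr1 Num.norm); rewrite normrN normr_nat => eqC.
have : 'C(q, m)%:R <= (q ^ l * W m)%:R :> algC.
  rewrite eqC; apply: le_trans (ler_norm_sum _ _ _) _.
  apply: le_trans (_ : \sum_(i : Iirr G | i != 0) (W m)%:R <= _).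
    apply: ler_sum => i i0; rewrite -mulr_suml normrM norm_conjC.
    by rewrite normC_lin_char ?G_punit // mulr1; apply: (irr_subset_sum _ i0 leB).
  rewrite sumr_const -mulrnA ler_nat mulnC leq_mul2r.
  apply/orP; right; rewrite -card_punits // -(card_Iirr_abelian G_abelian).
  exact: max_card.
by rewrite ler_nat leqNgt ltC.
Qed.

End CharacterSums.

(** * From split polynomials to codewords *)

Section OrdinaryCriterion.
Variables (F : finFieldType) (p e l k : nat).
Hypothesis p_prime : prime p.
Hypothesis cardF : #|F| = (p ^ e)%N.
Hypothesis l_gt0 : (0 < l)%N.
Notation q := #|F|.

(** [f] and [P] share their coefficients of index at least [k], so [f - P] gives a codeword. Its
    word differs from that of [f] exactly where [P] does not vanish, that is, off [A]. *)
Lemma ordinary_of_split (f : {poly F}) (A : {set F}) :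
  f \is monic -> size f = (k + l).+1 -> #|A| = (k + l)%N ->
  punit l (\prod_(b in A) ('X - b%:P)) = punit l f -> ordinary k f.
Proof.
move=> mf sz_f cA; set P := \prod_(b in A) _ => eq_u.
have PE : P = \prod_(b <- enum A) ('X - b%:P) by rewrite /P big_enum.
have mP : P \is monic by apply: monic_prod_XsubC.
have sz_P : size P = (k + l).+1.
  by rewrite PE size_prod_XsubC -cardE cA.
have le_k : (size (f - P)%R <= k)%N.
  apply/leq_sizeP => j le_kj; rewrite coefB; case: (ltnP (k + l) j) => [lt_j|le_j].
    by rewrite !nth_default ?subrr ?sz_f ?sz_P.
  have /(punit_eqP l mP sz_P mf sz_f) := eq_u => /(_ (k + l - j)%N).
  rewrite !coef_rev_poly leq_subr subKn // => -> //; first by rewrite subrr.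
  by move: le_kj le_j; lia.
rewrite /ordinary sz_f /= /count_at; apply/card_gt0P.
exists (word_of (polyn (npolyp k (f - P)))); rewrite inE; apply/andP; split.
  exact: imset_f.
rewrite npolypK //; apply/eqP; rewrite -cA addnC -[RHS](cardC A).
congr (_ + _)%N; apply: eq_card => x; rewrite !inE !ffunE hornerD hornerN.
rewrite -subr_eq0 addrAC subrr add0r oppr_eq0 -[_ == 0]/(root P x) PE root_prod_XsubC.
by rewrite mem_enum.
Qed.

Theorem ordinary_criterion (B : nat) (W : nat -> nat) (f : {poly F}) :
  f \is monic -> size f = (k + l).+1 ->
  (l.-1 ^ 2 * q <= B ^ 2)%N -> W 0%N = 1%N ->
  (forall n, (n * W n = \sum_(1 <= j < n.+1) (B + q * (p %| j)) * W (n - j))%N) ->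
  (q ^ l * W (k + l) < 'C(q, k + l))%N ->
  ordinary k f.
Proof.
move=> mf sz_f leB W0 recW ltC.
have [A cA] := exists_split_class p_prime cardF l_gt0 mf leB W0 recW ltC.
exact: ordinary_of_split.
Qed.

End OrdinaryCriterion.

Lemma ordinary_not_deep_hole (F : finFieldType) (k l : nat) (f : {poly F}) :
  (0 < l)%N -> size f = (k + l).+1 -> ordinary k f -> ~ deep_hole k f.
Proof.
move=> l_gt0 sz_f; rewrite /ordinary sz_f /= => pos /(_ (k + l)%N).
rewrite -[k.+1]addn1 leq_add2l => /(_ l_gt0) eq0.
by rewrite eq0 in pos.
Qed.

(** * Asymptotic estimates *)

Section GeometricSeries.

(* Multiplication of the series [E] by [1 / (1 - T ^ d)]. *)
Definition geo_conv (d : nat) (E : nat -> nat) (n : nat) : nat :=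
  \sum_(i < n.+1 | (d %| n - i)%N) E i.

Lemma geo_conv_small d E n : (n < d)%N -> geo_conv d E n = E n.
Proof.
move=> lt_nd; rewrite /geo_conv (big_pred1 ord_max) // => i.
apply/idP/eqP => [dv|->]; last by rewrite /= subnn dvdn0.
apply: val_inj => /=; have le_in : (i <= n)%N by rewrite -ltnS.
case: (posnP (n - i)%N) => [|lt_in]; first by lia.
have := dvdn_leq lt_in dv; lia.
Qed.

Lemma geo_convD d E n : (0 < d)%N -> (d <= n)%N ->
  geo_conv d E n = (E n + geo_conv d E (n - d))%N.
Proof.
move=> d0 le_dn; rewrite /geo_conv big_mkcond big_ord_recr /= subnn dvdn0 addnC; congr (_ + _)%N.
rewrite [RHS]big_mkcond /= -!(big_mkord xpredT (fun i => if (d %| _ - i)%N then E i else 0%N)).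
rewrite (big_cat_nat _ (n := (n - d).+1)) //=; last by rewrite ltn_subrL d0 (leq_trans d0).
rewrite [X in (_ + X)%N]big_nat [X in (_ + X)%N]big1 ?addn0 => [|i /andP[lt_i lt_in]].
  apply: eq_big_nat => i /andP[_ le_i]; rewrite ltnS in le_i.
  suff -> : (d %| n - i)%N = (d %| n - d - i)%N by [].
  by rewrite -[in LHS](subnK le_dn) addnC -addnBA // dvdn_addr.
case: ifP => // /dvdn_leq; rewrite subn_gt0 lt_in => /(_ isT); lia.
Qed.

Definition nat_log_rec (w E : nat -> nat) : Prop :=
  forall n, (n * E n = \sum_(1 <= j < n.+1) w j * E (n - j))%N.

(** Since [- log (1 - T^d) = \sum T^(d i) / i], a factor [1 / (1 - T^d)] adds [d] to the weights at
    multiples of [d]. *)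
Lemma geo_conv_log_rec d w E : (0 < d)%N -> nat_log_rec w E ->
  nat_log_rec (fun j => w j + d * (d %| j))%N (geo_conv d E).
Proof.
move=> d0 recE; elim/ltn_ind => n IH; case: (ltnP n d) => [lt_nd|le_dn].
  rewrite geo_conv_small // recE; apply: eq_big_nat => j /andP[j0 lt_j].
  rewrite geo_conv_small ?(leq_ltn_trans (leq_subr _ _)) //.
  have -> : (d %| j)%N = false.
    by apply/negP => /dvdn_leq - /(_ j0); rewrite leqNgt (leq_trans _ lt_nd).
  by rewrite muln0 addn0.
pose G := geo_conv d E.
rewrite (eq_bigr (fun j => w j * G (n - j) + d * ((d %| j) * G (n - j)))%N); last first.
  by move=> j _; rewrite mulnDl mulnA.
rewrite big_split /= -big_distrr /=.
have -> : (\sum_(1 <= j < n.+1) (d %| j) * G (n - j) =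
    G (n - d) + \sum_(1 <= j < (n - d).+1) (d %| j) * G (n - d - j))%N.
  rewrite (big_cat_nat _ (n := d)) //=; last exact: leqW.
  rewrite big_nat big1 ?add0n => [|j /andP[j0 lt_jd]]; last first.
    by rewrite (gtnNdvd j0 lt_jd).
  rewrite big_ltn ?ltnS // dvdnn mul1n -[d.+1]add1n big_addn subSn //.
  congr (_ + _)%N; apply: eq_bigr => j _.
  by rewrite dvdn_addl // -subnDA addnC.
have -> : (\sum_(1 <= j < n.+1) w j * G (n - j) =
    n * E n + \sum_(1 <= j < (n - d).+1) w j * G (n - d - j))%N.
  have le_nd : ((n - d).+1 <= n.+1)%N by rewrite ltnS leq_subr.
  rewrite recE (big_cat_nat _ le_nd) //= [in RHS](big_cat_nat _ le_nd) //=.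
  rewrite addnAC -big_split /=; congr (_ + _)%N; apply: eq_big_nat => j /andP[j0 lt_j].
    rewrite /G geo_convD //; last by move: lt_j; rewrite ltnS; lia.
    by rewrite mulnDr -!subnDA [(d + j)%N]addnC.
  by rewrite /G geo_conv_small //; lia.
rewrite {1}geo_convD // mulnDr -[(n * geo_conv d E (n - d))%N](_ : (d * G (n - d) + (n - d) * G (n - d) = _)%N).
  rewrite -addnA; congr (_ + _)%N; rewrite IH; last by rewrite ltn_subrL d0 (leq_trans d0).
  rewrite (eq_bigr (fun j => w j * G (n - d - j) + d * ((d %| j) * G (n - d - j)))%N); last first.
    by move=> j _; rewrite mulnDl mulnA.
  by rewrite big_split /= -big_distrr /= mulnDr addnCA.
by rewrite -mulnDl subnKC.
Qed.

(* The coefficients of [(1 - T) ^ - B * (1 - T ^ p) ^ - Q]. *)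
Definition weil_majorant (B p Q : nat) : nat -> nat :=
  iter Q (geo_conv p) (iter B (geo_conv 1) (fun n => (n == 0)%N : nat)).

Lemma geo_conv0 d E : geo_conv d E 0 = E 0%N.
Proof. by rewrite /geo_conv (big_pred1 ord0) // => i; rewrite ord1 dvdn0 /= eqxx. Qed.

Lemma weil_majorant0 B p Q : weil_majorant B p Q 0 = 1%N.
Proof.
rewrite /weil_majorant; elim: Q => [|Q IH] /=; last by rewrite geo_conv0.
by elim: B => [|B IH] //=; rewrite geo_conv0.
Qed.

Lemma weil_majorant_rec B p Q : (0 < p)%N ->
  nat_log_rec (fun j => B + p * Q * (p %| j))%N (weil_majorant B p Q).
Proof.
move=> p0; rewrite /weil_majorant.
have ext w w' E : w =1 w' -> nat_log_rec w E -> nat_log_rec w' E.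
  by move=> eq_w recE n; rewrite recE; apply: eq_bigr => j _; rewrite eq_w.
elim: Q => [|Q IH] /=.
  apply: (ext (fun=> B)) => [j|]; first by rewrite muln0 mul0n addn0.
  elim: B => [|B IH] /=.
    by move=> n; rewrite big1 => [|j _]; [case: n => // n; rewrite muln0 | rewrite mul0n].
  apply: ext (geo_conv_log_rec (ltn0Sn 0) IH) => j.
  by rewrite dvd1n addn1.
apply: ext (geo_conv_log_rec p0 IH) => j.
by rewrite mulnS; lia.
Qed.

Variable R : realFieldType.

(** The product identity of the two series at [r], on partial sums: cutting off nonnegative terms
    turns it into an inequality, with no convergence to discuss. *)
Lemma geo_conv_sum_le d (E : nat -> nat) (r : R) N : (0 < d)%N -> 0 <= r ->
  (\sum_(n < N) (geo_conv d E n)%:R * r ^+ n) * (1 - r ^+ d) <=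
  \sum_(n < N) (E n)%:R * r ^+ n.
Proof.
move=> d0 r0; set S := \sum_(n < N) (geo_conv d E n)%:R * r ^+ n.
rewrite mulrBr mulr1 lerBlDr.
pose T n := if (d <= n)%N then (geo_conv d E (n - d))%:R * r ^+ (n - d) * r ^+ d else 0.
have geoE n : (geo_conv d E n)%:R * r ^+ n = (E n)%:R * r ^+ n + T n.
  rewrite /T; case: leqP => [le_dn|lt_nd]; last by rewrite geo_conv_small // addr0.
  by rewrite geo_convD // natrD mulrDl -mulrA -exprD subnK.
rewrite {1}/S (eq_bigr (fun n : 'I_N => (E n)%:R * r ^+ n + T n)) => [|n _]; last exact: geoE.
rewrite big_split /= lerD2l -(big_mkord xpredT T) /T.
have term0 n : 0 <= (geo_conv d E n)%:R * r ^+ n by rewrite mulr_ge0 ?exprn_ge0.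
case: (leqP d N) => [le_dN|lt_Nd]; last first.
  rewrite big_nat big1 ?mulr_ge0 ?exprn_ge0 ?sumr_ge0 // => n /andP[_ lt_nN].
  by rewrite leqNgt (ltn_trans lt_nN).
rewrite (big_cat_nat _ (n := d)) //= big_nat big1 ?add0r => [|n /andP[_ lt_nd]]; last first.
  by rewrite leqNgt lt_nd.
rewrite -[d in \sum_(d <= _ < _) _]add0n big_addn.
rewrite (eq_bigr (fun n => (geo_conv d E n)%:R * r ^+ n * r ^+ d)); last first.
  by move=> n _; rewrite leq_addl addnK.
rewrite -mulr_suml ler_wpM2r ?exprn_ge0 // /S -(big_mkord xpredT (fun n => (geo_conv d E n)%:R * r ^+ n)).
rewrite [X in _ <= X](big_cat_nat _ (n := (N - d)%N)) ?leq_subr //= lerDl sumr_ge0 //.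
Qed.

(** A Cauchy estimate: the coefficients are nonnegative, so the term of index [m] is at most the
    partial sum at [r]. *)
Lemma weil_majorant_le B p Q (r : R) m : (0 < p)%N -> 0 <= r <= 1 ->
  (weil_majorant B p Q m)%:R * r ^+ m * ((1 - r) ^+ B * (1 - r ^+ p) ^+ Q) <= 1.
Proof.
move=> p0 /andP[r0 r1]; pose S E := \sum_(n < m.+1) (E n : nat)%:R * r ^+ n.
have t_ge0 d : 0 <= 1 - r ^+ d by rewrite subr_ge0 exprn_ile1.
have S_B E b : S (iter b (geo_conv 1) E) * (1 - r) ^+ b <= S E.
  elim: b => [|b IH] /=; first by rewrite mulr1.
  apply: le_trans IH; rewrite exprS mulrA ler_wpM2r ?exprn_ge0 ?subr_ge0 //.
  by have := geo_conv_sum_le (iter b (geo_conv 1) E) m.+1 (ltn0Sn 0) r0.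
have S_Q E b : S (iter b (geo_conv p) E) * (1 - r ^+ p) ^+ b <= S E.
  elim: b => [|b IH] /=; first by rewrite mulr1.
  apply: le_trans IH; rewrite exprS mulrA ler_wpM2r ?exprn_ge0 //.
  exact: geo_conv_sum_le.
apply: le_trans (_ : S (weil_majorant B p Q) * ((1 - r) ^+ B * (1 - r ^+ p) ^+ Q) <= _).
  apply: ler_wpM2r; first by apply: mulr_ge0; apply: exprn_ge0; rewrite ?t_ge0 // subr_ge0.
  rewrite /S big_ord_recr /= lerDr.
  by rewrite sumr_ge0 // => n _; rewrite mulr_ge0 ?exprn_ge0.
rewrite [_ ^+ B * _]mulrC mulrA.
apply: le_trans (_ : S (iter B (geo_conv 1) (fun n => (n == 0)%N : nat)) * (1 - r) ^+ B <= _).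
  by apply: ler_wpM2r; [rewrite exprn_ge0 ?subr_ge0 | exact: S_Q].
apply: le_trans (S_B _ _) _; rewrite /S big_ord_recl /= mulr1 big1 ?addr0 // => n _.
by rewrite mul0r.
Qed.

End GeometricSeries.

(** * Lower bounds for binomial coefficients *)

(** Among the [q.+1] terms in the expansion of [(k + (q - k))^q], that of index [k] is the largest:
    the ratios of consecutive terms show a rise up to [k] and a fall afterwards. *)
Lemma bin_central_term q k : (k <= q)%N ->
  (q ^ q <= q.+1 * ('C(q, k) * (k ^ k * (q - k) ^ (q - k))))%N.
Proof.
move=> le_kq; pose t j := ('C(q, j) * ((q - k) ^ (q - j) * k ^ j))%N.
have step j : (j < q)%N -> (j.+1 * (q - k) * t j.+1 = (q - j) * k * t j)%N.
  move=> lt_jq; rewrite /t -[in RHS](subnSK lt_jq) [in RHS]expnS [(k ^ j.+1)%N]expnS.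
  have := mul_bin_left q j; move: 'C(q, j.+1) 'C(q, j) ((q - k) ^ _)%N (k ^ j)%N.
  rewrite -(subnSK lt_jq); move: (q - j.+1).+1%N (q - k)%N => c b a d u v e.
  by transitivity ((j.+1 * a) * (b * u * (k * v)))%N; [ring | rewrite e; ring].
have t_max j : (j <= q)%N -> (t j <= t k)%N.
  have up i : (i < k)%N -> (t i <= t i.+1)%N.
    move=> lt_ik; have lt_iq : (i < q)%N by apply: leq_trans le_kq.
    case: (posnP (q - k)) => [qk0|qk0].
      rewrite {1}/t qk0 exp0n ?mul0n ?muln0 // subn_gt0 //.
    rewrite -(leq_pmul2l (_ : 0 < i.+1 * (q - k))%N) ?muln_gt0 ?qk0 // step //.
    by rewrite leq_mul2r; apply/orP; right; nia.
  have down i : (k <= i < q)%N -> (t i.+1 <= t i)%N.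
    case/andP=> le_ki lt_iq; have qk0 : (0 < q - k)%N by rewrite subn_gt0 (leq_ltn_trans le_ki).
    rewrite -(leq_pmul2l (_ : 0 < i.+1 * (q - k))%N) ?muln_gt0 ?qk0 // step //.
    by rewrite leq_mul2r; apply/orP; right; nia.
  case: (leqP j k) => [le_jk _|lt_kj].
    rewrite -(subKn le_jk); elim: (k - j)%N (leq_subr j k) => [|n IH] le_nk; first by rewrite subn0.
    apply: leq_trans (IH (ltnW le_nk)); have := up (k - n.+1)%N.
    by rewrite subnSK //; apply; apply: leq_subr.
  elim: j lt_kj => // j IH; rewrite ltnS => le_kj lt_jq.
  apply: leq_trans (down j _) _; first by rewrite le_kj.
  move: le_kj; rewrite leq_eqVlt => /orP[/eqP->//|lt_kj].
  by apply: IH => //; apply: ltnW.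
have -> : (q ^ q = \sum_(j < q.+1) t j)%N.
  by rewrite -[X in (X ^ _)%N](subnK le_kq) expnDn.
apply: leq_trans (_ : \sum_(j < q.+1) t k <= _)%N.
  by apply: leq_sum => j _; apply: t_max; rewrite -ltnS.
by rewrite sum_nat_const card_ord /t [(k ^ k * _)%N]mulnC.
Qed.

Lemma bin_shift_le q k l : (k + l <= q)%N -> ('C(q, k) <= 'C(q, k + l) * q ^ l)%N.
Proof.
elim: l => [|l IH] le_q; first by rewrite addn0 muln1.
apply: leq_trans (IH _) _; first by apply: leq_trans le_q; rewrite leq_add2l.
rewrite addnS expnS mulnA leq_mul2r; apply/orP; right.
have := mul_bin_left q (k + l); move: le_q; rewrite addnS => lt_q e.
apply: leq_trans (_ : 'C(q, (k + l).+1) * (k + l).+1 <= _)%N.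
  by rewrite mulnC e leq_pmull // subn_gt0.
by rewrite leq_mul2l lt_q orbT.
Qed.

From mathcomp Require Import all_classical all_reals all_analysis lra.
Import Order.TTheory GRing.Theory Num.Theory.

(** * Entropy and comparison with the binomial coefficient *)

Section EntropyEstimates.
Variable R : realType.
Implicit Types x c r : R.

Definition entropy c : R := c * ln (1 / c) + (1 - c) * ln (1 / (1 - c)).

Lemma ln_le_sub1 x : 0 < x -> ln x <= x - 1.
Proof.
move=> x0; have {1}-> : x = 1 + (x - 1) by lra.
by apply: le_ln1Dx; lra.
Qed.

Lemma ln1V x : 0 < x -> ln (1 / x) = - ln x.
Proof. by move=> x0; rewrite div1r lnV ?posrE. Qed.

Lemma mul_lnV_le x : 0 < x -> x * ln (1 / x) <= 1 - x.
Proof.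
move=> x0; have := @ln_le_sub1 (1 / x); rewrite divr_gt0 // => /(_ isT).
rewrite -(ler_pM2l x0) => H; apply: le_trans H _.
by rewrite mulrBr mulr1 mulrCA divff ?gt_eqF // mulr1.
Qed.

Lemma entropy_le1 c : 0 < c -> c < 1 -> entropy c <= 1.
Proof.
move=> c0 c1; have := mul_lnV_le c0; have := @mul_lnV_le (1 - c); rewrite subr_gt0 => /(_ c1).
rewrite /entropy; lra.
Qed.

(** With [t = sqrt (1 - c)], the two terms are at most [t^2] and [2 t (1 - t)]. The bound keeps [c]
    away from 1 when the entropy is bounded below. *)
Lemma entropy_le_sqrt c : 0 < c -> c < 1 -> entropy c <= 2 * Num.sqrt (1 - c).
Proof.
move=> c0 c1; have d0 : 0 < 1 - c by rewrite subr_gt0.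
set t := Num.sqrt (1 - c); have t0 : 0 < t by rewrite sqrtr_gt0.
have t2 : 1 - c = t * t by rewrite -expr2 sqr_sqrtr ?ltW.
have := mul_lnV_le c0; have := mul_lnV_le t0.
rewrite /entropy t2 (ln1V (mulr_gt0 t0 t0)) (ln1V t0) (lnM (x := t) (y := t)) ?posrE //.
by move: (c * _) (ln t) => u v; nra.
Qed.

Lemma bernoulli_sub (r : R) p : 0 <= r -> r <= 1 -> 1 - r ^+ p <= p%:R * (1 - r).
Proof.
move=> r0 r1; elim: p => [|p IH]; first by rewrite expr0 subrr mul0r.
have : r ^+ p <= 1 by apply: exprn_ile1.
have : 0 <= r ^+ p by apply: exprn_ge0.
rewrite exprS -natr1; move: (r ^+ p) (p%:R : R) IH => u v; nra.
Qed.

(** Logarithms of the bound in [weil_majorant_le] and of the lower bound for the binomial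
    coefficient; [q.+1] and the second [q ^ l] are the losses in [bin_central_term] and
    [bin_shift_le]. *)
Lemma majorant_lt_bin (q l k B p Q : nat) (r : R) : (0 < p)%N -> 0 < r -> r < 1 ->
  (0 < k < q)%N -> (k + l <= q)%N ->
  l%:R * ln q%:R - (k + l)%:R * ln r - B%:R * ln (1 - r) - Q%:R * ln (1 - r ^+ p) <
    q%:R * entropy (k%:R / q%:R) - ln q.+1%:R - l%:R * ln q%:R ->
  (q ^ l * weil_majorant B p Q (k + l) < 'C(q, k + l))%N.
Proof.
move=> p0 r0 r1 /andP[k0 kq] klq ltE.
have q0 : (0 < q)%N by apply: ltn_trans kq.
have qR : 0 < q%:R :> R by rewrite ltr0n.
have kR : 0 < k%:R :> R by rewrite ltr0n.
have dR : 0 < (q - k)%:R :> R by rewrite ltr0n subn_gt0.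
have rp1 : 0 < 1 - r ^+ p by rewrite subr_gt0 exprn_ilt1 // ?ltW // -lt0n.
have r1' : 0 < 1 - r by rewrite subr_gt0.
pose X := r ^+ (k + l) * ((1 - r) ^+ B * (1 - r ^+ p) ^+ Q).
have X0 : 0 < X by rewrite !mulr_gt0 ?exprn_gt0.
have lnX : ln X = (k + l)%:R * ln r + (B%:R * ln (1 - r) + Q%:R * ln (1 - r ^+ p)).
  by rewrite !lnM ?posrE ?mulr_gt0 ?exprn_gt0 // !lnXn // !mulr_natl.
pose D := (q.+1 * (k ^ k * (q - k) ^ (q - k)))%N.
have D0 : (0 < D)%N by rewrite !muln_gt0 !expn_gt0 k0 subn_gt0 kq.
have lnD : ln (D%:R : R) = ln q.+1%:R + (k%:R * ln k%:R + (q - k)%:R * ln (q - k)%:R).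
  by rewrite !natrM !natrX !lnM ?posrE ?mulr_gt0 ?exprn_gt0 ?ltr0Sn // !lnXn // !mulr_natl.
have entropyE : q%:R * entropy (k%:R / q%:R) =
    q%:R * ln q%:R - k%:R * ln k%:R - (q - k)%:R * ln (q - k)%:R.
  have -> : entropy (k%:R / q%:R) = k%:R / q%:R * (ln q%:R - ln k%:R) +
     (q - k)%:R / q%:R * (ln q%:R - ln (q - k)%:R).
    rewrite /entropy; have -> : 1 - k%:R / q%:R = (q - k)%:R / q%:R :> R.
      by rewrite natrB ?(ltnW kq) // mulrBl divff ?gt_eqF.
    by rewrite !div1r !invf_div !ln_div ?posrE.
  rewrite natrB ?(ltnW kq) //; field; exact: lt0r_neq0.
have main : q%:R ^+ l * (q%:R ^+ l * D%:R) < q%:R ^+ q * X.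
  rewrite -ltr_ln ?posrE ?mulr_gt0 ?exprn_gt0 ?ltr0n //.
  have -> : ln (q%:R ^+ q * X) = q%:R * ln q%:R + ln X.
    by rewrite lnM ?posrE ?exprn_gt0 // lnXn // mulr_natl.
  have -> : ln (q%:R ^+ l * (q%:R ^+ l * D%:R)) =
      l%:R * ln q%:R + (l%:R * ln q%:R + ln (D%:R : R)).
    by rewrite !lnM ?posrE ?mulr_gt0 ?exprn_gt0 ?ltr0n // !lnXn // !mulr_natl.
  by rewrite lnX lnD; move: ltE; rewrite entropyE; lra.
have bin_ge : q%:R ^+ q <= ('C(q, k + l))%:R * (q%:R ^+ l * D%:R) :> R.
  rewrite -!natrX -!natrM ler_nat; apply: leq_trans (bin_central_term (ltnW kq)) _.
  rewrite /D; have := bin_shift_le klq; move: (q ^ l)%N (k ^ k * _)%N => u v.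
  by move=> H; rewrite mulnCA [X in (_ <= X)%N]mulnA leq_mul.
rewrite -(ltr_nat R) natrM natrX -(ltr_pM2r X0).
have qlD : 0 < q%:R ^+ l * D%:R :> R by rewrite mulr_gt0 ?exprn_gt0 ?ltr0n.
apply: (@le_lt_trans _ _ (q%:R ^+ l)).
  rewrite -mulrA ger_pMr ?exprn_gt0 // mulrA.
  by apply: weil_majorant_le => //; rewrite !ltW.
rewrite -(ltr_pM2r qlD); apply: lt_le_trans main _.
by rewrite mulrAC ler_pM2r.
Qed.

End EntropyEstimates.

(** * Error terms in powers of the fourth root of [q] *)

Section Asymptotics.
Variable R : realType.
Variables (q l k : nat).
Hypothesis q_gt0 : (0 < q)%N.
Hypothesis l_gt0 : (0 < l)%N.
Let s : R := Num.sqrt (Num.sqrt q%:R).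

Lemma root4_ge1 : 1 <= s.
Proof.
have sqrt_ge1 (x : R) : 1 <= x -> 1 <= Num.sqrt x.
  by move=> x1; rewrite -{1}sqrtr1 ler_wsqrtr.
by apply/sqrt_ge1/sqrt_ge1; rewrite ler1n.
Qed.

Lemma root4_sqr : s * s = Num.sqrt q%:R.
Proof. by rewrite -expr2 sqr_sqrtr // sqrtr_ge0. Qed.

Lemma root4E : s * s * (s * s) = q%:R.
Proof. by rewrite root4_sqr -expr2 sqr_sqrtr ?ler0n. Qed.

Lemma ln_root4 : ln (2 * q%:R) <= 5 * s.
Proof.
have s1 := root4_ge1; have s0 : 0 < s by lra.
rewrite -root4E lnM ?posrE ?mulr_gt0 // !lnM ?posrE ?mulr_gt0 //.
have := ln_le_sub1 s0; have := @ln_le_sub1 R 2; move: (ln s) (ln 2) => u v; lra.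
Qed.

Hypothesis l_le : l%:R - 1 <= 2 * Num.sqrt q%:R :> R.

Lemma l_root4 : l%:R <= 3 * (s * s).
Proof.
have s1 := root4_ge1; move: l_le; rewrite -root4_sqr => H.
have : 1 <= s * s by nra.
move: (s * s) H => t; lra.
Qed.

(** Here [l] is at most [3 s^2] and [ln (2 q)] at most [5 s], so the left side is at most [55 s^3],
    against [d s^4]. *)
Lemma log_terms_lt (d : R) : 0 < d -> 55 / d < s ->
  (3 * l%:R + 2) * ln (2 * q%:R) < d * q%:R.
Proof.
move=> d0; rewrite ltr_pdivrMr // => lt_s; have s1 := root4_ge1.
have lnle := ln_root4; have lle := l_root4.
have L0 : 0 <= ln (2 * q%:R : R).
  have q1 : 1 <= q%:R :> R by rewrite ler1n.
  by apply: ln_ge0; lra.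
have t1 : 1 <= s * s by nra.
have l0 : 0 <= l%:R :> R by rewrite ler0n.
apply: (@le_lt_trans _ _ ((11 * (s * s)) * (5 * s))).
  by apply: ler_pM => //; move: (s * s) t1 lle => t; lra.
rewrite -root4E; have -> : 11 * (s * s) * (5 * s) = (s * s * s) * 55 by ring.
have -> : d * (s * s * (s * s)) = (s * s * s) * (s * d) by ring.
by rewrite ltr_pM2l // !mulr_gt0 //; lra.
Qed.

Hypothesis k_gt0 : (0 < k)%N.
Hypothesis k_lt : (k < q)%N.
Let c : R := k%:R / q%:R.

Lemma rate_gt0 : 0 < c.
Proof. by rewrite divr_gt0 ?ltr0n. Qed.

Lemma rate_lt1 : c < 1.
Proof. by rewrite ltr_pdivrMr ?ltr0n // mul1r ltr_nat. Qed.

(** With [t = sqrt (1 - c)], the entropy bound gives [s t > 55], so [q - k = (s t)^2 s^2] exceeds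
    [3 s^2], hence [l]. *)
Lemma room_of_entropy (d : R) : 0 < d -> 110 / d < s -> d <= entropy c -> (k + l <= q)%N.
Proof.
move=> d0; rewrite ltr_pdivrMr // => lt_s le_d; have s1 := root4_ge1.
have := le_trans le_d (entropy_le_sqrt rate_gt0 rate_lt1).
set t := Num.sqrt (1 - c) => le_dt.
have t2 : t * t = 1 - c by rewrite -expr2 sqr_sqrtr // subr_ge0 ltW ?rate_lt1.
have st : 55 < s * t by nra.
have : k%:R = c * q%:R :> R by rewrite /c divfK // gt_eqF ?ltr0n.
rewrite -root4E => kE; rewrite -(ler_nat R) natrD -root4E.
have lle := l_root4; rewrite (_ : k%:R = s * s * (s * s) - (s * t) * (s * t) * (s * s)); last first.
  have cE : c = 1 - t * t by rewrite t2; ring.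
  by rewrite kE cE; ring.
have ss : 1 <= s * s by nra.
have : 3 <= (s * t) * (s * t) by nra.
move: (s * t * (s * t)) (s * s) ss lle => u v; nra.
Qed.

Lemma eventually_lt (B p Q : nat) (r d : R) : (0 < p)%N -> 0 < r -> r < 1 ->
  0 < d -> 55 / d < s -> (k + l <= q)%N ->
  - (k + l)%:R * ln r - B%:R * ln (1 - r) - Q%:R * ln (1 - r ^+ p) <=
    q%:R * (entropy c - d) + (l%:R + 1) * ln (2 * q%:R) ->
  (q ^ l * weil_majorant B p Q (k + l) < 'C(q, k + l))%N.
Proof.
move=> p0 r0 r1 d0 lt_s klq H.
apply: (majorant_lt_bin p0 r0 r1 _ klq); first by rewrite k_gt0.
have qR : 1 <= q%:R :> R by rewrite ler1n.
have lt_d := log_terms_lt d0 lt_s.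
have ln1 : ln q%:R <= ln (2 * q%:R) :> R by rewrite ler_ln ?posrE; lra.
have ln2 : ln q.+1%:R <= ln (2 * q%:R) :> R by rewrite -natr1 ler_ln ?posrE; lra.
have l0 : 0 <= l%:R :> R by rewrite ler0n.
have ln3 : l%:R * ln q%:R <= l%:R * ln (2 * q%:R) :> R by rewrite ler_wpM2l.
rewrite -/c.
move: H lt_d ln1 ln2 ln3.
move: (ln (2 * q%:R)) (ln q%:R) (ln q.+1%:R) (ln r) (ln (1 - r)) (ln (1 - r ^+ p)) (entropy c) => L L1 L2 a1 a2 a3 h.
move: (k + l)%:R B%:R Q%:R (q%:R) (l%:R) => kl b qq Z y; lra.
Qed.

End Asymptotics.

(** * Saddle points under the two conditions *)

Section SaddlePoints.
Variable R : realType.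
Variables (p q Q l k : nat) (d : R).
Hypothesis p_gt1 : (1 < p)%N.
Hypothesis qE : q = (p * Q)%N.
Hypothesis Q_gt0 : (0 < Q)%N.
Hypothesis l_gt0 : (0 < l)%N.
Hypothesis k_gt0 : (0 < k)%N.
Hypothesis k_lt : (k < q)%N.
Hypothesis d_gt0 : 0 < d.
Local Notation c := (rate R q k).
Local Notation g := (gam R q l).
Local Notation L := (@ln R (2 * q%:R)).

Let q_gt0 : (0 < q)%N. Proof. exact: leq_ltn_trans k_lt. Qed.
Let qR : 1 <= q%:R :> R. Proof. by rewrite ler1n. Qed.
Let p_le_q : p%:R <= q%:R :> R. Proof. by rewrite ler_nat qE leq_pmulr. Qed.
Let pR : 2 <= p%:R :> R. Proof. by rewrite ler_nat. Qed.
Let c0 : 0 < c. Proof. exact: rate_gt0. Qed.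
Let c1 : c < 1. Proof. exact: rate_lt1. Qed.
Let kE : k%:R = c * q%:R. Proof. by rewrite /rate divfK // gt_eqF ?ltr0n. Qed.
Let QE : Q%:R = q%:R / p%:R :> R.
Proof. by rewrite qE natrM mulrAC divff ?mul1r // gt_eqF // ltr0n ltnW. Qed.
Let c_ge : 1 <= c * q%:R. Proof. by rewrite -kE ler1n. Qed.
Let l1 : 1 <= l%:R :> R. Proof. by rewrite ler1n. Qed.
Let sqrt_gt0 : 0 < Num.sqrt q%:R :> R. Proof. by rewrite sqrtr_gt0 ltr0n. Qed.

Lemma gam_ge0 : 0 <= g.
Proof. by rewrite /gam divr_ge0 ?subr_ge0 // ltW. Qed.

Lemma gam_mul : g * q%:R = (l%:R - 1) * Num.sqrt q%:R.
Proof.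
rewrite /gam -{2}(@sqr_sqrtr R q%:R) ?ler0n // expr2 mulrA; congr (_ * _).
by rewrite divfK // gt_eqF.
Qed.

Lemma gam_leP (b : R) : g <= b -> l%:R - 1 <= b * Num.sqrt q%:R.
Proof. by rewrite /gam ler_pdivrMr. Qed.

Variable B : nat.
Hypothesis B_le : B%:R <= g * q%:R + 1.

Let lnV_c_ge0 : 0 <= ln (1 / c). Proof. by rewrite ln1V // oppr_ge0 ln_le0 // ltW. Qed.

Section CondA.
Hypothesis H : condA d p q l k.

Let ln2p_ge : 1 / 2 <= ln (2 * p%:R) :> R.
Proof.
have p2_ := pR; have c0_ := c0; have c1_ := c1; have q1_ := qR; have pq_ := p_le_q.
have d0_ := d_gt0.
have p2 : 0 < 2 * p%:R :> R by lra.
have i0 : 0 < 1 / (2 * p%:R) :> R by rewrite divr_gt0.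
have h1 : 1 / (2 * p%:R) <= 1 / 2 :> R by rewrite ler_pdivrMr //; lra.
have := ln_le_sub1 i0; rewrite ln1V //.
by move: (1 / (2 * _)) (ln _) h1 => u v; lra.
Qed.

(** The entropy is at most 1 and [ln (2 p)] at least 1/2, which leaves room only for [g] at most
    2. *)
Lemma condA_facts : g <= 2 /\ d <= entropy c.
Proof.
have l2p_ := ln2p_ge.
have p2_ := pR; have c0_ := c0; have c1_ := c1; have q1_ := qR; have pq_ := p_le_q.
have d0_ := d_gt0.
have := H; rewrite /condA.
have h1 := entropy_le1 c0 c1.
have t1 : 0 <= (1 + c) / p%:R * ln (1 + c).
  by rewrite mulr_ge0 ?divr_ge0 ?ln_ge0 //; lra.
have t2 : (p%:R - 1) / p%:R * c * ln (1 / c) <= c * ln (1 / c).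
  rewrite ler_wpM2r // ger_pMl // ler_pdivrMr; lra.
have g0 := gam_ge0; have t3 : g * (1 / 2) <= g * ln (2 * p%:R) by rewrite ler_wpM2l.
move: h1 t1 t2 t3; rewrite /entropy.
move: (_ * ln (1 + c)) (c * ln (1 / c)) (_ * c * ln (1 / c)) (_ * ln (1 / (1 - c))) => u1 u2 u3 u4.
move: (g * ln _) => u5; split; lra.
Qed.

(* The saddle point [r ^ p = c / (1 + c)] of [(1 - r ^ p) ^ (- q / p) r ^ (- k)]. *)
Lemma condA_saddle : exists r : R, [/\ 0 < r, r < 1 &
  - (k + l)%:R * ln r - B%:R * ln (1 - r) - Q%:R * ln (1 - r ^+ p) <=
    q%:R * (entropy c - d) + (l%:R + 1) * L].
Proof.
have B_ := B_le.
have l2p_ := ln2p_ge.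
have p2_ := pR; have c0_ := c0; have c1_ := c1; have q1_ := qR; have pq_ := p_le_q.
have d0_ := d_gt0.
have p0 : 0 < p%:R :> R by lra.
have x0 : 0 < c / (1 + c) by rewrite divr_gt0 //; lra.
pose r := expR (ln (c / (1 + c)) / p%:R).
have rp : r ^+ p = c / (1 + c).
  by rewrite /r -expRM_natr divfK ?gt_eqF // lnK.
have r0 : 0 < r by apply: expR_gt0.
have r1 : r < 1.
  rewrite expR_lt1 pmulr_llt0 ?invr_gt0 //; apply: ln_lt0; rewrite x0 /=.
  by rewrite ltr_pdivrMr; lra.
exists r; split=> //.
have lnr : - ln r = (ln (1 / c) + ln (1 + c)) / p%:R.
  rewrite /r expRK ln_div ?posrE //; last by lra.
  by rewrite ln1V // -mulNr opprB addrC.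
have omrp : 1 - r ^+ p = 1 / (1 + c) by rewrite rp; field; lra.
have lnrp : - ln (1 - r ^+ p) = ln (1 + c) by rewrite omrp ln1V ?opprK //; lra.
(* From [1 - r^p <= p (1 - r)] and [1 - r^p = 1 / (1 + c) >= 1/2]; this explains [ln (2 p)] in
   Condition A. *)
have ln1r : - ln (1 - r) <= ln (2 * p%:R).
  have r1' : 0 < 1 - r by lra.
  rewrite -ln1V // ler_ln ?posrE ?divr_gt0 //; last by lra.
  rewrite ler_pdivrMr //.
  have := bernoulli_sub p (ltW r0) (ltW r1); rewrite omrp.
  have : 1 / 2 <= 1 / (1 + c) by rewrite ler_pdivlMr; lra.
  move: (1 / (1 + c)) => u; rewrite -mulrA; move: (p%:R * _) => v; lra.
have L_ge : ln (2 * p%:R) <= L.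
  by rewrite ler_ln ?posrE; lra.
have lcL : ln (1 / c) + ln (1 + c) <= L.
  have c1p : 0 < 1 + c by lra.
  have ic0 : 0 < 1 / c by rewrite divr_gt0.
  rewrite -(lnM (x := 1 / c)) ?posrE // ler_ln ?posrE ?(mulr_gt0 ic0 c1p) //; last by lra.
  rewrite mulrAC mul1r ler_pdivrMr //; move: c_ge; rewrite [c * _]mulrC => h.
  by rewrite -mulrA; move: (q%:R * c) h => u; lra.
have lc0 : 0 <= ln (1 / c) + ln (1 + c).
  have : 0 <= ln (1 + c) by apply: ln_ge0; lra.
  by move: lnV_c_ge0; lra.
have term1 : l%:R * ((ln (1 / c) + ln (1 + c)) / p%:R) <= l%:R * L.
  rewrite ler_wpM2l ?ler0n // ler_pdivrMr //.
  have p1 : 1 <= p%:R :> R by lra.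
  by apply: (le_trans lcL); apply: ler_peMr => //; apply: le_trans lc0 lcL.
have term2 : B%:R * - ln (1 - r) <= (g * q%:R + 1) * ln (2 * p%:R).
  apply: le_trans (_ : B%:R * ln (2 * p%:R) <= _).
    by rewrite ler_wpM2l ?ler0n.
  by rewrite ler_wpM2r //; lra.
have := H; rewrite /condA => HA.
have {}HA := ler_wpM2l (ler0n R q) HA.
have -> : - (k + l)%:R * ln r - B%:R * ln (1 - r) - Q%:R * ln (1 - r ^+ p) =
  c * q%:R * (- ln r) + l%:R * (- ln r) + B%:R * - ln (1 - r) + Q%:R * (- ln (1 - r ^+ p)).
  by rewrite natrD kE; ring.
rewrite lnr lnrp QE.
have -> : q%:R * (entropy c - d) + (l%:R + 1) * L =
  q%:R * (c * ln (1 / c) + (1 - c) * ln (1 / (1 - c)) - d) + l%:R * L + L.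
  by rewrite /entropy; ring.
(* At this [r], the terms of order [q] from [ln r] and [ln (1 - r^p)] are exactly the gap between
   the entropy and the expression in Condition A. *)
have E1 : q%:R * ((p%:R - 1) / p%:R * c * ln (1 / c) + (1 - c) * ln (1 / (1 - c)) -
     (1 + c) / p%:R * ln (1 + c)) =
  q%:R * (c * ln (1 / c) + (1 - c) * ln (1 / (1 - c))) -
  (c * q%:R * ((ln (1 / c) + ln (1 + c)) / p%:R) + q%:R / p%:R * ln (1 + c)).
  by field; lra.
rewrite E1 in HA.
have E2 : (g * q%:R + 1) * ln (2 * p%:R) = q%:R * (g * ln (2 * p%:R)) + ln (2 * p%:R) by ring.
rewrite E2 in term2; rewrite !mulrDr in HA.
move: HA term1 term2 L_ge.
move: (l%:R * ((ln (1 / c) + ln (1 + c)) / p%:R)) (B%:R * - ln (1 - r)) => v1 v2.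
move: (c * q%:R * ((ln (1 / c) + ln (1 + c)) / p%:R)) (q%:R / p%:R * ln (1 + c)) => v3 v4.
move: (q%:R * (g * ln (2 * p%:R))) (ln (2 * p%:R)) (l%:R * L) => v5 v6 v7.
rewrite mulrBr !mulrDr.
move: (q%:R * (c * _)) (q%:R * ((1 - c) * _)) (q%:R * d) => v8 v9 v10; lra.
Qed.

End CondA.

Section CondB.
Hypothesis H : condB d p q l k.

Let g_gt0 : 0 < g.
Proof.
have p2_ := pR; have c0_ := c0; have c1_ := c1; have q1_ := qR; have pq_ := p_le_q.
have d0_ := d_gt0.
have [h _] := H; apply: lt_le_trans h; rewrite divr_gt0 //; lra.
Qed.

Let ratio_ge1 : 1 <= (c + g) / g.
Proof.
by have c0_ := c0; have g0_ := g_gt0; rewrite ler_pdivlMr // mul1r; lra.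
Qed.

Let ratio_le : (c + g) / g <= 1 + p%:R.
Proof.
have p2_ := pR; have c0_ := c0; have c1_ := c1; have q1_ := qR; have pq_ := p_le_q.
have d0_ := d_gt0.
have g0_ := g_gt0.
have p0 : 0 < p%:R :> R by lra.
have [] := H; rewrite ler_pdivrMr // => h _.
by rewrite ler_pdivrMr //; lra.
Qed.

Lemma condB_facts : g <= 1 /\ d <= entropy c.
Proof.
have p2_ := pR; have c0_ := c0; have c1_ := c1; have q1_ := qR; have pq_ := p_le_q.
have d0_ := d_gt0.
have g0_ := g_gt0.
have [_] := H; rewrite -/(entropy c).
have h1 := entropy_le1 c0 c1.
have : 0 <= g * ln ((c + g) / g) by rewrite mulr_ge0 ?ln_ge0 // ltW.
by move: (g * _) => u; split; lra.
Qed.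

(* The saddle point [r = c / (c + g)] of [(1 - r) ^ (- g q) r ^ (- k)]; the factor
   [(1 - r ^ p) ^ (- q / p)] is negligible for large [p]. *)
Lemma condB_saddle : ln (1 + p%:R) / p%:R <= d / 2 -> exists r : R, [/\ 0 < r, r < 1 &
  - (k + l)%:R * ln r - B%:R * ln (1 - r) - Q%:R * ln (1 - r ^+ p) <=
    q%:R * (entropy c - d / 2) + (l%:R + 1) * L].
Proof.
have B_ := B_le.
have cq_ := c_ge.
have p2_ := pR; have c0_ := c0; have c1_ := c1; have q1_ := qR; have pq_ := p_le_q.
have d0_ := d_gt0.
have g0_ := g_gt0.
have rt_ := ratio_ge1; have rl_ := ratio_le.
move=> hp; have p0 : 0 < p%:R :> R by lra.
have cg0 : 0 < c + g by lra.
pose r := c / (c + g).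
have r0 : 0 < r by rewrite divr_gt0.
have r1 : r < 1 by rewrite ltr_pdivrMr //; lra.
exists r; split=> //.
have omr : 1 - r = 1 / ((c + g) / g) by rewrite /r; field; lra.
have t0 : 0 < (c + g) / g by lra.
set T := ln ((c + g) / g).
have ln1r : - ln (1 - r) = T by rewrite omr ln1V // opprK.
have T0 : 0 <= T by rewrite ln_ge0.
have T_le : T <= ln (1 + p%:R) by rewrite ler_ln ?posrE //; lra.
have L_ge : T <= L by apply: le_trans T_le _; rewrite ler_ln ?posrE; lra.
have gc : 0 < g / c by rewrite divr_gt0.
have lnr : - ln r = ln (1 + g / c).
  rewrite -ln1V //; congr ln; rewrite /r; field; lra.
have lnr_le : c * - ln r <= g.
  rewrite lnr; have := @le_ln1Dx R (g / c); rewrite (_ : -1 < g / c); last by lra.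
  move=> /(_ isT) h; apply: le_trans (_ : c * (g / c) <= _); first by rewrite ler_pM2l.
  by rewrite mulrCA divff ?mulr1 // gt_eqF.
have [g1 _] := condB_facts.
have lnr_L : - ln r <= L.
  have : g / c <= q%:R by rewrite ler_pdivrMr // [q%:R * _]mulrC; lra.
  by rewrite lnr ler_ln ?posrE; move: (g / c) gc => u; lra.
have term1 : l%:R * - ln r <= l%:R * L by rewrite ler_wpM2l ?ler0n.
have term0 : q%:R * (c * - ln r) <= q%:R * g by rewrite ler_wpM2l ?ler0n.
have term2 : B%:R * - ln (1 - r) <= (g * q%:R + 1) * T.
  by rewrite ln1r ler_wpM2r.
(* As [r^p <= r], the crude bound [T] is available, and [g >= c / p] gives [T <= ln (1 + p)]; the
   factor [Q = q / p] then makes the term small. *)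
have X_le : - ln (1 - r ^+ p) <= ln (1 + p%:R).
  apply: (le_trans _ T_le); rewrite -ln1r lerN2.
  have rp_le : r ^+ p <= r by rewrite ler_iXnr ?ltW // ltnW.
  have h1 : 0 < 1 - r by rewrite subr_gt0.
  have h2 : 0 < 1 - r ^+ p by rewrite subr_gt0 (le_lt_trans rp_le).
  by rewrite ler_ln ?posrE // lerD2l lerN2.
have term3 : Q%:R * - ln (1 - r ^+ p) <= q%:R * (d / 2).
  rewrite QE mulrAC -mulrA; apply: ler_wpM2l; first exact: ler0n.
  by apply: (le_trans _ hp); rewrite ler_pM2r ?invr_gt0.
have [_] := H; rewrite -/(entropy c) -/T => HB.
have {}HB := ler_wpM2l (ler0n R q) HB.
have -> : - (k + l)%:R * ln r - B%:R * ln (1 - r) - Q%:R * ln (1 - r ^+ p) =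
  q%:R * (c * - ln r) + l%:R * (- ln r) + B%:R * - ln (1 - r) + Q%:R * (- ln (1 - r ^+ p)).
  by rewrite natrD kE; ring.
have E2 : (g * q%:R + 1) * T = q%:R * (g * T) + T by ring.
have E3 : q%:R * (g + g * T + d) = q%:R * g + q%:R * (g * T) + q%:R * d by ring.
have E4 : (l%:R + 1) * L = l%:R * L + L by ring.
rewrite E2 in term2; rewrite E3 in HB; rewrite E4 mulrBr.
move: HB term0 term1 term2 term3 L_ge.
have -> : q%:R * (d / 2) = (q%:R * d) / 2 by rewrite mulrA.
move: (q%:R * (c * - ln r)) (l%:R * - ln r) (B%:R * - ln (1 - r)) (Q%:R * - ln (1 - r ^+ p)) => v1 v2 v3 v4.
move: (q%:R * g) (q%:R * (g * T)) (q%:R * d) (q%:R * entropy c) (l%:R * L) => v5 v6 v7 v8 v9; lra.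
Qed.

End CondB.
End SaddlePoints.

(** * Assembling the criterion and the estimates *)

(** The saddle point keeps a gain of [d / 2], Condition B having spent the other half. This gain
    absorbs the logarithmic terms, whence 110, twice the 55 of [log_terms_lt]. *)
Lemma ordinary_of_saddle (R : realType) (F : finFieldType) (p e l k : nat) (d : R) :
  prime p -> (0 < e)%N -> #|F| = (p ^ e)%N -> (0 < l)%N -> (0 < k)%N -> (k < #|F|)%N ->
  0 < d -> 110 / d < Num.sqrt (Num.sqrt #|F|%:R) ->
  gam R #|F| l <= 2 /\ d <= entropy (rate R #|F| k) ->
  (forall B Q, #|F| = (p * Q)%N -> B%:R <= gam R #|F| l * #|F|%:R + 1 ->
    exists r : R, [/\ 0 < r, r < 1 &
      - (k + l)%:R * ln r - B%:R * ln (1 - r) - Q%:R * ln (1 - r ^+ p) <=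
      #|F|%:R * (entropy (rate R #|F| k) - d / 2) + (l%:R + 1) * ln (2 * #|F|%:R)]) ->
  forall f : {poly F}, f \is monic -> size f = (k + l).+1 -> ordinary k f.
Proof.
move=> p_prime e0 cardF l0 k0 k_lt d0 lt_s [g2 d_le] saddle f mf sz_f.
have q0 : (0 < #|F|)%N by apply: leq_ltn_trans k_lt.
pose x : R := (l%:R - 1) * Num.sqrt #|F|%:R.
have l1 : 0 <= l%:R - 1 :> R by rewrite subr_ge0 ler1n.
have x0 : 0 <= x by rewrite mulr_ge0 ?sqrtr_ge0.
(* An integer above the Weil bound [(l - 1) sqrt q] by at most one. *)
pose B := (Num.truncn x).+1; pose Q := (p ^ e.-1)%N.
have qE : #|F| = (p * Q)%N by rewrite cardF -expnS prednK.
have B_le : B%:R <= gam R #|F| l * #|F|%:R + 1.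
  by rewrite (gam_mul R l k_lt) -natr1 lerD2r truncn_le.
have B_ge : (l.-1 ^ 2 * #|F| <= B ^ 2)%N.
  rewrite -(ler_nat R) natrM !natrX -[X in _ * X](@sqr_sqrtr R) ?ler0n // -exprMn.
  rewrite ler_pXn2r ?nnegrE ?mulr_ge0 ?sqrtr_ge0 ?ler0n //.
  by rewrite -subn1 natrB // ltW // truncnS_gt.
have [r [r0 r1 Hr]] := saddle B Q qE B_le.
have l_le : l%:R - 1 <= 2 * Num.sqrt #|F|%:R :> R by apply: (gam_leP k_lt g2).
have p0 := prime_gt0 p_prime.
apply: (ordinary_criterion p_prime cardF l0 mf sz_f B_ge (weil_majorant0 B p Q)).
  by move=> n; rewrite qE; apply: weil_majorant_rec.
have klq := room_of_entropy q0 l_le k0 k_lt d0 lt_s d_le.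
apply: (eventually_lt q0 l_le k0 k_lt p0 r0 r1 _ _ klq Hr); first by rewrite divr_gt0.
by rewrite invf_div mulrA -[55 * 2]/(_ : R) (_ : 55 * 2 = 110) //; ring.
Qed.

Lemma root4_gt (R : realType) (a : R) (n : nat) : 0 < a ->
  (Num.truncn (a ^+ 4) < n)%N -> a < Num.sqrt (Num.sqrt n%:R).
Proof.
move=> a0; rewrite truncn_lt_nat ?exprn_ge0 ?ltW // => lt_n.
rewrite -(ltr_pXn2r (n := 2)) ?nnegrE ?sqrtr_ge0 ?ltW // sqr_sqrtr ?sqrtr_ge0 //.
rewrite -(ltr_pXn2r (n := 2)) ?nnegrE ?sqrtr_ge0 ?exprn_ge0 ?ltW // sqr_sqrtr ?ler0n //.
by rewrite -exprM.
Qed.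

(** With [t = sqrt n], [ln (1 + n) <= 2 ln (2 t) <= 4 t], and [4 / t < d / 2] once
    [n > 64 / d^2]. *)
Lemma ln1Dn_small (R : realType) (d : R) (n : nat) : 0 < d ->
  (Num.truncn (64 / d ^+ 2) < n)%N -> ln (1 + n%:R) / n%:R <= d / 2.
Proof.
move=> d0; have a0 : 0 <= 64 / d ^+ 2 by rewrite divr_ge0 ?exprn_ge0 // ltW.
move=> lt_n; have n_gt0 : (0 < n)%N by apply: leq_ltn_trans lt_n.
move: lt_n; rewrite truncn_lt_nat // ltr_pdivrMr ?exprn_gt0 // => lt_n.
have n1 : 1 <= n%:R :> R by rewrite ler1n.
set t := Num.sqrt (n%:R : R); have t2 : t * t = n%:R by rewrite -expr2 sqr_sqrtr ?ler0n.
have t0 : 0 < t by rewrite sqrtr_gt0 ltr0n.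
have t1 : 1 <= t by nra.
have dt : 8 < d * t.
  rewrite -(ltr_pXn2r (n := 2)) ?nnegrE ?mulr_ge0 ?(ltW d0) ?(ltW t0) //.
  by rewrite exprMn [t ^+ 2]expr2 t2 mulrC (_ : 8 ^+ 2 = 64) //; ring.
have ln_t : ln (1 + n%:R) <= 4 * t.
  apply: (@le_trans _ _ (ln ((2 * t) * (2 * t)))).
    by rewrite ler_ln ?posrE ?mulr_gt0 //; nra.
  rewrite lnM ?posrE ?mulr_gt0 //.
  have := @ln_le_sub1 R (2 * t); rewrite mulr_gt0 // => /(_ isT); lra.
rewrite ler_pdivrMr ?ltr0n //; apply: (le_trans ln_t); rewrite -t2.
have : 0 <= (d * t - 8) * t by rewrite mulr_ge0 ?subr_ge0 // ltW.
rewrite mulrBl; have -> : d / 2 * (t * t) = (d * t * t) / 2 by ring.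
by move: (d * t * t) => u; lra.
Qed.

Local Open Scope classical_set_scope.
Local Open Scope ring_scope.

Theorem corollary2 (R : realType) (delta0 : R) (p q l k : nat -> nat)
    (delta0_gt0 : 0 < delta0)
    (p_prime : forall n : nat, prime (p n))
    (q_pow : forall n : nat, exists2 e : nat, (0 < e)%N & q n = (p n ^ e)%N)
    (l_ge1 : forall n : nat, (1 <= l n)%N)
    (k_ge1 : forall n : nat, (1 <= k n)%N)
    (k_ltq : forall n : nat, (k n < q n)%N)
    (q_cvg : q @ \oo --> \oo)
    (cond : (forall n : nat, condA delta0 (p n) (q n) (l n) (k n)) \/
            (p @ \oo --> \oo /\
             forall n : nat, condB delta0 (p n) (q n) (l n) (k n))) :
  exists q0 : nat, forall n : nat, (q0 <= q n)%N ->
    forall F : finFieldType, #|F| = q n ->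
      (forall f : {poly F}, f \is monic -> size f = (k n + l n).+1 ->
         ordinary (k n) f) /\
      (forall f : {poly F}, f \is monic -> size f = (k n + l n).+1 ->
         ~ deep_hole (k n) f).
Proof.
pose N := (Num.truncn ((110 / delta0) ^+ 4)).+1.
(* Under Condition B the growth of [p] enters through the smallness of [ln (1 + p) / p]; the other
   estimates hold once [q] passes the bound [N], which depends on [delta0] alone. *)
suff [q0 q0P] : exists q0 : nat, forall n, (q0 <= q n)%N ->
    condA delta0 (p n) (q n) (l n) (k n) \/
    condB delta0 (p n) (q n) (l n) (k n) /\ ln (1 + (p n)%:R) / (p n)%:R <= delta0 / 2.
  exists (maxn q0 N) => n; rewrite geq_max => /andP[le_q0 le_N] F cardF.
  suff ord (f : {poly F}) : f \is monic -> size f = (k n + l n).+1 -> ordinary (k n) f.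
    split=> // f mf sz_f; apply: (ordinary_not_deep_hole (l_ge1 n) sz_f).
    exact: ord.
  have [e e_gt0 qE] := q_pow n; have p_gt1 := prime_gt1 (p_prime n).
  have cardFp : #|F| = (p n ^ e)%N by rewrite cardF.
  have k_ltF : (k n < #|F|)%N by rewrite cardF.
  have Q_gt0 : (0 < p n ^ e.-1)%N by rewrite expn_gt0 ltnW.
  have qE' : #|F| = (p n * p n ^ e.-1)%N by rewrite cardFp -expnS prednK.
  have s_gt : 110 / delta0 < Num.sqrt (Num.sqrt #|F|%:R).
    by rewrite cardF; apply: root4_gt => //; rewrite divr_gt0.
  move: f; apply: (ordinary_of_saddle (p_prime n) e_gt0 cardFp (l_ge1 n) (k_ge1 n) k_ltF delta0_gt0 s_gt).
    case: (q0P n le_q0) => [H|[H _]]; rewrite -cardF in H.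
      exact: (condA_facts p_gt1 qE' Q_gt0 (l_ge1 n) (k_ge1 n) k_ltF delta0_gt0 H).
    have [g1 ->] := condB_facts p_gt1 qE' Q_gt0 (k_ge1 n) k_ltF delta0_gt0 H.
    by split=> //; apply: le_trans g1 _; rewrite ler1n.
  move=> B Q qQ B_le; have Q0 : (0 < Q)%N.
    by case: (Q) qQ => //; rewrite muln0 => F0; rewrite F0 in k_ltF.
  case: (q0P n le_q0) => [H|[H hp]]; rewrite -cardF in H; last first.
    exact: (condB_saddle p_gt1 qQ Q0 (k_ge1 n) k_ltF delta0_gt0 B_le H hp).
  have [r [r0 r1 le_r]] := condA_saddle p_gt1 qQ Q0 (k_ge1 n) k_ltF delta0_gt0 B_le H.
  exists r; split=> //; apply: (le_trans le_r); rewrite lerD2r ler_wpM2l // lerD2l lerN2.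
  by rewrite ler_pdivrMr // ler_peMr ?ler1n // ltW.
case: cond => [HA|[p_cvg HB]]; first by exists 0%N => n _; left.
have /cvgnyPge/(_ (Num.truncn (64 / delta0 ^+ 2)).+1)[n0 _ n0P] := p_cvg.
(* A value [q n] above the sum of the first [n0] values forces [n >= n0]: largeness of the index is
   turned into largeness of [q]. *)
exists (\sum_(i < n0) q i).+1 => n le_n; right; split; first exact: HB.
apply: ln1Dn_small => //; apply: n0P; rewrite /= leqNgt; apply/negP => lt_n.
by move: le_n; rewrite (bigD1 (Ordinal lt_n)) //= ltnNge leq_addr.
Qed.
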